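(* Suppose $\mathbb{X}$ is a Banach space with a basis such that, for some $1<q<\infty$, either $B_{\infty,q}$ or $B_{1,q}$ is isomorphic to a complemented subspace of $\mathbb{X}$. Then $\mathbb{X}$ has an almost greedy basis $\mathcal{B}_\kappa$ with fundamental function equivalent to $(m^{1/q})_{m=1}^\infty$ and such that $L_m[\mathcal{B}_\kappa,\mathbb{X}]\approx\log m$ for $m\ge2$.
   Context: For $p\in[1,\infty]$ and $1\le q<\infty$, $B_{p,q}=(\bigoplus_{n=1}^\infty\ell_p^n)_q$ is the direct sum, in the $\ell_q$-sense, of the $n$-dimensional spaces $\ell_p^n$, $n\in\mathbb{N}$. A basis $\mathcal{B}=(x_j)_{j=1}^\infty$ of a (real or complex) Banach space $\mathbb{X}$ is a Schauder basis, always assumed semi-normalized, i.e. $0<\inf_j\Vert x_j\Vert\le\sup_j\Vert x_j\Vert<\infty$; $(x_j^* )_{j=1}^\infty$ are its coordinate functionals. For $A\subseteq\mathbb{N}$, $S_A(f)=\sum_{j\in A}x_j^*(f)x_j$ (when well defined), and $\operatorname{supp}(f)=\{j: x_j^*(f)\ne0\}$. Define $$L_m[\mathcal{B},\mathbb{X}]=\sup\left\{\frac{\Vert S_A(f)\Vert}{\Vert f\Vert}: f\in\mathbb{X}\setminus\{0\},\ \max(\operatorname{supp}(f))\le m,\ A\subseteq\mathbb{N}\right\}.$$ The basis is almost greedy if there is a constant $C$ with $\Vert f-S_F(f)\Vert\le C\Vert f-S_A(f)\Vert$ whenever $f\in\mathbb{X}$, $|A|\le|F|<\infty$, and $|x_j^*(f)|\le|x_k^*(f)|$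 for all $j\in\mathbb{N}\setminus F$, $k\in F$. Its fundamental function is $\varphi_m[\mathcal{B},\mathbb{X}]=\sup_{|A|\le m}\Vert\sum_{j\in A}x_j\Vert$, $m\in\mathbb{N}$. For families of non-negative numbers, $\alpha_i\lesssim\beta_i$ means there is a constant $C$ with $\alpha_i\le C\beta_i$ for all $i$; $\alpha_i\approx\beta_i$ (equivalence) means $\alpha_i\lesssim\beta_i$ and $\beta_i\lesssim\alpha_i$. *)

(* Defs.v *)
From HB Require Import structures.
From mathcomp Require Import all_boot all_order all_algebra finmap.
From mathcomp Require Import complex.
From mathcomp Require Import all_classical all_reals all_analysis.
Set Implicit Arguments.
Unset Strict Implicit.
Unset Printing Implicit Defensive.
Import Order.TTheory GRing.Theory Num.Theory numFieldNormedType.Exports.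
Local Open Scope classical_set_scope.
Local Open Scope ring_scope.

(* Banach spaces over R and over C are treated uniformly. *)
Variant scalar_kind := RealScalars | ComplexScalars.

Definition scalar_field (R : realType) (s : scalar_kind) : numFieldType :=
  match s with RealScalars => R | ComplexScalars => complex R end.

Definition scalar_re (R : realType) (s : scalar_kind) : scalar_field R s -> R :=
  match s with RealScalars => fun z => z | ComplexScalars => @complex.Re R end.

(* MathComp norms take their values in the scalar field, in C for complex
   spaces; those values are nonnegative reals and [rnorm] reads them in R. *)
Definition rnorm (R : realType) (s : scalar_kind)
  (V : normedZmodType (scalar_field R s)) (v : V) : R := scalar_re `|v|.

Section Families.
Context {R : realType}.
Local Open Scope ereal_scope.

Definition lesssim_on (D : set nat) (a b : nat -> \bar R) :=
  exists C : R, forall i, D i -> a i <= C%:E * b i.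

Definition equivalent_on (D : set nat) (a b : nat -> \bar R) :=
  lesssim_on D a b /\ lesssim_on D b a.

End Families.

Section Bpq.
Context {R : realType} {s : scalar_kind}.
Local Notation K := (scalar_field R s).

(* The value at [p = -oo] is junk. *)
Definition lp_norm (p : \bar R) (n : nat) (v : 'I_n -> K) : R :=
  match p with
  | EFin r => (\sum_(i < n) rnorm (v i) `^ r) `^ r^-1
  | +oo%E => \big[Num.max/0]_(i < n) rnorm (v i)
  | -oo%E => 0
  end.

(* A sequence of vectors v_n in K^n, n >= 1, is coded as one function of
   the pair (n, i) with i < n; the block [n] below is the one of dimension
   [n.+1]. *)
Definition bidx : Type := {n : nat & 'I_n.+1}.

Definition block (f : bidx -> K) (n : nat) : 'I_n.+1 -> K :=
  fun i => f (existT (fun n : nat => 'I_n.+1) n i).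

Definition Bpq_qsum (p : \bar R) (q : R) (f : bidx -> K) : \bar R :=
  (\sum_(0 <= n <oo) (lp_norm p (@block f n) `^ q)%:E)%E.

Definition Bpq (p : \bar R) (q : R) : set (bidx -> K) :=
  [set f | (Bpq_qsum p q f < +oo)%E].

Definition Bpq_norm (p : \bar R) (q : R) (f : bidx -> K) : R :=
  fine (Bpq_qsum p q f) `^ q^-1.

End Bpq.

Section Subspaces.
Context {R : realType} {s : scalar_kind}.
Local Notation K := (scalar_field R s).
Variable X : normedModType K.

Definition complemented (Y : set X) :=
  exists P : {linear X -> X},
    [/\ continuous P, forall v, P (P v) = P v & range P = Y].

(* [T] only matters on the subspace [Bpq p q] of all families. *)
Definition Bpq_embedding (p : \bar R) (q : R) (T : (bidx -> K) -> X) :=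
  [/\ forall (a : K) f g, Bpq p q f -> Bpq p q g ->
        T (fun i => a * f i + g i) = a *: T f + T g,
      exists C : R, forall f, Bpq p q f ->
        rnorm (T f) <= C * Bpq_norm p q f
    & exists2 c : R, 0 < c & forall f, Bpq p q f ->
        c * Bpq_norm p q f <= rnorm (T f)].

Definition Bpq_complemented_in (p : \bar R) (q : R) :=
  exists T : (bidx -> K) -> X,
    Bpq_embedding p q T /\ complemented (T @` Bpq p q).

End Subspaces.

(* Basis vectors are indexed from 0, so that the first m of them are those
   with index in [`I_m]. *)
Section Bases.
Context {R : realType} {s : scalar_kind}.
Local Notation K := (scalar_field R s).
Context {X : normedModType K}.
Implicit Types (x : nat -> X) (f : X).

Definition expansion x f (a : nat -> K) :=
  series (fun j => a j *: x j) @ \oo --> f.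

Definition schauder_basis x := forall f, exists! a, expansion x f a.

Definition semi_normalized x :=
  exists c C : R, 0 < c /\ forall j, c <= rnorm (x j) <= C.

Definition banach_basis x := schauder_basis x /\ semi_normalized x.

Definition basis_coord x f : nat -> K := xget (fun=> 0) [set a | expansion x f a].

Definition basis_supp x f : set nat := [set j | basis_coord x f j != 0].

Definition basis_proj x (A : set nat) f : X :=
  lim (series (fun j => if j \in A then basis_coord x f j *: x j else 0) @ \oo).

Definition Lconst x (m : nat) : \bar R :=
  ereal_sup [set r | exists (f : X) (A : set nat),
    [/\ f != 0, basis_supp x f `<=` `I_m
      & r = (rnorm (basis_proj x A f) / rnorm f)%:E]].

Definition almost_greedy x :=
  exists C : R, forall (f : X) (A F : {fset nat}),
    (#|` A| <= #|` F|)%N ->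
    (forall j k, j \notin F -> k \in F ->
      rnorm (basis_coord x f j) <= rnorm (basis_coord x f k)) ->
    rnorm (f - basis_proj x [set` F] f) <= C * rnorm (f - basis_proj x [set` A] f).

Definition fundamental_function x (m : nat) : \bar R :=
  ereal_sup [set r | exists2 A : {fset nat}, (#|` A| <= m)%N
    & r = (rnorm (\sum_(j <- A) x j))%:E].

End Bases.

(* Main.v *)
Require Import Defs.
From HB Require Import structures.
From mathcomp Require Import all_boot all_order all_algebra finmap.
From mathcomp Require Import complex zify ring lra.
From mathcomp Require Import all_classical all_reals all_analysis.
Set Implicit Arguments.
Unset Strict Implicit.
Unset Printing Implicit Defensive.
Import Order.TTheory GRing.Theory Num.Theory numFieldNormedType.Exports.
Local Open Scope classical_set_scope.
Local Open Scope ring_scope.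

(** The basis is obtained by the construction of Dilworth, Kalton and Kutzarova,
    applied to the unit vectors of a complemented copy of l_q and to a basic
    sequence y that is as conditional as possible.

    The construction. Let e_j be equivalent to the unit vectors of l_q, cut into
    blocks of sizes 2^n, and let y be a basic sequence, bounded above and below.
    In block n the vector e_j is replaced by z_j = e_j - A_n + rho^n 2^-n y_n,
    where A_n is the average of the block and rho = 2^(1/q). A combination of the
    z_j with coefficients a then has two parts: the vectors e_j with the
    coefficients a_j minus their block averages, and the vectors y_n with the block
    averages multiplied by rho^n (psum_dkk). The first part is an l_q norm. The
    second is as conditional as y, but a combination with few coefficients has
    small averages on long blocks because rho < 2, so that neither greedy
    projections nor sums of m basis vectors notice it: projections onto the
    coefficients above a threshold are bounded (dkk_threshold) and sums of m
    vectors have norm of the order of m^(1/q) (dkk_upper and dkk_threshold).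
    Almost greediness follows by comparing F \ A with A \ F.

    The conditionality. Inside a block the new basis is equivalent to the unit
    vectors of l_q, and m indices meet about log m blocks, so that L_m is at most
    of the order of log m (dkk_conditionality_upper). Coefficients constant on
    blocks reproduce the sequence y, so that L_m is at least the conditionality of
    the first log m terms of y (dkk_conditionality_lower). It remains to have y
    conditional of linear order.

    The sequence y. The space B_(p,q) with p = 1 or p = oo contains, at disjoint
    sets of positions, a copy of itself, a copy of l_q and blocks isometric to
    l_p^(2^n). Hence X contains a copy of itself, together with a complementary
    sequence space with these two parts (shift_decomposition). The l_p blocks have
    bases with constants independent of n and conditionality of the order of
    their dimension: the difference basis for p = 1 and the summing basis for
    p = oo (l1_block_basis, linf_block_basis). Interleaving them with the copy of
    the given basis of X, with the remaining unit vectors and with the block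
    averages of the l_q basis gives y (exists_dkk_data); the averages are included
    because the vectors z_j no longer contain them, and with them the z_j span X.

    Boundedness of the partial sum operators of the given basis is proved by the
    open mapping argument (basis_constant), and a basic sequence with dense span is
    a basis (basic_seq_basis), so that everything else concerns finite sums. *)

(** * Norms with real values *)

Section RealNorm.
Context {R : realType} {s : scalar_kind}.
Local Notation K := (scalar_field R s).

Definition real_scalar : R -> K :=
  match s return R -> scalar_field R s with
  | RealScalars => fun r => r
  | ComplexScalars => fun r => r%:C%C
  end.

Lemma real_scalarD a b : real_scalar (a + b) = real_scalar a + real_scalar b.
Proof. by rewrite /real_scalar; case: s => //; rewrite rmorphD. Qed.

Lemma real_scalarM a b : real_scalar (a * b) = real_scalar a * real_scalar b.
Proof. by rewrite /real_scalar; case: s => //; rewrite rmorphM. Qed.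

Lemma real_scalar1 : real_scalar 1 = 1.
Proof. by rewrite /real_scalar; case: s => //; rewrite rmorph1. Qed.

Lemma real_scalar0 : real_scalar 0 = 0.
Proof. by rewrite /real_scalar; case: s => //; rewrite rmorph0. Qed.

Lemma real_scalarN a : real_scalar (- a) = - real_scalar a.
Proof. by rewrite /real_scalar; case: s => //; rewrite rmorphN. Qed.

Lemma real_scalar_natr n : real_scalar n%:R = n%:R.
Proof. by rewrite /real_scalar; case: s => //; rewrite rmorph_nat. Qed.

Lemma ler_real_scalar a b : (real_scalar a <= real_scalar b) = (a <= b).
Proof. by rewrite /real_scalar; case: s => //; rewrite lecR. Qed.

Lemma ltr_real_scalar a b : (real_scalar a < real_scalar b) = (a < b).
Proof. by rewrite /real_scalar; case: s => //; rewrite ltcR. Qed.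

Lemma real_scalar_inj : injective real_scalar.
Proof. by rewrite /real_scalar; case: s => // a b []. Qed.

Lemma ge0_real_scalar (k : K) : 0 <= k -> exists2 r : R, 0 <= r & k = real_scalar r.
Proof.
move: k; rewrite /real_scalar; case: s => [k k0|[a b]]; first by exists k.
by rewrite lecE /= => /andP[/eqP -> ha]; exists a.
Qed.

Lemma real_scalarK (r : R) : scalar_re (real_scalar r) = r.
Proof. by rewrite /real_scalar /scalar_re; case: s. Qed.

Section Module.
Variable V : normedZmodType K.
Implicit Types u v : V.

Lemma normE_rnorm v : `|v| = real_scalar (rnorm v).
Proof.
by rewrite /rnorm; have [r _ ->] := ge0_real_scalar (normr_ge0 v); rewrite real_scalarK.
Qed.

Lemma rnorm_ge0 v : 0 <= rnorm v.
Proof. by rewrite -ler_real_scalar real_scalar0 -normE_rnorm. Qed.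

Lemma rnorm_eq0 v : (rnorm v == 0) = (v == 0).
Proof.
rewrite -(normr_eq0 v) normE_rnorm -real_scalar0.
by apply/eqP/eqP => [->|/real_scalar_inj].
Qed.

Lemma rnorm0 : rnorm (0 : V) = 0.
Proof. by apply/eqP; rewrite rnorm_eq0. Qed.

Lemma rnorm_gt0 v : (0 < rnorm v) = (v != 0).
Proof. by rewrite lt_neqAle rnorm_ge0 andbT eq_sym rnorm_eq0. Qed.

Lemma rnormD u v : rnorm (u + v) <= rnorm u + rnorm v.
Proof. by rewrite -ler_real_scalar real_scalarD -!normE_rnorm ler_normD. Qed.

Lemma rnormN v : rnorm (- v) = rnorm v.
Proof. by rewrite /rnorm normrN. Qed.

Lemma rnormB u v : rnorm (u - v) <= rnorm u + rnorm v.
Proof. by rewrite -[in leRHS](rnormN v) rnormD. Qed.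

Lemma rnorm_distC u v : rnorm (u - v) = rnorm (v - u).
Proof. by rewrite -rnormN opprB. Qed.

Lemma rnorm_dist w u v : rnorm (u - v) <= rnorm (u - w) + rnorm (w - v).
Proof. by rewrite -[u - v](subrKA w); exact: rnormD. Qed.

Lemma rnorm_le_dist u v : rnorm u <= rnorm v + rnorm (u - v).
Proof. by rewrite -{1}[u](addrNK v) addrC rnormD. Qed.

Lemma rnorm_sum I (r : seq I) (P : pred I) (F : I -> V) :
  rnorm (\sum_(i <- r | P i) F i) <= \sum_(i <- r | P i) rnorm (F i).
Proof.
elim/big_rec2: _ => [|i a v _ h]; first by rewrite rnorm0.
by rewrite (le_trans (rnormD _ _))// lerD2l.
Qed.

End Module.

Lemma rnormM (a b : K) : rnorm (a * b) = rnorm a * rnorm b.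
Proof. by apply: real_scalar_inj; rewrite real_scalarM -!normE_rnorm normrM. Qed.

Lemma rnorm1 : rnorm (1 : K) = 1.
Proof. by apply: real_scalar_inj; rewrite -normE_rnorm normr1 real_scalar1. Qed.

Lemma rnorm_real (r : R) : rnorm (real_scalar r) = `|r|.
Proof.
have ge0 (a : R) : 0 <= a -> rnorm (real_scalar a) = a.
  move=> a0; apply: real_scalar_inj; rewrite -normE_rnorm ger0_norm//.
  by rewrite -real_scalar0 ler_real_scalar.
have [r0|r0] := leP 0 r; first by rewrite ger0_norm// ge0.
by rewrite -rnormN -real_scalarN ge0 ?ltr0_norm// oppr_ge0 ltW.
Qed.

Lemma rnormZ (V : normedModType K) (a : K) (v : V) :
  rnorm (a *: v) = rnorm a * rnorm v.
Proof. by apply: real_scalar_inj; rewrite real_scalarM -!normE_rnorm normrZ. Qed.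

(** Neighbourhoods are indexed by positive elements of the scalar field, which
    are real, so that epsilons may be taken in R over both fields. *)
Lemma rcvgP (V : normedModType K) (u : nat -> V) (l : V) :
  u @ \oo --> l <->
  forall e : R, 0 < e -> exists N, forall n, (N <= n)%N -> rnorm (u n - l) < e.
Proof.
split=> [h e e0|h].
  have e0' : (0 : K) < real_scalar e by rewrite -real_scalar0 ltr_real_scalar.
  have /cvgrPdist_lt/(_ _ e0')[N _ hN] := h.
  exists N => n /hN /=.
  by rewrite normE_rnorm ltr_real_scalar rnorm_distC.
apply/cvgrPdist_lt => e e0.
have [r r0 er] := ge0_real_scalar (ltW e0).
have r0' : 0 < r by rewrite -ltr_real_scalar real_scalar0 -er.
have [N hN] := h _ r0'.
exists N => // n /= /hN hn.
by rewrite normE_rnorm er ltr_real_scalar rnorm_distC.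
Qed.

Definition rcauchy (V : normedZmodType K) (u : nat -> V) :=
  forall e : R, 0 < e ->
    exists N, forall m n, (N <= m)%N -> (N <= n)%N -> rnorm (u m - u n) < e.

Lemma rcauchy_cvg (V : completeNormedModType K) (u : nat -> V) :
  rcauchy u -> exists l : V, u @ \oo --> l.
Proof.
move=> h; suff : cvgn u by move=> hu; exists (limn u).
apply: cauchy_cvg; apply: cauchy_exP => e e0.
have [r r0 er] := ge0_real_scalar (ltW e0).
have r0' : 0 < r by rewrite -ltr_real_scalar real_scalar0 -er.
have [N hN] := h _ r0'.
exists (u N), N => // n /= Nn.
by rewrite -ball_normE /ball_ /= normE_rnorm er ltr_real_scalar hN.
Qed.

Lemma rcvg_unique (V : normedModType K) (u : nat -> V) (l l' : V) :
  u @ \oo --> l -> u @ \oo --> l' -> l = l'.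
Proof.
move=> /rcvgP h /rcvgP h'; apply/eqP; rewrite -subr_eq0 -rnorm_eq0 -[_ == _]negbK.
apply/negP => n0; have e0 : 0 < rnorm (l - l') / 2.
  by rewrite divr_gt0// lt_neqAle eq_sym n0 rnorm_ge0.
have [N hN] := h _ e0; have [N' hN'] := h' _ e0.
have := ltrD (hN _ (leq_maxl N N')) (hN' _ (leq_maxr N N')).
rewrite -splitr rnorm_distC => /(le_lt_trans (rnorm_dist _ _ _)).
by rewrite ltxx.
Qed.

Lemma linear_rbounded (V : normedModType K) (P : {linear V -> V}) :
  continuous P -> exists2 C : R, 0 < C & forall v, rnorm (P v) <= C * rnorm v.
Proof.
move=> /(_ 0) h0; have /cvgrPdist_lt/(_ 1 ltr01) : P x @[x --> 0] --> (0 : V).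
  by rewrite -[X in _ --> X](linear0 P).
rewrite nearE => /nbhs_ballP[d /= d0 hd].
have [r r0 dr] := ge0_real_scalar (ltW d0).
have {}r0 : 0 < r by rewrite -ltr_real_scalar real_scalar0 -dr.
exists (2 / r) => [|v]; first by rewrite divr_gt0.
have [->|v0] := eqVneq v 0; first by rewrite linear0 !rnorm0 mulr0.
have nv0 : 0 < rnorm v by rewrite rnorm_gt0.
pose a : K := real_scalar (r / 2 / rnorm v).
have na : rnorm a = r / 2 / rnorm v by rewrite rnorm_real gtr0_norm// !divr_gt0.
have /hd : ball 0 d (a *: v).
  rewrite -ball_normE /ball_ /= sub0r normrN normE_rnorm dr ltr_real_scalar.
  by rewrite rnormZ na divfK ?gt_eqF// ltr_pdivrMr// ltr_pMr// ltr1n.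
rewrite /= sub0r normrN linearZ normE_rnorm -real_scalar1 ltr_real_scalar.
rewrite rnormZ na => /ltW; rewrite mulrAC ler_pdivrMr// mul1r.
by rewrite -ler_pdivlMl ?invf_div// divr_gt0.
Qed.

(** The scalar fields are complete: over C, real and imaginary parts are
    dominated by the modulus and dominate it together. *)
Lemma scalar_rcauchy (u : nat -> K) : rcauchy u ->
  exists l : K, forall e : R, 0 < e ->
    exists N, forall n, (N <= n)%N -> rnorm (u n - l) < e.
Proof.
have realC (v : nat -> R) : (forall e : R, 0 < e -> exists N, forall m n,
    (N <= m)%N -> (N <= n)%N -> `|v m - v n| < e) ->
  exists l : R, forall e : R, 0 < e ->
    exists N, forall n, (N <= n)%N -> `|v n - l| < e.
  move=> h; suff : cvgn v.
    move=> /cvg_ex[l /cvgrPdist_lt hl]; exists l => e /hl[N _ hN].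
    by exists N => n /hN /=; rewrite distrC.
  apply: cauchy_cvg; apply: cauchy_exP => e e0; have [N hN] := h _ e0.
  by exists (v N), N => // n /= Nn; rewrite -ball_normE /ball_ /=; exact: hN.
move: u; rewrite /rcauchy /rnorm; case: s => /= u hu; first exact: realC.
have Re_le (z : R[i]) : `|complex.Re z| <= Normc.normc z.
  by case: z => x y /=; rewrite -sqrtr_sqr ler_wsqrtr// lerDl sqr_ge0.
have Im_le (z : R[i]) : `|complex.Im z| <= Normc.normc z.
  by case: z => x y /=; rewrite -sqrtr_sqr ler_wsqrtr// lerDr sqr_ge0.
have proj (f : R[i] -> R) : (forall z, `|f z| <= Normc.normc z) ->
    (forall x y, f (x - y) = f x - f y) -> exists l : R, forall e : R, 0 < e ->
    exists N, forall n, (N <= n)%N -> `|f (u n) - l| < e.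
  move=> fle fB; apply: (realC (f \o u)) => e /hu[N hN]; exists N => m n Nm Nn /=.
  by rewrite -fB (le_lt_trans (fle _)) ?hN.
have [a ha] := proj _ Re_le (raddfB _).
have [b hb] := proj _ Im_le (raddfB _).
exists (Complex a b) => e e0; have e2 : 0 < e / 2 by rewrite divr_gt0.
have [N hN] := ha _ e2; have [M hM] := hb _ e2.
exists (maxn N M) => n; rewrite geq_max => /andP[/hN h1 /hM h2].
have -> : u n - Complex a b = (complex.Re (u n) - a)%:C%C
    + Complex 0 (complex.Im (u n) - b).
  by case: (u n) => x y; apply/eqP; rewrite eq_complex /= addr0 add0r !eqxx.
apply: le_lt_trans (le_normcD _ _) _ => /=.
by rewrite expr0n /= addr0 add0r !sqrtr_sqr (splitr e) ltrD.
Qed.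

End RealNorm.

(** * Boundedness of the partial sum operators *)

Section PartialSums.
Context {R : realType} {s : scalar_kind}.
Local Notation K := (scalar_field R s).

Definition psum (V : normedModType K) (x : nat -> V) (a : nat -> K) (k : nat) : V :=
  \sum_(0 <= j < k) a j *: x j.

Lemma psumB (V : normedModType K) (x : nat -> V) a b k :
  psum x a k - psum x b k = psum x (fun j => a j - b j) k.
Proof. by rewrite /psum -sumrB; apply: eq_bigr => j _; rewrite scalerBl. Qed.

Lemma psumS (V : normedModType K) (x : nat -> V) a k :
  psum x a k.+1 = psum x a k + a k *: x k.
Proof. by rewrite /psum big_nat_recr. Qed.

Lemma natSinv_lt (e : R) : 0 < e -> exists N, forall n, (N <= n)%N -> n.+1%:R^-1 < e.
Proof.
move=> e0; exists (Num.truncn e^-1) => n Nn.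
rewrite -ltf_pV2 ?posrE ?invr_gt0// invrK; apply: lt_le_trans (truncnS_gt _) _.
by rewrite ler_nat.
Qed.

Section Complete.
Variables (X : completeNormedModType K) (x : nat -> X).
Hypothesis x_neq0 : forall j, x j != 0.

Lemma expansionP f (a : nat -> K) : expansion x f a <->
  forall e : R, 0 < e -> exists N, forall n, (N <= n)%N -> rnorm (psum x a n - f) < e.
Proof. exact: rcvgP. Qed.

Lemma psum_coord_le a (C : R) k :
  (forall k, rnorm (psum x a k) <= C) -> rnorm (a k) * rnorm (x k) <= C + C.
Proof.
move=> h; rewrite -rnormZ; have -> : a k *: x k = psum x a k.+1 - psum x a k.
  by rewrite psumS addrAC subrr add0r.
by rewrite (le_trans (rnormB _ _))// lerD.
Qed.

(** Uniform convergence of the partial sums of the expansions of F m turns the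
    coordinatewise limit into an expansion of the limit of F. *)
Lemma expansion_limit (b : nat -> nat -> K) (F : nat -> X) (f : X) :
  (forall m, expansion x (F m) (b m)) ->
  (forall e : R, 0 < e -> exists N, forall m, (N <= m)%N -> rnorm (F m - f) < e) ->
  (forall e : R, 0 < e -> exists N, forall m n, (N <= m)%N -> (N <= n)%N ->
     forall k, rnorm (psum x (b m) k - psum x (b n) k) <= e) ->
  exists2 A : nat -> K, expansion x f A &
    forall e : R, 0 < e -> exists N, forall m, (N <= m)%N ->
      forall k, rnorm (psum x (b m) k - psum x A k) <= e.
Proof.
move=> Fb Ff bC.
have coordC j : rcauchy (fun m => b m j).
  move=> e e0; have xj : 0 < rnorm (x j) by rewrite rnorm_gt0.
  have e3 : 0 < e / 3 * rnorm (x j) by rewrite mulr_gt0// divr_gt0.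
  have [N hN] := bC _ e3.
  exists N => m n Nm Nn; rewrite -(ltr_pM2r xj).
  have hk k : rnorm (psum x (fun i => b m i - b n i) k) <= e / 3 * rnorm (x j).
    by rewrite -psumB hN.
  have /= h := psum_coord_le j hk; apply: (le_lt_trans h).
  rewrite -mulrDl ltr_pM2r// -mulrDl ltr_pdivrMr//; lra.
have [A hA] := choice (fun j => scalar_rcauchy (coordC j)).
have psumA k e : 0 < e ->
    exists N, forall m, (N <= m)%N -> rnorm (psum x (b m) k - psum x A k) < e.
  elim: k e => [|k IH] e e0.
    by exists 0 => m _; rewrite /psum !big_geq// subrr rnorm0.
  have e2 : 0 < e / 2 by rewrite divr_gt0.
  have xk : 0 < rnorm (x k) by rewrite rnorm_gt0.
  have e2' : 0 < e / 2 / rnorm (x k) by rewrite divr_gt0.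
  have [N hN] := IH _ e2; have [M hM] := hA k _ e2'.
  exists (maxn N M) => m; rewrite geq_max => /andP[/hN h1 /hM h2].
  rewrite !psumS opprD addrACA (le_lt_trans (rnormD _ _))// (splitr e) ltrD//.
  by rewrite -scalerBl rnormZ -ltr_pdivlMr.
have unif (e : R) : 0 < e -> exists N, forall m, (N <= m)%N ->
      forall k, rnorm (psum x (b m) k - psum x A k) <= e.
  move=> e0; have [N hN] := bC _ e0; exists N => m Nm k.
  apply/ler_addgt0Pr => d d0; have [M hM] := psumA k _ d0.
  apply: le_trans (rnorm_dist (psum x (b (maxn N M)) k) _ _) _.
  by rewrite lerD ?hN ?leq_maxl// ltW// hM// leq_maxr.
exists A => //; apply/expansionP => e e0.
have e3 : 0 < e / 3 by rewrite divr_gt0.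
have [N hN] := unif _ e3; have [M hM] := Ff _ e3.
have {hN} hN := hN _ (leq_maxl N M); have {hM} hM := hM _ (leq_maxr N M).
set m := maxn N M in hN hM; have /expansionP/(_ _ e3)[k0 hk] := Fb m.
exists k0 => k /hk h; have hd := hN k.
apply: le_lt_trans (rnorm_dist (psum x (b m) k) _ _) _.
have := le_lt_trans (rnorm_dist (F m) _ _) (ltrD h hM).
move: hd; rewrite [rnorm (psum x A k - _)]rnorm_distC; lra.
Qed.

End Complete.

(** The nested ball argument behind Baire's theorem: if no V M were dense in a
    ball, balls could be chosen inside each other, the M-th one missing V M, and
    their common point would belong to no V M. *)
Lemma somewhere_dense_cover (X : completeNormedModType K) (V : nat -> set X) :
  (forall f, exists M, V M f) ->
  exists M c (r : R), 0 < r /\ forall y, rnorm (y - c) < r ->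
    forall e : R, 0 < e -> exists2 v, V M v & rnorm (y - v) < e.
Proof.
move=> cover; apply: contrapT => nd.
have step (t : nat * (X * R)) : exists t' : X * R, 0 < t.2.2 ->
    [/\ 0 < t'.2, t'.2 <= t.1.+1%:R^-1, rnorm (t'.1 - t.2.1) + t'.2 <= t.2.2
      & forall v, rnorm (v - t'.1) <= t'.2 -> ~ V t.1 v].
  case: t => M [c r] /=; have [r0|r0] := boolP (0 < r); last by exists (c, r).
  have [y [e [yc e0 hy]]] : exists y (e : R),
      [/\ rnorm (y - c) < r / 2, 0 < e & forall v, V M v -> e <= rnorm (y - v)].
    apply: contrapT => h; apply: nd; exists M, c, (r / 2); split=> [|y yc e e0];
      first by rewrite divr_gt0.
    apply: contrapT => h'; apply: h; exists y, e; split=> // v Vv.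
    by rewrite leNgt; apply/negP => ?; apply: h'; exists v.
  exists (y, Num.min (Num.min (r / 2) (e / 2)) M.+1%:R^-1) => /= _; split.
  - by rewrite !lt_min !divr_gt0 ?invr_gt0 ?ltr0n.
  - by rewrite ge_min lexx orbT.
  - rewrite [leRHS]splitr lerD ?(ltW yc)//; last by rewrite !ge_min lexx.
  - move=> v; rewrite !le_min => /andP[/andP[_ h] _] /hy.
    rewrite rnorm_distC => /le_trans/(_ h); lra.
have [g hg] := choice step.
pose b := fix b n := if n is m.+1 then g (m, b m) else (0, 1).
have r_gt0 n : 0 < (b n).2.
  by elim: n => [|n IH] /=; [exact: ltr01|case: (hg (n, b n) IH)].
have hb n := hg (n, b n) (r_gt0 n).
have nest n m : rnorm ((b (n + m)%N).1 - (b n).1) + (b (n + m)%N).2 <= (b n).2.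
  elim: m => [|m IH]; first by rewrite addn0 subrr rnorm0 add0r.
  rewrite addnS; have [_ _ h _] := hb (n + m)%N.
  have := rnorm_dist (b (n + m)%N).1 (b (n + m).+1).1 (b n).1.
  move: h IH => /=; lra.
have nest' n m : (n <= m)%N -> rnorm ((b m).1 - (b n).1) <= (b n).2.
  move=> nm; have := nest n (m - n)%N; rewrite subnKC//.
  have := r_gt0 m; lra.
have [l hl] : exists l : X, (fun n => (b n).1) @ \oo --> l.
  apply: rcauchy_cvg => e e0; have e2 : 0 < e / 2 by rewrite divr_gt0.
  have [N hN] := natSinv_lt e2; exists N.+1 => m n Nm Nn.
  have [_ /le_lt_trans/(_ (hN _ (leqnn N))) h _ _] := hb N.
  have h1 := nest' _ _ Nm; have h2 := nest' _ _ Nn.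
  have := rnorm_dist (b N.+1).1 (b m).1 (b n).1.
  move: h h1 h2; rewrite [rnorm ((b n).1 - _)]rnorm_distC /=; lra.
have [M VM] := cover l; have [_ _ _ hM] := hb M.
apply: (hM l) => //; apply/ler_addgt0Pr => e e0.
have /rcvgP/(_ _ e0)[N hN] := hl.
have := hN _ (leq_maxl N M.+1); have := nest' _ _ (leq_maxr N M.+1).
have := rnorm_dist (b (maxn N M.+1)).1 l (b M.+1).1.
rewrite [rnorm (l - (b (maxn _ _)).1)]rnorm_distC /=; lra.
Qed.

End PartialSums.

Section BasisConstant.
Context {R : realType} {s : scalar_kind}.
Local Notation K := (scalar_field R s).
Variables (X : completeNormedModType K) (x : nat -> X).

Lemma psum_lin c a b k :
  psum x (fun j => c * a j + b j) k = c *: psum x a k + psum x b k.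
Proof.
rewrite /psum scaler_sumr -big_split /=; apply: eq_bigr => j _.
by rewrite scalerDl scalerA.
Qed.

Lemma expansion_lin c f g a b : expansion x f a -> expansion x g b ->
  expansion x (c *: f + g) (fun j => c * a j + b j).
Proof.
move=> /expansionP hf /expansionP hg; apply/expansionP => e e0.
have c1 : 0 < rnorm c + 1 by rewrite (le_lt_trans (rnorm_ge0 c))// ltrDl.
have [|N hN] := hf (e / 2 / (rnorm c + 1)); first by rewrite !divr_gt0.
have [|M hM] := hg (e / 2); first by rewrite divr_gt0.
exists (maxn N M) => n; rewrite geq_max => /andP[/hN h1 /hM h2].
rewrite psum_lin opprD addrACA -scalerBr (le_lt_trans (rnormD _ _))//.
have := ler_wpM2l (rnorm_ge0 c) (ltW h1); rewrite -rnormZ.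
have -> : rnorm c * (e / 2 / (rnorm c + 1)) =
    e / 2 - e / 2 / (rnorm c + 1) by field; rewrite gt_eqF.
have : 0 < e / 2 / (rnorm c + 1) by rewrite !divr_gt0.
lra.
Qed.

Lemma expansion_sum (F : nat -> X) (b : nat -> nat -> K) m :
  (forall n, expansion x (F n) (b n)) ->
  expansion x (\sum_(0 <= n < m) F n) (fun j => \sum_(0 <= n < m) b n j).
Proof.
move=> h; elim: m => [|m IH].
  apply/expansionP => e e0; exists 0%N => n _; rewrite big_geq// subr0.
  by rewrite /psum big1 ?rnorm0// => j _; rewrite big_geq// scale0r.
rewrite big_nat_recr//= addrC -[F m]scale1r.
suff -> : (fun j => \sum_(0 <= n < m.+1) b n j) =
    (fun j => 1 * b m j + \sum_(0 <= n < m) b n j) by exact: expansion_lin.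
by apply/funext => j; rewrite big_nat_recr//= addrC mul1r.
Qed.

Lemma expansion_bounded f a : expansion x f a ->
  exists M : nat, forall k, rnorm (psum x a k) <= M%:R.
Proof.
move=> /expansionP/(_ _ ltr01)[N hN].
pose B : R := rnorm f + 1 + \sum_(0 <= n < N) rnorm (psum x a n).
exists (Num.truncn B).+1 => k; apply: le_trans (ltW (truncnS_gt B)).
have S0 : 0 <= \sum_(0 <= n < N) rnorm (psum x a n).
  by apply: sumr_ge0 => n _; exact: rnorm_ge0.
have [Nk|kN] := leqP N k.
  have := hN _ Nk; have := rnorm_le_dist (psum x a k) f; rewrite /B; lra.
have : rnorm (psum x a k) <= \sum_(0 <= n < N) rnorm (psum x a n).
  rewrite big_mkord (bigD1 (Ordinal kN))//= lerDl.
  by apply: sumr_ge0 => n _; exact: rnorm_ge0.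
have := rnorm_ge0 f; rewrite /B; lra.
Qed.

Hypothesis x_basis : schauder_basis x.
Hypothesis x_neq0 : forall j, x j != 0.

(** The vectors whose partial sums are bounded by M cover the space as M varies,
    so that for some M they are dense in a ball. Their differences then fill a
    ball about the origin, up to arbitrarily small errors. *)
Lemma expansion_approx : exists2 C : R, 0 <= C & forall f (e : R), 0 < e ->
  exists ga : X * (nat -> K), [/\ expansion x ga.1 ga.2,
    forall k, rnorm (psum x ga.2 k) <= C * rnorm f & rnorm (f - ga.1) < e].
Proof.
pose V M := [set f | exists2 a, expansion x f a &
  forall k, rnorm (psum x a k) <= M%:R :> R].
have cover f : exists M, V M f.
  have [a [fa _]] := x_basis f; have [M hM] := expansion_bounded fa.
  by exists M, a.
have [M [c [r [r0 hr]]]] := somewhere_dense_cover cover.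
exists (4 * M%:R / r) => [|f e e0]; first by rewrite divr_ge0 ?mulr_ge0 ?ler0n ?(ltW r0).
have [->|f0] := eqVneq f 0.
  exists (0, fun=> 0); split => /=; last by rewrite subrr rnorm0.
    apply/expansionP => d d0; exists 0%N => n _.
    by rewrite /psum big1 ?subr0 ?rnorm0// => j _; rewrite scale0r.
  move=> k; rewrite rnorm0 mulr0 /psum big1 ?rnorm0// => j _.
  by rewrite scale0r.
have nf0 : 0 < rnorm f by rewrite rnorm_gt0.
pose t : R := r / 2 / rnorm f; have t0 : 0 < t by rewrite !divr_gt0.
have te0 : 0 < t * e / 2 by rewrite divr_gt0// mulr_gt0.
have [|v1 [a1 va1 h1] d1] := hr (c + real_scalar t *: f) _ _ te0.
  rewrite addrAC subrr add0r rnormZ rnorm_real gtr0_norm// /t divfK ?gt_eqF//.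
  lra.
have [|v2 [a2 va2 h2] d2] := hr c _ _ te0; first by rewrite subrr rnorm0.
pose ti : K := real_scalar t^-1.
have nti : rnorm ti = t^-1 by rewrite rnorm_real gtr0_norm// invr_gt0.
have tiK : ti * real_scalar t = 1 by rewrite -real_scalarM mulVf ?real_scalar1 ?gt_eqF.
exists (ti *: v1 + ((- ti) *: v2 + 0),
   fun j => ti * a1 j + ((- ti) * a2 j + 0)); split => /=.
- apply: expansion_lin => //; apply: expansion_lin => //.
  apply/expansionP => d d0; exists 0%N => n _.
  by rewrite /psum big1 ?subr0 ?rnorm0// => j _; rewrite scale0r.
- move=> k; rewrite (psum_lin ti a1 (fun j => - ti * a2 j + 0)).
  rewrite (psum_lin (- ti) a2 (fun=> 0)) [psum x (fun=> 0) k]big1 => [|j _].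
    rewrite addr0 scaleNr -scalerBr rnormZ nti ler_pdivrMl//.
    have -> : t * (4 * M%:R / r * rnorm f) = M%:R + M%:R.
      rewrite /t; field; rewrite !gt_eqF//.
    by rewrite (le_trans (rnormB _ _))// lerD.
  by rewrite scale0r.
- rewrite addr0 scaleNr -scalerBr -[f]scale1r -tiK -scalerA -scalerBr rnormZ nti.
  rewrite ltr_pdivrMl//; have -> : real_scalar t *: f - (v1 - v2) =
     (c + real_scalar t *: f - v1) - (c - v2).
    rewrite [c + _]addrC -!addrA; congr (_ + _).
    by rewrite !opprB [RHS]addrCA [c + _]addrC subrK addrC.
  have := rnormB (c + real_scalar t *: f - v1) (c - v2); lra.
Qed.

(** The open mapping argument for the norm sup_k |S_k f|: successive
    approximation writes f as a sum of terms whose partial sums decay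
    geometrically, and uniqueness identifies the sum of their expansions. *)
Theorem basis_constant : exists2 C : R, 0 < C & forall f a,
  expansion x f a -> forall k, rnorm (psum x a k) <= C * rnorm f.
Proof.
have [C C0 approx] := expansion_approx.
exists (2 * C + 1) => [|f a fa k]; first lra.
have [f0|nf0] := eqVneq f 0.
  suff -> : a = fun=> 0.
    rewrite /psum big1 ?rnorm0 => [|j _]; last by rewrite scale0r.
    by rewrite mulr_ge0 ?rnorm_ge0//; lra.
  have [b [_ hb]] := x_basis f; rewrite -(hb _ fa); apply: hb; rewrite f0.
  apply/expansionP => d d0; exists 0%N => n _.
  by rewrite /psum big1 ?subr0 ?rnorm0// => j _; rewrite scale0r.
have pf0 : 0 < rnorm f by rewrite rnorm_gt0.
have [G hG] := choice (fun fe : X * R => match pselect (0 < fe.2) return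
   exists ga : X * (nat -> K), 0 < fe.2 -> [/\ expansion x ga.1 ga.2,
    forall k, rnorm (psum x ga.2 k) <= C * rnorm fe.1 & rnorm (fe.1 - ga.1) < fe.2]
  with left e0 => let: ex_intro ga h := approx fe.1 fe.2 e0 in
                   ex_intro _ ga (fun=> h)
     | right e0 => ex_intro _ (0, fun=> 0) (fun e0' => False_ind _ (e0 e0')) end).
pose eps n : R := rnorm f / 2 ^+ n.
have eps0 n : 0 < eps n by rewrite divr_gt0// exprn_gt0.
pose rest := fix rest n := if n is m.+1 then
  rest m - (G (rest m, eps m.+1)).1 else f.
pose ga n := G (rest n, eps n.+1).
have hga n := hG (rest n, eps n.+1) (eps0 n.+1).
have rest_le n : rnorm (rest n) <= eps n.
  case: n => [|n]; first by rewrite /eps expr0 divr1.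
  by have [_ _ /ltW] := hga n.
have psum_le n k' : rnorm (psum x (ga n).2 k') <= C * eps n.
  have [_ h _] := hga n; apply: (le_trans (h k')).
  by rewrite ler_wpM2l// rest_le.
have sum_rest m : \sum_(0 <= n < m) (ga n).1 = f - rest m.
  elim: m => [|m IH]; first by rewrite big_geq// subrr.
  by rewrite big_nat_recr//= IH opprB addrA addrAC.
pose b m j := \sum_(0 <= n < m) (ga n).2 j.
have psum_b m k' : psum x (b m) k' = \sum_(0 <= n < m) psum x (ga n).2 k'.
  rewrite /psum exchange_big /=; apply: eq_bigr => j _.
  by rewrite /b scaler_suml.
have eps_sum m n : (m <= n)%N -> \sum_(m <= i < n) eps i <= 2 * eps m.
  move=> mn; suff -> : \sum_(m <= i < n) eps i = 2 * eps m - 2 * eps n.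
    by rewrite lerBlDr lerDl mulr_ge0 ?ltW.
  rewrite -[n in LHS](subnKC mn) -[n in RHS](subnKC mn).
  elim: (n - m)%N => [|l IH]; first by rewrite addn0 big_geq ?subrr.
  rewrite addnS big_nat_recr ?leq_addr//= IH /eps exprS.
  have pn0 i : (2 : R) ^+ i != 0 by rewrite expf_neq0 ?pnatr_eq0.
  move: (pn0 m) (pn0 (m + l)%N); move: (2 ^+ m) (2 ^+ (m + l)) => u v u0 v0.
  by field; rewrite u0 v0.
have psum_tail m n k' : (m <= n)%N ->
    rnorm (psum x (b n) k' - psum x (b m) k') <= 2 * C * eps m.
  move=> mn; rewrite !psum_b (@big_cat_nat _ _ _ m)//= addrAC subrr add0r.
  apply: le_trans (rnorm_sum _ _ _) _.
  apply: le_trans (ler_sum _ (fun i _ => psum_le i k')) _.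
  rewrite -mulr_sumr mulrAC [_ * C]mulrC ler_wpM2l//; exact: eps_sum.
have eps_lim e : 0 < e -> exists N, forall m, (N <= m)%N -> eps m < e.
  move=> e0; have e0' : 0 < e / rnorm f by rewrite divr_gt0.
  have [N hN] := natSinv_lt e0'; exists N => m /hN h.
  rewrite /eps mulrC -ltr_pdivlMr//; apply: le_lt_trans h.
  rewrite lef_pV2 ?posrE ?exprn_gt0// -natrX ler_nat.
  by elim: (m) => // i IH; rewrite expnS mul2n -addnn -addn1 leq_add// expn_gt0.
have [|||A fA hA] := @expansion_limit _ _ X x x_neq0 b
    (fun m => \sum_(0 <= n < m) (ga n).1) f.
- by move=> m; apply: expansion_sum => n; have [] := hga n.
- move=> e e0; have [N hN] := eps_lim _ e0; exists N => m /hN.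
  by rewrite sum_rest addrAC subrr add0r rnormN; exact: le_lt_trans.
- move=> e e0; have C21 : 0 < 2 * C + 1 by lra.
  have [N hN] := eps_lim _ (divr_gt0 e0 C21).
  exists N => m n Nm Nn k'.
  wlog mn : m n Nm Nn / (m <= n)%N => [W|].
    have [|/ltnW] := leqP m n; first exact: W.
    by rewrite rnorm_distC; exact: W.
  rewrite rnorm_distC (le_trans (psum_tail _ _ _ mn))//.
  have := hN _ Nm; rewrite ltr_pdivlMr// mulrC => /ltW; apply: le_trans.
  by rewrite ler_wpM2r ?(ltW (eps0 _))// lerDl.
have <- : A = a by have [c [_ hc]] := x_basis f; rewrite -(hc _ fa) -(hc _ fA).
apply/ler_addgt0Pr => e e0; have [N hN] := hA _ e0.
have := hN _ (leqnn N) k; rewrite rnorm_distC => h1.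
have := psum_tail _ _ k (leq0n N).
have -> : psum x (b 0) k = 0 by rewrite psum_b big_geq.
have -> : eps 0 = rnorm f by rewrite /eps expr0 divr1.
rewrite subr0; have := rnorm_le_dist (psum x A k) (psum x (b N) k).
rewrite mulrDl mul1r; have := rnorm_ge0 f; lra.
Qed.

End BasisConstant.

(** * Basic sequences with dense span *)

Section BasicSequences.
Context {R : realType} {s : scalar_kind}.
Local Notation K := (scalar_field R s).

Definition basic_seq (X : normedModType K) (x : nat -> X) (C : R) :=
  forall a k N, (k <= N)%N -> rnorm (psum x a k) <= C * rnorm (psum x a N).

Definition dense_span (X : normedModType K) (x : nat -> X) :=
  forall f (e : R), 0 < e -> exists a N, rnorm (f - psum x a N) < e.

Definition trunc (A : pred nat) (a : nat -> K) : nat -> K :=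
  fun j => if A j then a j else 0.

Section Normed.
Variables (X : normedModType K) (x : nat -> X).

Lemma eq_psum a b k : (forall j, (j < k)%N -> a j = b j) -> psum x a k = psum x b k.
Proof. by move=> h; apply: eq_big_nat => j /andP[_ /h ->]. Qed.

Lemma psum_trunc a N k : psum x (trunc (fun j => (j < N)%N) a) k = psum x a (minn k N).
Proof.
have e k' : (k' <= N)%N -> psum x (trunc (fun j => (j < N)%N) a) k' = psum x a k'.
  by move=> kN; apply: eq_psum => j jk; rewrite /trunc (leq_trans jk).
have [/e //|/ltnW Nk] := leqP k N.
rewrite /psum (@big_cat_nat _ _ _ N 0 k)//= [X in _ + X]big1_seq ?addr0; first exact: e.
move=> j /= /[!mem_index_iota] /andP[Nj _].
by rewrite /trunc ltnNge Nj scale0r.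
Qed.

Lemma psumD a b k : psum x (fun j => a j + b j) k = psum x a k + psum x b k.
Proof. by rewrite /psum -big_split; apply: eq_bigr => j _; rewrite scalerDl. Qed.

Lemma psumZ c a k : psum x (fun j => c * a j) k = c *: psum x a k.
Proof. by rewrite /psum scaler_sumr; apply: eq_bigr => j _; rewrite scalerA. Qed.

Lemma expansion_psum a N :
  expansion x (psum x a N) (trunc (fun j => (j < N)%N) a).
Proof.
apply/rcvgP => e e0; exists N => n Nn.
by rewrite -[series _ n]/(psum x _ n) psum_trunc (minn_idPr Nn) subrr rnorm0.
Qed.

End Normed.

Section Complete.
Variables (X : completeNormedModType K) (x : nat -> X) (C : R).
Hypothesis C0 : 0 < C.
Hypothesis x_basic : basic_seq x C.
Hypothesis x_neq0 : forall j, x j != 0.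

Lemma basic_seq_coord_le a N k : (k < N)%N ->
  rnorm (a k) * rnorm (x k) <= 2 * C * rnorm (psum x a N).
Proof.
move=> kN; rewrite -rnormZ.
have -> : a k *: x k = psum x a k.+1 - psum x a k by rewrite psumS addrAC subrr add0r.
have := x_basic a kN; have := x_basic a (ltnW kN).
have := rnormB (psum x a k.+1) (psum x a k); lra.
Qed.

(** The partial sum operators are bounded on the span, so that finite sums
    converging to f have uniformly convergent partial sums and expansion_limit
    yields an expansion of f; the coordinate bound makes it unique. *)
Theorem basic_seq_basis : dense_span x -> schauder_basis x.
Proof.
move=> dense f.
have approx m : exists aN : (nat -> K) * nat,
    rnorm (f - psum x aN.1 aN.2) < m.+1%:R^-1.
  have m0 : 0 < m.+1%:R^-1 :> R by rewrite invr_gt0.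
  by have [a [N h]] := dense f _ m0; exists (a, N).
have [g hg] := choice approx.
pose b m := trunc (fun j => (j < (g m).2)%N) (g m).1.
pose F m := psum x (g m).1 (g m).2.
have bF m : exists N0, forall k, (N0 <= k)%N -> psum x (b m) k = F m.
  by exists (g m).2 => k h; rewrite psum_trunc (minn_idPr h).
have FC (e : R) : 0 < e -> exists N, forall m, (N <= m)%N -> rnorm (F m - f) < e.
  move=> /natSinv_lt[N hN]; exists N => m /hN; rewrite rnorm_distC.
  exact/lt_trans/hg.
have [|//|e e0|A fA _] := @expansion_limit _ _ X x x_neq0 b F f.
- by move=> m; exact: expansion_psum.
- have eC : 0 < e / (2 * C) by rewrite divr_gt0// mulr_gt0.
  have [N hN] := FC _ eC; exists N => m n Nm Nn k.
  have [M hM] := bF m; have [M' hM'] := bF n.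
  rewrite psumB (le_trans (x_basic _ (leq_maxl k (maxn M M'))))//.
  rewrite -psumB hM ?hM'//; last 2 first.
  - by rewrite !leq_max leqnn !orbT.
  - by rewrite !leq_max leqnn !orbT.
  have := hN _ Nm; have := hN _ Nn; rewrite !ltr_pdivlMr ?mulr_gt0//.
  have := ler_wpM2l (ltW C0) (rnorm_dist f (F m) (F n)).
  rewrite [rnorm (f - _)]rnorm_distC; lra.
exists A; split=> // B fB; apply/funext => k; apply/eqP.
rewrite -subr_eq0 -rnorm_eq0 -(mulIr_eq0 _ (mulIf (_ : rnorm (x k) != 0)));
  last by rewrite rnorm_eq0.
rewrite eq_le mulr_ge0 ?rnorm_ge0// andbT; apply/ler_addgt0Pr => e e0.
rewrite add0r; have eC : 0 < e / (4 * C) by rewrite divr_gt0// mulr_gt0.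
have /expansionP/(_ _ eC)[N hN] := fA; have /expansionP/(_ _ eC)[M hM] := fB.
pose n := maxn k.+1 (maxn N M).
have := @basic_seq_coord_le (fun j => A j - B j) n k (leq_maxl _ _).
move=> /le_trans; apply; rewrite -psumB.
have := hN n; have := hM n; rewrite !leq_max !leqnn !orbT => /(_ isT) + /(_ isT).
rewrite !ltr_pdivlMr ?mulr_gt0//.
have := ler_wpM2l (ltW C0) (rnorm_dist f (psum x A n) (psum x B n)).
rewrite [rnorm (f - _)]rnorm_distC; lra.
Qed.

End Complete.

Section Coordinates.
Variables (X : completeNormedModType K) (x : nat -> X).
Hypothesis x_basis : schauder_basis x.

Lemma basis_coordE f a : expansion x f a -> basis_coord x f = a.
Proof.
move=> fa; have [b [_ hb]] := x_basis f; rewrite /basis_coord.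
case: xgetP => [c _ /= fc|/(_ a)//]; by rewrite -(hb _ fc) -(hb _ fa).
Qed.

Lemma basis_coordP f : expansion x f (basis_coord x f).
Proof. by have [b [fb _]] := x_basis f; rewrite (basis_coordE fb). Qed.

Lemma basis_projE f (A : set nat) N :
  (forall j, j \in A -> (N <= j)%N -> basis_coord x f j = 0) ->
  basis_proj x A f = psum x (trunc (fun j => j \in A) (basis_coord x f)) N.
Proof.
move=> h; apply: (@cvg_lim X); first exact: norm_hausdorff.
apply/rcvgP => e e0; exists N => n Nn; rewrite /series/=.
suff -> : \sum_(0 <= j < n) (if j \in A then basis_coord x f j *: x j else 0) =
    psum x (trunc (fun j => j \in A) (basis_coord x f)) N by rewrite subrr rnorm0.
rewrite (@big_cat_nat _ _ _ N 0 n)//= [X in _ + X]big1_seq ?addr0.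
  by apply: eq_bigr => j _; rewrite /trunc; case: ifP; rewrite ?scale0r.
move=> j /= /[!mem_index_iota] /andP[Nj _]; case: ifP => // jA.
by rewrite h// scale0r.
Qed.

End Coordinates.
End BasicSequences.

(** * Dyadic blocks and their averages *)

Section DyadicBlocks.
Local Open Scope nat_scope.

(** Indices are cut into consecutive blocks of sizes 1, 2, 4, ...; the block of
    level n starts at lo n. *)
Definition lo (n : nat) : nat := (2 ^ n).-1.
Definition lev (j : nat) : nat := trunc_log 2 j.+1.

Lemma lo0 : lo 0 = 0. Proof. by []. Qed.

Lemma loS n : lo n.+1 = lo n + 2 ^ n.
Proof. by rewrite /lo expnS; have := expn_gt0 2 n; lia. Qed.

Lemma lo_homo m n : m <= n -> lo m <= lo n.
Proof. by move=> mn; rewrite /lo; have := @leq_pexp2l 2 m n isT mn; lia. Qed.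

Lemma leq_lo n : n <= lo n.
Proof. by rewrite /lo; have := ltn_expl n (isT : 1 < 2); lia. Qed.

Lemma lo_lt_S n : lo n < lo n.+1.
Proof. by rewrite loS -[X in X < _]addn0 ltn_add2l expn_gt0. Qed.

Lemma lev_bounds j : lo (lev j) <= j < lo (lev j).+1.
Proof.
rewrite /lo /lev; have := @trunc_log_bounds 2 j.+1 isT isT; lia.
Qed.

Lemma lev_eq n j : lo n <= j -> j < lo n.+1 -> lev j = n.
Proof.
rewrite /lo => h1 h2; apply: trunc_log_eq => //; have := expn_gt0 2 n; lia.
Qed.

Lemma lev_ge n j : lo n <= j -> n <= lev j.
Proof.
move=> h; have /andP[_ h'] := lev_bounds j; rewrite leqNgt; apply/negP => /lo_homo.
by move=> h2; have := leq_trans h' (leq_trans h2 h); rewrite ltnn.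
Qed.

Lemma lev_lt n j : j < lo n -> lev j < n.
Proof.
move=> h; have /andP[h' _] := lev_bounds j; rewrite ltnNge; apply/negP => /lo_homo.
by move=> h2; have := leq_ltn_trans (leq_trans h2 h') h; rewrite ltnn.
Qed.

Lemma leq_lev j : lev j <= j.
Proof. by have /andP[h _] := lev_bounds j; exact: leq_trans (leq_lo _) h. Qed.

End DyadicBlocks.

Lemma big_lo (V : nmodType) (F : nat -> V) k N : (k <= N)%N ->
  \sum_(lo k <= j < lo N) F j =
  \sum_(k <= n < N) \sum_(lo n <= j < lo n.+1) F j.
Proof.
move=> kN; rewrite -(subnKC kN); elim: (N - k)%N => [|m IH].
  by rewrite addn0 !big_geq.
rewrite addnS (@big_cat_nat _ _ _ (lo (k + m)))//=; last 2 first.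
- by rewrite lo_homo// leq_addr.
- exact: lo_homo.
by rewrite IH [RHS]big_nat_recr ?leq_addr.
Qed.

Section PowerInequalities.
Context {R : realType}.
Variable q : R.
Hypothesis q1 : 1 < q.

Let q0 : 0 < q. Proof. exact: lt_trans ltr01 q1. Qed.
Let qN0 : q != 0. Proof. by rewrite gt_eqF. Qed.

Lemma powR_rootK (x : R) : 0 <= x -> (x `^ q) `^ q^-1 = x.
Proof. by move=> x0; rewrite -powRrM divff// powRr1. Qed.

Lemma root_powRK (x : R) : 0 <= x -> (x `^ q^-1) `^ q = x.
Proof. by move=> x0; rewrite -powRrM mulVf// powRr1. Qed.

Lemma ler_pow (x y : R) : 0 <= x -> x <= y -> x `^ q <= y `^ q.
Proof.
by move=> x0 xy; rewrite ge0_ler_powR ?nnegrE ?(ltW q0)// (le_trans x0).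
Qed.

Lemma ler_root (x y : R) : 0 <= x -> x <= y -> x `^ q^-1 <= y `^ q^-1.
Proof.
by move=> x0 xy; rewrite ge0_ler_powR ?nnegrE ?invr_ge0 ?(ltW q0)// (le_trans x0).
Qed.

Lemma le_root (x E : R) : 0 <= x -> x `^ q <= E -> x <= E `^ q^-1.
Proof. by move=> x0 /ler_root; rewrite powR_rootK//; apply; exact: powR_ge0. Qed.

Lemma root_le (x E : R) : 0 <= x -> 0 <= E -> E <= x `^ q -> E `^ q^-1 <= x.
Proof. by move=> x0 E0 /ler_root; rewrite powR_rootK//; exact. Qed.

Lemma powR_add_le (x y : R) : 0 <= x -> 0 <= y ->
  (x + y) `^ q <= 2 `^ q * (x `^ q + y `^ q).
Proof.
wlog xy : x y / x <= y => [W x0 y0|x0 y0].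
  have [/W|/ltW/W] := leP x y; first exact.
  by rewrite addrC [_ `^ _ + _]addrC; exact.
apply: (@le_trans _ _ ((2 * y) `^ q)).
  by rewrite ler_pow ?addr_ge0//; lra.
by rewrite powRM// ler_wpM2l ?powR_ge0// lerDr powR_ge0.
Qed.

Lemma powR_pred (x : R) : 0 < x -> x * x `^ (q - 1) = x `^ q.
Proof. by move=> x0; rewrite mulr_powRB1 ?(ltW x0). Qed.

(** Above the level t the q-th power controls the first power, as q > 1; below it
    powR_trade_le reverses the estimate. *)
Lemma powR_trade (x t : R) : 0 < t -> t <= x -> x <= x `^ q * t `^ (1 - q).
Proof.
move=> t0 tx; have x0 := lt_le_trans t0 tx.
rewrite -opprB powRN -powR_pred// -mulrA ler_peMr ?(ltW x0)//.
rewrite -/(_ / _) ler_pdivlMr ?powR_gt0// mul1r.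
by rewrite ge0_ler_powR ?nnegrE ?subr_ge0 ?(ltW q1) ?(ltW t0) ?(ltW x0).
Qed.

Lemma powR_trade_le (x t : R) : 0 <= x -> x <= t -> 0 < t ->
  x `^ q * t `^ (1 - q) <= x.
Proof.
rewrite le_eqVlt => /predU1P[<-|x0] xt t0; first by rewrite powR0// mul0r.
rewrite -opprB powRN -powR_pred// -mulrA ler_piMr ?(ltW x0)//.
rewrite -/(_ / _) ler_pdivrMr ?powR_gt0// mul1r.
by rewrite ge0_ler_powR ?nnegrE ?subr_ge0 ?(ltW q1) ?(ltW t0) ?(ltW x0).
Qed.

(** The power mean inequality up to the factor 2^q: half of the average is
    carried by the terms that exceed half of it, where powR_trade applies. *)
Lemma power_mean (v : nat -> R) m n : (m < n)%N -> (forall j, 0 <= v j) ->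
  (n - m)%:R * ((\sum_(m <= j < n) v j) / (n - m)%:R) `^ q
    <= 2 `^ q * \sum_(m <= j < n) v j `^ q.
Proof.
move=> mn v0; set a := _ / _.
have S0 : 0 <= \sum_(m <= j < n) v j by apply: sumr_ge0.
have E0 : 0 <= \sum_(m <= j < n) v j `^ q by apply: sumr_ge0 => j _; exact: powR_ge0.
have d0 : 0 < (n - m)%:R :> R by rewrite ltr0n subn_gt0.
have a0 : 0 <= a by rewrite divr_ge0// ltW.
move: a0; rewrite le_eqVlt => /predU1P[<-|a0].
  by rewrite powR0// mulr0 mulr_ge0 ?powR_ge0.
pose t := a / 2; have t0 : 0 < t by rewrite divr_gt0.
have aE : (n - m)%:R * a = \sum_(m <= j < n) v j by rewrite mulrC divfK ?gt_eqF.
have h : \sum_(m <= j < n) v j <=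
    \sum_(m <= j < n) (t + v j `^ q * t `^ (1 - q)).
  apply: ler_sum => j _; have [/ltW vt|tv] := ltP (v j) t.
    by rewrite (le_trans vt)// lerDl mulr_ge0 ?powR_ge0.
  by rewrite (le_trans (powR_trade t0 tv))// lerDr ltW.
move: h; rewrite big_split /= sumr_const_nat -mulr_suml -aE -[t *+ _]mulr_natl.
move: E0 d0 {aE S0 mn}.
move: (\sum_(_ <= _ < _) _) ((n - m)%:R) => E d E0 d0.
have -> : a = 2 * t by rewrite /t mulrC divfK.
move: t0 {a0}; move: t => t {a} t0 h.
have {}h : d * t <= E * t `^ (1 - q) by lra.
rewrite powRM ?ler0n ?(ltW t0)// mulrCA ler_wpM2l ?powR_ge0// -powR_pred// mulrA.
by rewrite -ler_pdivlMr ?powR_gt0// -powRN opprB.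
Qed.

End PowerInequalities.

(** * The Dilworth-Kalton-Kutzarova construction *)

Section DKK.
Context {R : realType} {s : scalar_kind}.
Local Notation K := (scalar_field R s).
Variables (X : completeNormedModType K) (q : R).
Hypothesis q1 : 1 < q.
Let q0 : 0 < q. Proof. exact: lt_trans ltr01 q1. Qed.
Let qN0 : q != 0. Proof. by rewrite gt_eqF. Qed.

Definition qsum (u : nat -> K) m n : R := \sum_(m <= j < n) rnorm (u j) `^ q.

Lemma qsum_ge0 u m n : 0 <= qsum u m n.
Proof. by apply: sumr_ge0 => j _; exact: powR_ge0. Qed.

Lemma ler_qsum u v m n : (forall j, (m <= j < n)%N -> rnorm (u j) <= rnorm (v j)) ->
  qsum u m n <= qsum v m n.
Proof. by move=> h; apply: ler_sum_nat => j /h; apply: ler_pow => //; exact: rnorm_ge0. Qed.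

Lemma qsum_sub u m n m' n' : (m' <= m)%N -> (n <= n')%N ->
  qsum u m n <= qsum u m' n'.
Proof.
move=> mm nn; have [nm|mn] := leqP n m.
  by rewrite /qsum big_geq//; exact: qsum_ge0.
rewrite /qsum (@big_cat_nat _ _ _ m m' n')//= ?(leq_trans (ltnW mn))//.
rewrite (@big_cat_nat _ _ _ n m n')//= ?(ltnW mn)//.
by rewrite addrCA lerDl addr_ge0// -/(qsum _ _ _) qsum_ge0.
Qed.

(** Its n-th power is the l_q norm of the sum of the 2^n unit vectors of the
    block of level n. *)
Definition root2 : R := 2 `^ q^-1.
Local Notation rho := root2.

Lemma root2_gt1 : 1 < rho.
Proof.
rewrite -(powRr0 2) /root2 /powR pnatr_eq0 ltr_expR ltr_pM2r ?invr_gt0//.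
by rewrite ln_gt0// ltr1n.
Qed.

Lemma root2_gt0 : 0 < rho. Proof. exact: lt_trans ltr01 root2_gt1. Qed.

Lemma root2X_gt0 n : 0 < rho ^+ n. Proof. exact: exprn_gt0 root2_gt0. Qed.

Lemma root2Xq n : (rho ^+ n) `^ q = 2 ^+ n.
Proof.
rewrite -(powR_mulrn n (ltW root2_gt0)) -powRrM mulrC powRrM /root2.
by rewrite (root_powRK q1 (ler0n R 2)) powR_mulrn.
Qed.

Lemma root2X_le m n : (m <= n)%N -> rho ^+ m <= rho ^+ n.
Proof. by move=> mn; rewrite ler_weXn2l// ltW// root2_gt1. Qed.

(** The largest term dominates a geometric sum. *)
Lemma root2_geometric : exists2 c : R, 0 < c & forall (k : nat) (D : R), 0 <= D ->
  (forall n, (n < k)%N -> rho ^+ n <= D) -> \sum_(0 <= n < k) rho ^+ n <= c * D.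
Proof.
have r1 : 0 < rho - 1 by rewrite subr_gt0 root2_gt1.
exists (rho / (rho - 1)) => [|[|k] D D0 hD]; first by rewrite divr_gt0 ?root2_gt0.
  by rewrite big_geq// mulr_ge0// divr_ge0 ?(ltW r1)// ltW ?root2_gt0.
have h : \sum_(0 <= n < k.+1) rho ^+ n <= rho / (rho - 1) * rho ^+ k.
  rewrite mulrAC ler_pdivlMr// mulrC.
  elim: (k) => [|m IH]; first by rewrite big_nat1 expr0 !mulr1 gerBl.
  rewrite big_nat_recr//= mulrDr; move: IH.
  rewrite [rho ^+ m.+1]exprS; have := mulr_ge0 (ltW root2_gt0) (ltW (root2X_gt0 m)).
  lra.
by rewrite (le_trans h)// ler_wpM2l ?divr_ge0 ?(ltW r1) ?(ltW root2_gt0)// hD.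
Qed.

Definition mean (a : nat -> K) n : K :=
  real_scalar (2 ^+ n)^-1 * \sum_(lo n <= j < lo n.+1) a j.

Definition centered (a : nat -> K) j : K := a j - mean a (lev j).

Lemma size_block n : (lo n.+1 - lo n)%N = (2 ^ n)%N.
Proof. by rewrite loS addKn. Qed.

Lemma rnorm_mean_le a n : rnorm (mean a n) <=
  (2 ^+ n)^-1 * \sum_(lo n <= j < lo n.+1) rnorm (a j).
Proof.
rewrite rnormM rnorm_real gtr0_norm ?invr_gt0 ?exprn_gt0//.
by rewrite ler_wpM2l ?invr_ge0 ?exprn_ge0// rnorm_sum.
Qed.

Lemma mean_pow a n :
  2 ^+ n * rnorm (mean a n) `^ q <= 2 `^ q * qsum a (lo n) (lo n.+1).
Proof.
have := power_mean q1 (lo_lt_S n) (fun j => rnorm_ge0 (a j)).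
rewrite size_block natrX; apply: le_trans.
rewrite ler_wpM2l ?exprn_ge0//; apply: ler_pow q1 _ _ _ _; first exact: rnorm_ge0.
by rewrite mulrC; exact: rnorm_mean_le.
Qed.

Lemma block_sum_mean a n :
  \sum_(lo n <= j < lo n.+1) a j = real_scalar (2 ^+ n) * mean a n.
Proof. by rewrite mulrA -real_scalarM mulfV ?expf_neq0// real_scalar1 mul1r. Qed.

Lemma sum_block_const (V : lmodType K) (v : V) n :
  \sum_(lo n <= j < lo n.+1) v = (real_scalar (2 ^+ n) : K) *: v.
Proof.
by rewrite sumr_const_nat size_block -scaler_nat -natrX real_scalar_natr.
Qed.

Lemma mean_center a n : mean (centered a) n = 0.
Proof.
rewrite /mean /centered (eq_big_nat _ _ (F2 := fun j => a j - mean a n)); last first.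
  by move=> j /andP[h1 h2]; rewrite (lev_eq h1 h2).
by rewrite sumrB (sum_block_const (mean a n : K^o)) block_sum_mean subrr mulr0.
Qed.

(** Averaging a block is bounded in l_q, hence so is subtracting the average. *)
Lemma block_qsum_center a n :
  qsum (centered a) (lo n) (lo n.+1) <= 8 `^ q * qsum a (lo n) (lo n.+1).
Proof.
have h j : (lo n <= j < lo n.+1)%N -> rnorm (centered a j) `^ q <=
    2 `^ q * (rnorm (a j) `^ q + rnorm (mean a n) `^ q).
  move=> /andP[h1 h2]; rewrite /centered (lev_eq h1 h2).
  apply: le_trans (powR_add_le q1 (rnorm_ge0 _) (rnorm_ge0 _)).
  by apply: ler_pow => //; [exact: rnorm_ge0|exact: rnormB].
apply: (le_trans (ler_sum_nat h)).
rewrite -mulr_sumr big_split /= sumr_const_nat size_block.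
rewrite -[X in _ * (_ + X) <= _]mulr_natl natrX -/(qsum _ _ _).
apply: (@le_trans _ _ (2 `^ q * (4 `^ q * qsum a (lo n) (lo n.+1)))).
  rewrite ler_wpM2l ?powR_ge0//; have := mean_pow a n.
  have -> : 4 `^ q = 2 `^ q * 2 `^ q :> R by rewrite -powRM//; congr (_ `^ _); lra.
  have : 2 <= 2 `^ q :> R by rewrite le1r_powR ?ltW// ltr1n.
  have := qsum_ge0 a (lo n) (lo n.+1); move: (2 `^ q) (qsum _ _ _) => c E E0 c2.
  by have := mulr_ge0 E0 (_ : 0 <= c - 2); have := mulr_ge0 E0 (_ : 0 <= c); nra.
by rewrite mulrA -powRM// ler_wpM2r ?qsum_ge0//; apply: ler_pow => //; lra.
Qed.

Lemma qsum_blocks u k N : (k <= N)%N ->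
  qsum u (lo k) (lo N) = \sum_(k <= n < N) qsum u (lo n) (lo n.+1).
Proof. exact: big_lo. Qed.

Lemma qsum_center a N :
  qsum (centered a) 0 (lo N) <= 8 `^ q * qsum a 0 (lo N).
Proof.
rewrite -lo0 !qsum_blocks// mulr_sumr; apply: ler_sum => n _.
exact: block_qsum_center.
Qed.

Lemma root_qsumM (c E : R) : 0 <= c -> 0 <= E ->
  (c `^ q * E) `^ q^-1 = c * E `^ q^-1.
Proof. by move=> c0 E0; rewrite powRM ?powR_ge0// powR_rootK. Qed.

(** The power mean inequality on a block: rho^n is the factor by which the l_q
    norm of a constant sequence exceeds its value. *)
Lemma wmean_le a n : rho ^+ n * ((2 ^+ n)^-1 * \sum_(lo n <= j < lo n.+1) rnorm (a j))
  <= 2 * qsum a (lo n) (lo n.+1) `^ q^-1.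
Proof.
have S0 : 0 <= \sum_(lo n <= j < lo n.+1) rnorm (a j).
  by apply: sumr_ge0 => j _; exact: rnorm_ge0.
rewrite -root_qsumM ?qsum_ge0//; apply: (le_root q1).
  by rewrite !mulr_ge0// ?(ltW (root2X_gt0 _))// invr_ge0 exprn_ge0.
rewrite powRM ?(ltW (root2X_gt0 _)) ?mulr_ge0 ?invr_ge0 ?exprn_ge0// root2Xq.
have := power_mean q1 (lo_lt_S n) (fun j => rnorm_ge0 (a j)).
by rewrite size_block natrX mulrC [(2 ^+ n)^-1 * _]mulrC mulrC.
Qed.

End DKK.

Section DKKBasis.
Context {R : realType} {s : scalar_kind}.
Local Notation K := (scalar_field R s).
Variables (X : completeNormedModType K) (q : R).
Hypothesis q1 : 1 < q.
Let q0 : 0 < q. Proof. exact: lt_trans ltr01 q1. Qed.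
Let qN0 : q != 0. Proof. by rewrite gt_eqF. Qed.
Local Notation rho := (root2 q).
Local Notation qsum := (qsum q).

Variables (es y : nat -> X).

(** In each block the average direction of the vectors es is replaced by the
    direction of y n. The coefficient of y n makes the sum of the block equal to
    rho^n y n, whose norm is that of the sum of 2^n unit vectors of l_q. *)
Definition dkk (j : nat) : X :=
  es j - real_scalar (2 ^+ lev j)^-1 *: (\sum_(lo (lev j) <= i < lo (lev j).+1) es i)
  + real_scalar (rho ^+ lev j * (2 ^+ lev j)^-1) *: y (lev j).
Local Notation z := dkk.

(** The coefficient of y n that the block of level n of a contributes. *)
Definition wmean (a : nat -> K) n : K := real_scalar (rho ^+ n) * mean a n.

Definition block_part (a : nat -> K) n : X := \sum_(lo n <= j < lo n.+1) a j *: z j.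

Lemma block_partE a n : block_part a n =
  \sum_(lo n <= j < lo n.+1) centered a j *: es j + wmean a n *: y n.
Proof.
rewrite /block_part /dkk.
pose S := \sum_(lo n <= i < lo n.+1) es i.
rewrite (eq_big_nat _ _ (F2 := fun j => a j *: es j - a j *: (real_scalar (2 ^+ n)^-1 *: S)
   + a j *: (real_scalar (rho ^+ n * (2 ^+ n)^-1) *: y n))); last first.
  by move=> j /andP[h1 h2]; rewrite (lev_eq h1 h2) scalerDr scalerBr.
rewrite big_split sumrB /= -!scaler_suml !scalerA; congr (_ + _); last first.
  by congr (_ *: _); rewrite /wmean /mean real_scalarM mulrC -mulrA.
rewrite [RHS](eq_big_nat _ _ (F2 := fun j => a j *: es j - mean a n *: es j)); last first.
  by move=> j /andP[h1 h2]; rewrite /centered (lev_eq h1 h2) scalerBl.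
by rewrite sumrB -scaler_sumr /mean mulrC.
Qed.

Lemma psum_blocks (x : nat -> X) a k N : (k <= N)%N -> psum x a (lo N) =
  psum x a (lo k) + \sum_(k <= n < N) \sum_(lo n <= j < lo n.+1) a j *: x j.
Proof.
by move=> kN; rewrite /psum (@big_cat_nat _ _ _ (lo k))//= ?lo_homo// -big_lo.
Qed.

Lemma psum_blocks0 (x : nat -> X) a N : psum x a (lo N) =
  \sum_(0 <= n < N) \sum_(lo n <= j < lo n.+1) a j *: x j.
Proof. by rewrite (psum_blocks _ _ (leq0n N)) {1}/psum big_geq ?add0r. Qed.

Lemma psum_dkk a N : psum z a (lo N) = psum es (centered a) (lo N) + psum y (wmean a) N.
Proof.
rewrite !psum_blocks0 -big_split.
by apply: eq_bigr => n _; rewrite -[LHS]/(block_part a n) block_partE.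
Qed.

Variable C : R.
Hypothesis C1 : 1 <= C.
Hypothesis es_upper : forall u N, rnorm (psum es u N) <= C * qsum u 0 N `^ q^-1.
Hypothesis es_lower : forall u N, qsum u 0 N `^ q^-1 <= C * rnorm (psum es u N).
Hypothesis y_basic : basic_seq y C.
Hypothesis y_lower : forall n, C^-1 <= rnorm (y n).
Hypothesis y_upper : forall n, rnorm (y n) <= C.
(* The sequence y may contain the block averages of es; only combinations of es
   with zero averages have to be separated from it. *)
Hypothesis es_y_sum : forall u b N, (forall n, mean u n = 0) ->
  rnorm (psum es u (lo N)) <= C * rnorm (psum es u (lo N) + psum y b N).

Let C0 : 0 < C. Proof. exact: lt_le_trans ltr01 C1. Qed.

Let c0 : R := 4 * C ^+ 3.
Let c0_gt0 : 0 < c0. Proof. by rewrite mulr_gt0 ?exprn_gt0. Qed.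

Let norm_le_c0 (A x k : R) : 0 <= A -> 0 <= k <= 4 ->
   x <= k * C ^+ 3 * A -> x <= c0 * A.
Proof.
move=> A0 /andP[k0 k4] h; apply: le_trans h _.
by rewrite ler_wpM2r// ler_wpM2r// exprn_ge0 ?ltW.
Qed.

Lemma center_part_le a N :
  rnorm (psum es (centered a) (lo N)) <= C * rnorm (psum z a (lo N)).
Proof. by rewrite psum_dkk es_y_sum// => n; exact: mean_center. Qed.

Lemma qsum_center_le a N :
  qsum (centered a) 0 (lo N) `^ q^-1 <= c0 * rnorm (psum z a (lo N)).
Proof.
apply: (@norm_le_c0 _ _ 1); rewrite ?rnorm_ge0//; first lra.
apply: le_trans (es_lower _ _) _; rewrite mul1r.
apply: (@le_trans _ _ (C * (C * rnorm (psum z a (lo N))))).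
  by rewrite ler_wpM2l ?center_part_le ?ltW.
rewrite mulrA ler_wpM2r ?rnorm_ge0// -expr2 [leRHS]exprS ler_peMl//.
by rewrite exprn_ge0 ?ltW.
Qed.

Lemma y_part_le a N : rnorm (psum y (wmean a) N) <= 2 * C * rnorm (psum z a (lo N)).
Proof.
have := center_part_le a N.
have := rnorm_le_dist (psum y (wmean a) N) (psum z a (lo N)).
rewrite rnorm_distC [in rnorm (psum z a (lo N) - _)]psum_dkk addrK.
have := ler_wpM2r (rnorm_ge0 (psum z a (lo N))) C1; lra.
Qed.

Lemma wmean_norm a n : rnorm (wmean a n) = rho ^+ n * rnorm (mean a n).
Proof. by rewrite rnormM rnorm_real gtr0_norm// root2X_gt0. Qed.

Lemma wmean_part_le a N n : (n < N)%N ->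
  rho ^+ n * rnorm (mean a n) <= c0 * rnorm (psum z a (lo N)).
Proof.
move=> nN; rewrite -wmean_norm; apply: (@norm_le_c0 _ _ 4); rewrite ?rnorm_ge0//; first lra.
have := basic_seq_coord_le y_basic (wmean a) nN.
have := ler_wpM2l (rnorm_ge0 (wmean a n)) (y_lower n).
move=> /le_trans h /h; rewrite ler_pdivrMr// => /le_trans; apply.
have := ler_wpM2l (mulr_ge0 (ltW C0) (ltW C0)) (y_part_le a N).
by rewrite !exprS expr0; lra.
Qed.

Lemma block_prefix_le a k N : (k <= N)%N ->
  rnorm (psum z a (lo k)) <= c0 * rnorm (psum z a (lo N)).
Proof.
move=> kN; apply: (@norm_le_c0 _ _ 3); rewrite ?rnorm_ge0//; first lra.
rewrite [in leLHS]psum_dkk.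
have h1 : rnorm (psum es (centered a) (lo k)) <= C * (C * (C * rnorm (psum z a (lo N)))).
  apply: le_trans (es_upper _ _) _; rewrite ler_wpM2l ?(ltW C0)//.
  have /le_trans : qsum (centered a) 0 (lo k) `^ q^-1 <= qsum (centered a) 0 (lo N) `^ q^-1.
    by apply: ler_root => //; [exact: qsum_ge0|apply: qsum_sub => //; exact: lo_homo].
  apply; apply: le_trans (es_lower _ _) _.
  by rewrite ler_wpM2l ?center_part_le ?ltW.
have h2 : rnorm (psum y (wmean a) k) <= C * (2 * C * rnorm (psum z a (lo N))).
  by apply: le_trans (y_basic _ kN) _; rewrite ler_wpM2l ?y_part_le ?(ltW C0).
have h3 : C * (2 * C * rnorm (psum z a (lo N))) <=
    2 * C ^+ 3 * rnorm (psum z a (lo N)).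
  have := ler_wpM2l (mulr_ge0 (mulr_ge0 (ltW C0) (ltW C0))
    (rnorm_ge0 (psum z a (lo N)))) C1.
  by rewrite !exprS expr0; lra.
have := rnormD (psum es (centered a) (lo k)) (psum y (wmean a) k).
move: h1 h2 h3; rewrite !exprS expr0; lra.
Qed.

(** Within a single block the norm dominates the l_q norm of the coordinates:
    the part with zero averages by the lower l_q estimate, and the average as one
    coordinate with respect to the basic sequence y. *)
Lemma block_qsum_le a n N : (n < N)%N ->
  qsum a (lo n) (lo n.+1) `^ q^-1 <= 4 * c0 * rnorm (psum z a (lo N)).
Proof.
move=> nN; set A := rnorm _; have cA : 0 <= c0 * A.
  by rewrite mulr_ge0 ?rnorm_ge0 ?ltW.
apply: (root_le q1); rewrite ?qsum_ge0//; first by rewrite -mulrA mulr_ge0.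
have h j : (lo n <= j < lo n.+1)%N -> rnorm (a j) `^ q <=
    2 `^ q * (rnorm (centered a j) `^ q + rnorm (mean a n) `^ q).
  move=> /andP[h1 h2]; apply: le_trans (powR_add_le q1 (rnorm_ge0 _) (rnorm_ge0 _)).
  apply: ler_pow => //; first exact: rnorm_ge0.
  by rewrite /centered (lev_eq h1 h2) -{1}[a j](subrK (mean a n)) rnormD.
apply: (le_trans (ler_sum_nat h)).
rewrite -mulr_sumr big_split /= sumr_const_nat size_block.
rewrite -[X in _ * (_ + X) <= _]mulr_natl natrX -(root2Xq q1).
rewrite -powRM ?rnorm_ge0 ?(ltW (root2X_gt0 q1 _))//.
have h1 : \sum_(lo n <= j < lo n.+1) rnorm (centered a j) `^ q <= (c0 * A) `^ q.
  apply: (@le_trans _ _ (qsum (centered a) 0 (lo N))).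
    by apply: qsum_sub => //; exact: lo_homo.
  rewrite -[leLHS](root_powRK q1); last exact: qsum_ge0.
  by apply: ler_pow => //; [exact: powR_ge0|exact: qsum_center_le].
have h2 : (rho ^+ n * rnorm (mean a n)) `^ q <= (c0 * A) `^ q.
  apply: ler_pow => //; last exact: wmean_part_le.
  by rewrite mulr_ge0 ?rnorm_ge0 ?(ltW (root2X_gt0 q1 _)).
have -> : (4 * c0 * A) `^ q = 2 `^ q * (2 `^ q * (c0 * A) `^ q).
  have -> : 4 * c0 * A = 2 * (2 * (c0 * A)) by lra.
  rewrite powRM//; last exact: mulr_ge0.
  by congr (_ * _); rewrite powRM.
rewrite ler_wpM2l ?powR_ge0//.
have c2 : 2 <= 2 `^ q :> R by rewrite le1r_powR ?ltW// ltr1n.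
have := ler_wpM2r (powR_ge0 (c0 * A) q) c2; lra.
Qed.

(** The y-part is estimated by the triangle inequality, which is efficient on a
    single block and on vectors whose averages decay along the blocks. *)
Lemma psum_dkk_le a N : rnorm (psum z a (lo N)) <=
  8 * C * qsum a 0 (lo N) `^ q^-1 + C * \sum_(0 <= n < N)
    rho ^+ n * ((2 ^+ n)^-1 * \sum_(lo n <= j < lo n.+1) rnorm (a j)).
Proof.
rewrite psum_dkk; apply: le_trans (rnormD _ _) (lerD _ _).
  apply: le_trans (es_upper _ _) _; rewrite [8 * C]mulrC -mulrA ler_wpM2l ?(ltW C0)//.
  rewrite -root_qsumM ?qsum_ge0//.
  by apply: ler_root => //; [exact: qsum_ge0|exact: qsum_center].
rewrite (le_trans (rnorm_sum _ _ _))// mulr_sumr; apply: ler_sum => n _.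
rewrite rnormZ mulrC ler_pM ?rnorm_ge0// wmean_norm.
by rewrite ler_wpM2l ?rnorm_mean_le ?(ltW (root2X_gt0 q1 _)).
Qed.

Let cB : R := 10 * C.

Lemma block_part_le a n :
  rnorm (block_part a n) <= cB * qsum a (lo n) (lo n.+1) `^ q^-1.
Proof.
pose b := trunc (fun j => (lo n <= j)%N) a.
have bE j : (lo n <= j < lo n.+1)%N -> b j = a j by move=> /andP[h _]; rewrite /b /trunc h.
have b0 j : (j < lo n)%N -> b j = 0 by move=> h; rewrite /b /trunc leqNgt h.
have -> : block_part a n = psum z b (lo n.+1).
  rewrite (psum_blocks _ _ (leqnSn n)) big_nat1 -[LHS]add0r; congr (_ + _).
    by rewrite /psum big_nat_cond big1// => j /andP[/andP[_ h] _]; rewrite b0// scale0r.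
  by apply: eq_big_nat => j /bE ->.
apply: le_trans (psum_dkk_le _ _) _; rewrite big_nat_recr//= big_nat_cond big1 ?add0r; last first.
  move=> m /andP[/andP[_ mn] _]; rewrite big_nat_cond big1 ?mulr0// => j /andP[/andP[_ h] _].
  by rewrite b0 ?rnorm0// (leq_trans h)// lo_homo.
have -> : qsum b 0 (lo n.+1) = qsum a (lo n) (lo n.+1).
  rewrite /qsum (@big_cat_nat _ _ _ (lo n))//= ?lo_homo// big_nat_cond big1 ?add0r.
    by apply: eq_big_nat => j /bE ->.
  by move=> j /andP[/andP[_ h] _]; rewrite b0// rnorm0 powR0.
rewrite (eq_big_nat _ _ (F2 := fun j => rnorm (a j))) => [|j /bE -> //].
have := ler_wpM2l (ltW C0) (wmean_le q1 a n); rewrite /cB; lra.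
Qed.

Lemma block_part_psum_le a b n N : (n < N)%N ->
  (forall j, (lo n <= j < lo n.+1)%N -> rnorm (b j) <= rnorm (a j)) ->
  rnorm (block_part b n) <= cB * (4 * c0) * rnorm (psum z a (lo N)).
Proof.
move=> nN ba; apply: le_trans (block_part_le _ _) _; rewrite -mulrA.
rewrite ler_wpM2l ?mulr_ge0 ?(ltW C0)//; apply: le_trans (block_qsum_le _ nN).
by apply: ler_root => //; [exact: qsum_ge0|exact: ler_qsum].
Qed.

Lemma psum_block_parts a N : psum z a (lo N) = \sum_(0 <= n < N) block_part a n.
Proof. exact: psum_blocks0. Qed.

Lemma psum_trunc_lo (x : nat -> X) a m N : (m <= lo N)%N ->
  psum x (trunc (fun j => (j < m)%N) a) (lo N) = psum x a m.
Proof. by move=> h; rewrite psum_trunc (minn_idPr h). Qed.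

(** A cut inside a block splits off one block part, on which the norm is an l_q
    norm up to constants; cuts between blocks are inherited from l_q and y. *)
Theorem dkk_basic : exists2 c : R, 0 < c & basic_seq z c.
Proof.
exists (c0 + cB * (4 * c0)) => [|a k M kM].
  by rewrite addr_gt0// !mulr_gt0.
pose N := M.+1; have MN : (M <= lo N)%N by rewrite (leq_trans (leq_lo M))// lo_homo.
pose b := trunc (fun j => (j < M)%N) a.
have -> : psum z a M = psum z b (lo N) by rewrite psum_trunc_lo.
have -> : psum z a k = psum z b k by rewrite psum_trunc (minn_idPl kM).
have /andP[h1 /ltnW h2] := lev_bounds k; set n := lev k in h1 h2.
have nN : (n < N)%N by rewrite ltnS (leq_trans (leq_lev k)).
have -> : psum z b k = psum z b (lo n) + block_part (trunc (fun j => (j < k)%N) b) n.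
  rewrite -[LHS](psum_trunc_lo z b h2) (psum_blocks _ _ (leqnSn n)) big_nat1.
  by rewrite psum_trunc (minn_idPl h1).
apply: le_trans (rnormD _ _) _; rewrite mulrDl lerD ?block_prefix_le 1?ltnW//.
apply: block_part_psum_le => // j _; rewrite {1}/trunc.
by case: ifP => // _; rewrite rnorm0 rnorm_ge0.
Qed.

(** Only logarithmically many blocks meet the first m indices, and each block
    is controlled unconditionally. *)
Theorem dkk_conditionality_upper : exists2 c : R, 0 <= c & forall a (P : pred nat) m,
  rnorm (psum z (trunc P a) m) <= c * (lev m).+1%:R * rnorm (psum z a m).
Proof.
exists (cB * (4 * c0)) => [|a P m]; first by rewrite !mulr_ge0// ltW.
pose N := (lev m).+1; have mN : (m <= lo N)%N by have /andP[_ /ltnW] := lev_bounds m.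
pose b := trunc (fun j => (j < m)%N) a.
have -> : psum z a m = psum z b (lo N) by rewrite psum_trunc_lo.
have -> : psum z (trunc P a) m = psum z (trunc P b) (lo N).
  rewrite -(psum_trunc_lo _ _ mN); apply: eq_psum => j _.
  by rewrite /b /trunc; case: ifP; case: ifP.
rewrite psum_block_parts; apply: le_trans (rnorm_sum _ _ _) _.
have h n : (0 <= n < N)%N -> rnorm (block_part (trunc P b) n) <=
    cB * (4 * c0) * rnorm (psum z b (lo N)).
  move=> /andP[_ nN]; apply: block_part_psum_le => // j _; rewrite {1}/trunc.
  by case: ifP => // _; rewrite rnorm0 rnorm_ge0.
apply: (le_trans (ler_sum_nat h)).
by rewrite sumr_const_nat subn0 -[leLHS]mulr_natr mulrAC.
Qed.

(** Coefficients that are constant on blocks have no part with zero averages, so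
    that blocks of the new basis act as the terms of y: the conditionality of the
    first N terms of y appears among the first lo N = 2^N - 1 new vectors. *)
Theorem dkk_conditionality_lower (b : nat -> K) (P : pred nat) N :
  exists a, psum z a (lo N) = psum y b N /\
    psum z (trunc (fun j => P (lev j)) a) (lo N) = psum y (trunc P b) N.
Proof.
have blk (c : nat -> K) : psum z (fun j => real_scalar (rho ^+ lev j)^-1 * c (lev j)) (lo N)
   = psum y c N.
  have mc n : mean (fun j => real_scalar (rho ^+ lev j)^-1 * c (lev j)) n =
      real_scalar (rho ^+ n)^-1 * c n.
    rewrite /mean (eq_big_nat _ _ (F2 := fun=> real_scalar (rho ^+ n)^-1 * c n)).
      rewrite (sum_block_const (_ : K^o)) /= -[_ *: _]/(_ * _) mulrA -real_scalarM mulVf.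
        by rewrite real_scalar1 mul1r.
      by rewrite expf_neq0.
    by move=> j /andP[h1 h2]; rewrite (lev_eq h1 h2).
  rewrite psum_dkk /psum big1 ?add0r => [|j _].
    apply: eq_bigr => n _; rewrite /wmean mc mulrA -real_scalarM mulfV.
      by rewrite real_scalar1 mul1r.
    by rewrite gt_eqF// root2X_gt0.
  by rewrite /centered mc subrr scale0r.
exists (fun j => real_scalar (rho ^+ lev j)^-1 * b (lev j)); split; first exact: blk.
rewrite -blk; apply: eq_psum => j _; rewrite /trunc; case: ifP => // _.
by rewrite mulr0.
Qed.

Lemma root2X_unbounded (D t : R) : 0 < t -> exists k, D <= rho ^+ k * t.
Proof.
move=> t0; have [D0|/ltW D0] := leP D 0.
  by exists 0%N; rewrite expr0 mul1r (le_trans D0)// ltW.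
exists (Num.truncn ((D / t) `^ q)).+1; rewrite -ler_pdivrMr//.
set k := (Num.truncn _).+1; have Dt : 0 <= D / t by rewrite divr_ge0 ?(ltW t0).
have <- : (2 ^+ k) `^ q^-1 = rho ^+ k.
  by rewrite -(root2Xq q1) powR_rootK ?(ltW (root2X_gt0 q1 _)).
apply: (le_root q1) => //; apply: le_trans (ltW (truncnS_gt _)) _.
by rewrite -natrX ler_nat; apply: ltnW (@ltn_expl 2 k _).
Qed.

(** Since q > 1, the ratio of rho^n to the size of the block decreases: long
    blocks see little of a vector with few coordinates. *)
Lemma root2_ratio m n : (m <= n)%N ->
  rho ^+ n * (2 ^+ n)^-1 <= rho ^+ m * (2 ^+ m)^-1.
Proof.
move=> mn; rewrite -!exprVn -!exprMn ler_wiXn2l//.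
  by rewrite mulr_ge0 ?invr_ge0// ltW// root2_gt0.
rewrite ler_pdivrMr// mul1r ler1_powR ?ler1n//.
by rewrite invf_le1// ltW.
Qed.

(** Blocks are split at the first level k at which rho^k t exceeds the norm of
    g. Below it the threshold t costs a geometric sum. From it on the averages of
    g are at most t/2, so that on G both g and t are dominated by the part of g
    with zero averages, and powR_trade turns the sum of the averages of g
    restricted to G into a power sum. *)
Theorem dkk_threshold : exists2 c : R, 0 < c & forall N (g : nat -> K) (G : pred nat) t,
  0 < t -> (forall j, G j -> t <= rnorm (g j)) ->
  (forall j, ~~ G j -> rnorm (g j) <= t) ->
  rnorm (psum z (trunc G g) (lo N)) <= c * rnorm (psum z g (lo N)) /\
  t * (\sum_(0 <= j < lo N) (G j)%:R) `^ q^-1 <= c * rnorm (psum z g (lo N)).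
Proof.
(* Real inequalities, stated apart from the vectors that they are applied to. *)
have half_le (x u v t : R) : x <= u + v -> t <= x -> v <= t / 2 -> x <= 2 * u by lra.
have le_half (x u v t : R) : 2 * x <= u * t -> u * t <= v * t -> x <= v * (t / 2) by nra.
have three (a b x e : R) : a <= 2 * x -> b <= x -> 3 * x <= e -> a + b <= e by lra.
have six (c x : R) : 3 * (2 * (c * x)) = 6 * c * x by ring.
have total (B g b n1 n2 n3 n4 n5 : R) : n2 <= B + b * (g * (2 * B)) ->
    n3 <= 8 * C * n4 + C * n5 -> n1 <= n2 + n3 -> C * n4 <= C * (2 * B) ->
    C * n5 <= C * (2 * B) -> n1 <= (1 + 2 * g * b + 18 * C) * B by nra.
have [cg cg0 geom] := root2_geometric q1.
have cB_gt0 : 0 < cB by rewrite mulr_gt0.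
exists (c0 * (1 + 2 * cg * cB + 18 * C) + 6 * c0) => [|N g G t t0 Gt tG].
  by rewrite !addr_gt0// !mulr_gt0 ?addr_gt0 ?mulr_gt0.
set A := rnorm (psum z g (lo N)).
have A0 : 0 <= A by exact: rnorm_ge0.
have cA0 : 0 <= c0 * A by rewrite mulr_ge0 ?(ltW c0_gt0).
(* The factor 2 makes averages above the level k at most t / 2. *)
pose D := 2 * (c0 * A); have D0 : 0 <= D by rewrite mulr_ge0.
have exk : exists k, D <= rho ^+ k * t by exact: root2X_unbounded.
pose k := ex_minn exk.
have Dk : D <= rho ^+ k * t by rewrite /k; case: ex_minnP.
have kD n : (n < k)%N -> rho ^+ n * t < D.
  by rewrite /k; case: ex_minnP => m _ h nm; rewrite ltNge; apply/negP => /h; rewrite leqNgt nm.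
(* The level k may exceed the number N of blocks. *)
pose k0 := minn k N; have k0N : (k0 <= N)%N by exact: geq_minr.
have k0D n : (n < k0)%N -> rho ^+ n * t < D by rewrite leq_min => /andP[/kD].
have geomD : \sum_(0 <= n < k0) rho ^+ n * t <= cg * D.
  rewrite -mulr_suml -ler_pdivlMr// -mulrA; apply: geom; first by rewrite divr_ge0// ltW.
  by move=> n /k0D; rewrite -ltr_pdivlMr// => /ltW.
pose h := trunc (fun j => G j && (lo k0 <= j)%N) g.
have big j : (j < lo N)%N -> G j -> (lo k0 <= j)%N ->
    (k <= lev j)%N /\ rnorm (g j) <= 2 * rnorm (centered g j).
  move=> jN Gj k0j; have nN := lev_lt jN.
  have kn : (k <= lev j)%N by have := lev_ge k0j; rewrite geq_min [(N <= _)%N]leqNgt nN orbF.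
  split=> //; have := wmean_part_le g nN; rewrite -/A => h1.
  have := rnormD (centered g j) (mean g (lev j)); rewrite /centered subrK => h2.
  apply: half_le h2 (Gt _ Gj) _.
  rewrite -(ler_pM2l (root2X_gt0 q1 (lev j))); apply: (le_trans h1).
  exact: le_half Dk (ler_wpM2r (ltW t0) (root2X_le q1 kn)).
have hG j : (j < lo N)%N -> h j = 0 \/
    [/\ G j, (lo k0 <= j)%N, h j = g j, (k <= lev j)%N & rnorm (g j) <= 2 * rnorm (centered g j)].
  move=> jN; rewrite /h /trunc; case: ifP => [/andP[Gj k0j]|]; last by left.
  by right; have [] := big _ jN Gj k0j.
have hD : qsum h 0 (lo N) <= D `^ q.
  apply: (@le_trans _ _ (2 `^ q * qsum (centered g) 0 (lo N))).
    rewrite mulr_sumr; apply: ler_sum_nat => j /andP[_ jN].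
    have [->|[Gj k0j -> _ gc]] := hG _ jN.
      by rewrite rnorm0 powR0// mulr_ge0 ?powR_ge0.
    by rewrite -powRM ?rnorm_ge0//; apply: ler_pow => //; exact: rnorm_ge0.
  rewrite /D powRM// ler_wpM2l ?powR_ge0// -[leLHS](root_powRK q1) ?qsum_ge0//.
  by apply: ler_pow => //; [exact: powR_ge0|exact: qsum_center_le].
have hD' : qsum h 0 (lo N) `^ q^-1 <= D by rewrite root_le ?qsum_ge0.
split.
- have -> : psum z (trunc G g) (lo N) = psum z (trunc G g) (lo k0) + psum z h (lo N).
    rewrite (psum_blocks _ _ k0N); congr (_ + _).
    rewrite (psum_blocks _ _ k0N) /psum [X in _ = X + _]big_nat_cond.
    rewrite [X in _ = X + _]big1 ?add0r.
      rewrite -!big_lo//; apply: eq_big_nat => j /andP[h1 _].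
      by rewrite /h /trunc h1 andbT.
    by move=> j /andP[/andP[_ jk] _]; rewrite /h /trunc leqNgt jk andbF scale0r.
  have small : rnorm (psum z (trunc G g) (lo k0)) <= c0 * A + cB * (cg * D).
    have -> : psum z (trunc G g) (lo k0) = psum z g (lo k0)
        - psum z (trunc (fun j => ~~ G j) g) (lo k0).
      rewrite psumB; apply: eq_psum => j _; rewrite /trunc.
      by case: (G j); rewrite ?subr0 ?subrr.
    apply: le_trans (rnormB _ _) (lerD (block_prefix_le _ k0N) _).
    rewrite psum_block_parts; apply: le_trans (rnorm_sum _ _ _) _.
    apply: (@le_trans _ _ (\sum_(0 <= n < k0) cB * (rho ^+ n * t))); last first.
      by rewrite -mulr_sumr ler_wpM2l ?(ltW cB_gt0).
    apply: ler_sum => n _; apply: le_trans (block_part_le _ _) _.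
    rewrite ler_wpM2l ?(ltW cB_gt0)//; apply: (root_le q1).
    - by rewrite mulr_ge0 ?(ltW (root2X_gt0 q1 _)) ?(ltW t0).
    - exact: qsum_ge0.
    rewrite powRM ?(ltW (root2X_gt0 q1 _)) ?(ltW t0)// root2Xq//.
    have -> : 2 ^+ n * t `^ q = \sum_(lo n <= j < lo n.+1) t `^ q.
      by rewrite sumr_const_nat size_block -[RHS]mulr_natl natrX.
    apply: ler_sum => j _; apply: ler_pow => //; first exact: rnorm_ge0.
    by rewrite /trunc; case: ifP => [/tG//|_]; rewrite rnorm0 ltW.
  have l1 : \sum_(0 <= n < N)
      rho ^+ n * ((2 ^+ n)^-1 * \sum_(lo n <= j < lo n.+1) rnorm (h j)) <= D.
    pose W := rho ^+ k * t; have W0 : 0 < W by rewrite mulr_gt0 ?root2X_gt0.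
    (* At W = rho^k t the weight of powR_trade is that of block k times its value at
       the level t. *)
    have WE : W `^ (1 - q) = rho ^+ k * (2 ^+ k)^-1 * t `^ (1 - q).
      rewrite powRM ?(ltW (root2X_gt0 q1 _)) ?(ltW t0)//; congr (_ * _).
      rewrite powRB ?(gt_eqF (root2X_gt0 q1 _)) ?implybT//.
      by rewrite root2Xq// powRr1// ltW// root2X_gt0.
    apply: (@le_trans _ _ (W `^ (1 - q) * qsum h 0 (lo N))); last first.
      apply: le_trans (powR_trade_le q1 D0 Dk W0); rewrite mulrC.
      by rewrite ler_wpM2r ?powR_ge0.
    rewrite [qsum h 0 _](qsum_blocks q h (leq0n N)) mulr_sumr.
    apply: ler_sum_nat => n /andP[_ nN].
    rewrite mulrA !mulr_sumr; apply: ler_sum_nat => j /andP[h1 h2].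
    have jN : (j < lo N)%N by rewrite (leq_trans h2)// lo_homo.
    have [->|[Gj k0j -> kn _]] := hG _ jN.
      by rewrite rnorm0 mulr0 mulr_ge0 ?powR_ge0.
    rewrite (lev_eq h1 h2) in kn.
    rewrite WE -[leRHS]mulrA; apply: ler_pM; rewrite ?rnorm_ge0//.
    - by rewrite mulr_ge0 ?(ltW (root2X_gt0 q1 _))// invr_ge0 exprn_ge0.
    - exact: root2_ratio.
    - by rewrite mulrC; exact: powR_trade (Gt _ Gj).
  have c6 : 0 <= 6 * c0 by rewrite mulr_ge0// (ltW c0_gt0).
  rewrite mulrDl -[leLHS]addr0; apply: lerD; last exact: mulr_ge0.
  rewrite -[leRHS]mulrA [leRHS]mulrCA; apply: total small (psum_dkk_le h N) (rnormD _ _) _ _;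
    by rewrite ?ler_wpM2l ?(ltW C0).
- apply: (@le_trans _ _ (3 * D)); last first.
    rewrite [leRHS]mulrDl -[leLHS]add0r lerD//.
      by rewrite !(mulr_ge0, addr_ge0, ltW c0_gt0, ltW cg0, ltW C0, ltW cB_gt0).
    by rewrite /D six.
  set S := \sum_(_ <= _ < _) _.
  have S0 : 0 <= S by apply: sumr_ge0 => j _; rewrite ler0n.
  rewrite -root_qsumM ?(ltW t0)//; apply: (root_le q1).
  - exact: mulr_ge0.
  - by rewrite mulr_ge0// powR_ge0.
  have -> : S = \sum_(0 <= j < lo k0) (G j)%:R + \sum_(lo k0 <= j < lo N) (G j)%:R.
    by rewrite /S (@big_cat_nat _ _ _ (lo k0))//= lo_homo.
  have S1 : t `^ q * \sum_(0 <= j < lo k0) (G j)%:R <= 2 * D `^ q.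
    have [k00|[m k0m]] : k0 = 0%N \/ exists m, k0 = m.+1.
    + by case: (k0) => [|m]; [left|right; exists m].
    + by rewrite k00 big_geq ?mulr0 ?mulr_ge0 ?powR_ge0.
    apply: (@le_trans _ _ (t `^ q * (2 * 2 ^+ m))).
      rewrite ler_wpM2l ?powR_ge0// -exprS -natrX.
      apply: (@le_trans _ _ ((lo k0)%:R)); last by rewrite ler_nat k0m /lo leq_pred.
      rewrite -[leRHS]mulr1n -[lo k0 in leRHS]subn0 -sumr_const_nat.
      by apply: ler_sum => j _; case: (G j).
    rewrite mulrCA ler_wpM2l// -(root2Xq q1) mulrC.
    rewrite -powRM ?(ltW (root2X_gt0 q1 _)) ?(ltW t0)//; apply: ler_pow => //.
      by rewrite mulr_ge0 ?(ltW (root2X_gt0 q1 _)) ?(ltW t0).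
    by rewrite ltW// k0D// k0m.
  have S2 : t `^ q * \sum_(lo k0 <= j < lo N) (G j)%:R <= D `^ q.
    apply: (@le_trans _ _ (qsum h (lo k0) (lo N))); last first.
      by apply: le_trans hD; exact: qsum_sub.
    rewrite mulr_sumr; apply: ler_sum_nat => j /andP[k0j _].
    rewrite /h /trunc k0j andbT; case Gj: (G j); last by rewrite mulr0 powR_ge0.
    by rewrite mulr1; apply: ler_pow (Gt _ Gj) => //; exact: ltW.
  rewrite mulrDr powRM//; apply: three S1 S2 _.
  by rewrite ler_wpM2r ?powR_ge0// le1r_powR ?(ltW q1)// ler1n.
Qed.

(** Blocks of size up to m contribute averages at most t, and a geometric sum;
    longer blocks share the m coordinates, each with the weight rho^n / 2^n, which
    root2_ratio bounds by its value at the level log m. *)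
Theorem dkk_upper : exists2 c : R, 0 < c & forall N (h : nat -> K) (E : pred nat) t m,
  0 <= t -> (0 < m)%N -> (forall j, rnorm (h j) <= t * (E j)%:R) ->
  \sum_(0 <= j < lo N) (E j)%:R <= m%:R :> R ->
  rnorm (psum z h (lo N)) <= c * (t * m%:R `^ q^-1).
Proof.
have final (cg t M x e : R) : x <= t * M -> e <= t * (cg * M) + 2 * (t * M) ->
    8 * C * x + C * e <= (8 * C + C * (cg + 2)) * (t * M).
  by move=> /(ler_wpM2l (ltW C0)) h1 /(ler_wpM2l (ltW C0)) h2; nra.
have [cg cg0 geom] := root2_geometric q1.
exists (8 * C + C * (cg + 2)) => [|N h E t m t0 m0 hE Em].
  by rewrite !(addr_gt0, mulr_gt0).
set M := m%:R `^ q^-1; have M0 : 0 <= M by exact: powR_ge0.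
have hq : qsum h 0 (lo N) `^ q^-1 <= t * M.
  rewrite -root_qsumM//; apply: ler_root; rewrite ?qsum_ge0//.
  apply: (@le_trans _ _ (t `^ q * \sum_(0 <= j < lo N) (E j)%:R)); last first.
    by rewrite ler_wpM2l ?powR_ge0.
  rewrite mulr_sumr; apply: ler_sum => j _.
  apply: le_trans (ler_pow q1 (rnorm_ge0 _) (hE j)) _.
  by case: (E j); rewrite ?mulr1// !mulr0 powR0.
pose k := trunc_log 2 m; have /andP[km mk] := trunc_log_bounds (isT : (1 < 2)%N) m0.
have rkM n : (n <= k)%N -> rho ^+ n <= M.
  move=> nk; apply: (le_root q1); rewrite ?(ltW (root2X_gt0 q1 _))// root2Xq//.
  by rewrite -natrX ler_nat (leq_trans _ km)// leq_exp2l.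
have l1 : \sum_(0 <= n < N)
      rho ^+ n * ((2 ^+ n)^-1 * \sum_(lo n <= j < lo n.+1) rnorm (h j)) <=
      t * (cg * M) + 2 * (t * M).
  apply: (@le_trans _ _ (\sum_(0 <= n < N) (t * (if (n < k)%N then rho ^+ n else 0) +
    t * (rho ^+ k * (2 ^+ k)^-1) * \sum_(lo n <= j < lo n.+1) (E j)%:R))).
    apply: ler_sum_nat => n _.
    have Eb : \sum_(lo n <= j < lo n.+1) rnorm (h j) <=
        t * \sum_(lo n <= j < lo n.+1) (E j)%:R.
      by rewrite mulr_sumr; apply: ler_sum.
    have E0 : 0 <= \sum_(lo n <= j < lo n.+1) (E j)%:R :> R.
      by apply: sumr_ge0 => j _; rewrite ler0n.
    have pos i : 0 <= rho ^+ i * (2 ^+ i)^-1.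
      by rewrite mulr_ge0 ?(ltW (root2X_gt0 q1 _))// invr_ge0 exprn_ge0.
    case: ifP => [nk|/negbT]; last rewrite -leqNgt => kn.
      apply: ler_wpDr; first by apply: mulr_ge0 => //; exact: mulr_ge0 (pos _).
      rewrite [leRHS]mulrC ler_wpM2l ?(ltW (root2X_gt0 q1 _))//.
      rewrite mulrC ler_pdivrMr ?exprn_gt0//; apply: le_trans Eb _.
      rewrite ler_wpM2l// -natrX -size_block -[leRHS]mulr1n -sumr_const_nat.
      by apply: ler_sum => j _; case: (E j).
    rewrite mulr0 add0r [leLHS]mulrA; apply: le_trans (ler_wpM2l (pos n) Eb) _.
    by rewrite mulrA [_ * t]mulrC ler_wpM2r// ler_wpM2l// root2_ratio.
  rewrite big_split /=; apply: lerD.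
    rewrite -mulr_sumr ler_wpM2l//; apply: le_trans (geom k M M0 _); last first.
      by move=> n /ltnW/rkM.
    suff -> : \sum_(0 <= n < N) (if (n < k)%N then rho ^+ n else 0) =
        \sum_(0 <= n < minn N k) rho ^+ n.
      rewrite [leRHS](@big_cat_nat _ _ _ (minn N k))//= ?geq_minr// lerDl.
      by apply: sumr_ge0 => n _; rewrite ltW// root2X_gt0.
    elim: N {hE Em hq} => [|N IH]; first by rewrite min0n !big_geq.
    rewrite big_nat_recr//= IH; have [Nk|kN] := ltnP N k.
      by rewrite (minn_idPl Nk) big_nat_recr.
    by rewrite (minn_idPr (leqW kN)) addr0.
  rewrite -mulr_sumr -big_lo// lo0.
  apply: (@le_trans _ _ (t * (rho ^+ k * (2 ^+ k)^-1) * m%:R)).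
    apply: ler_wpM2l => //; apply: mulr_ge0 => //; apply: mulr_ge0.
      exact: ltW (root2X_gt0 q1 _).
    by rewrite invr_ge0 exprn_ge0.
  rewrite -[leLHS]mulrA [leRHS]mulrCA ler_wpM2l// -mulrA [leRHS]mulrC.
  apply: ler_pM; rewrite ?rkM ?(ltW (root2X_gt0 q1 _))//.
  by rewrite mulrC ler_pdivrMr ?exprn_gt0// -exprS -natrX ler_nat ltnW.
apply: le_trans (psum_dkk_le h N) _; apply: final hq l1.
Qed.

End DKKBasis.

(** * From coordinate estimates to greedy-type properties *)

Section Conclusions.
Context {R : realType} {s : scalar_kind}.
Local Notation K := (scalar_field R s).
Variables (X : completeNormedModType K) (q : R) (z : nat -> X) (c : R).
Hypothesis q1 : 1 < q.
Hypothesis c0 : 0 < c.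
Hypothesis z_basic : basic_seq z c.
Hypothesis z_dense : dense_span z.
Hypothesis z_threshold : forall N (g : nat -> K) (G : pred nat) t,
  0 < t -> (forall j, G j -> t <= rnorm (g j)) ->
  (forall j, ~~ G j -> rnorm (g j) <= t) ->
  rnorm (psum z (trunc G g) (lo N)) <= c * rnorm (psum z g (lo N)) /\
  t * (\sum_(0 <= j < lo N) (G j)%:R) `^ q^-1 <= c * rnorm (psum z g (lo N)).
Hypothesis z_upper : forall N (h : nat -> K) (E : pred nat) t m,
  0 <= t -> (0 < m)%N -> (forall j, rnorm (h j) <= t * (E j)%:R) ->
  \sum_(0 <= j < lo N) (E j)%:R <= m%:R :> R ->
  rnorm (psum z h (lo N)) <= c * (t * m%:R `^ q^-1).

Lemma sum_mem_fset (A : {fset nat}) M : (forall j, j \in A -> (j < M)%N) ->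
  \sum_(0 <= j < M) (j \in A)%:R = #|` A|%:R :> R.
Proof.
move=> AM; rewrite -natr_sum; congr (_%:R).
rewrite -big_mkcond /= sum1_count -size_filter; apply: perm_size.
apply: uniq_perm; rewrite ?filter_uniq ?iota_uniq ?fset_uniq// => j.
rewrite mem_filter mem_index_iota /=; case jA: (j \in A) => //=.
by rewrite AM.
Qed.

Lemma fset_bounded (A : {fset nat}) : exists N, forall M, (N <= M)%N ->
  forall j, j \in A -> (j < lo M)%N.
Proof.
exists (\max_(j <- A) j).+1 => M NM j jA; apply: leq_trans (leq_lo M).
by apply: leq_trans NM; rewrite ltnS; apply: leq_bigmax_seq.
Qed.

Lemma fset_argmin (A : {fset nat}) (v : nat -> R) : A != fset0 ->
  exists2 k, k \in A & forall j, j \in A -> v k <= v j.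
Proof.
have argmin (l : seq nat) i : i \in l ->
    exists2 k, k \in l & forall j, j \in l -> v k <= v j.
  elim: l i => // x l IH i _; case: l IH => [_|y l IH].
    by exists x => [|j]; rewrite !inE// => /eqP ->.
  have [|k kl hk] := IH y; first by rewrite inE eqxx.
  have [xk|/ltW kx] := leP (v x) (v k).
    exists x => [|j]; first by rewrite inE eqxx.
    by rewrite inE => /predU1P[-> //|/hk]; exact: le_trans.
  exists k => [|j]; first by rewrite inE kl orbT.
  by rewrite inE => /predU1P[-> //|/hk].
by move=> /fset0Pn[i iA]; exact: argmin (enum_fset A) i iA.
Qed.

Lemma psum_unit j M : (j < M)%N -> psum z (fun i => (i == j)%:R) M = z j.
Proof.
move=> jM; rewrite /psum big_mkord (bigD1 (Ordinal jM))//= eqxx scale1r big1 ?addr0//.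
by move=> i; rewrite -val_eqE /= => /negbTE ->; rewrite scale0r.
Qed.

Lemma term_norm_bounds j : c^-1 <= rnorm (z j) <= c.
Proof.
have jN : (j < lo j.+1)%N by rewrite (leq_ltn_trans (leq_lo j))// lo_lt_S.
have S1 : \sum_(0 <= i < lo j.+1) (i == j)%:R = 1 :> R.
  rewrite big_mkord (bigD1 (Ordinal jN))//= eqxx big1 ?addr0//.
  by move=> i; rewrite -val_eqE /= => /negbTE ->.
have unitn i : rnorm ((i == j)%:R : K) = (i == j)%:R.
  by case: (i == j); rewrite ?rnorm1 ?rnorm0.
apply/andP; split.
  have [|i|i|_] := @z_threshold j.+1 (fun i => (i == j)%:R) (pred1 j) 1.
  - exact: ltr01.
  - by move=> /= /eqP ->; rewrite unitn eqxx.
  - by move=> /= /negbTE ->; rewrite rnorm0.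
  - by rewrite psum_unit// /= S1 mul1r powR1 -ler_pdivrMl// mulr1.
have := @z_upper j.+1 (fun i => (i == j)%:R) (pred1 j) 1 1.
rewrite psum_unit// mul1r powR1 mulr1; apply => //; first by move=> i; rewrite unitn mul1r.
by rewrite /= S1.
Qed.

Lemma term_neq0 j : z j != 0.
Proof.
have /andP[h _] := term_norm_bounds j; rewrite -rnorm_gt0 (lt_le_trans _ h)//.
by rewrite invr_gt0.
Qed.

Lemma terms_schauder : schauder_basis z.
Proof. exact: basic_seq_basis c0 z_basic term_neq0 z_dense. Qed.

Theorem banach_basis_of_estimates : banach_basis z.
Proof.
split; first exact: terms_schauder.
by exists c^-1, c; split; [rewrite invr_gt0|exact: term_norm_bounds].
Qed.

Let out (A : {fset nat}) : pred nat := fun j => j \notin A.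

(** With G = F \ A and E = A \ F, removing F instead of A from a costs the
    projection onto the greedy set G, and the part on E, whose coordinates are
    below those on G and which has at most as many of them. *)
Lemma almost_greedy_finite : exists2 d : R, 0 < d &
  forall N (a : nat -> K) (A F : {fset nat}),
  (#|` A| <= #|` F|)%N -> (forall j, j \in A -> (j < lo N)%N) ->
  (forall j, j \in F -> (j < lo N)%N) ->
  (forall j k, j \notin F -> k \in F -> rnorm (a j) <= rnorm (a k)) ->
  rnorm (psum z (trunc (out F) a) (lo N)) <= d * rnorm (psum z (trunc (out A) a) (lo N)).
Proof.
have total (x y w u : R) : x <= y + w + u -> w <= c * y -> u <= c * (c * y) ->
  x <= (1 + c + c * c) * y by nra.
exists (1 + c + c * c) => [|N a A F AF AN FN greedy].
  by rewrite !addr_gt0// mulr_gt0.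
set g := trunc (out A) a; have g0 := rnorm_ge0 (psum z g (lo N)).
pose G := (F `\` A)%fset; pose E := (A `\` F)%fset.
have EG : (#|` E| <= #|` G|)%N.
  have h1 := cardfsID F A; have h2 := cardfsID A F.
  by rewrite fsetIC in h2; rewrite /E /G; lia.
have ext : psum z (trunc (out F) a) (lo N) = psum z g (lo N)
    - psum z (trunc (mem G) g) (lo N) + psum z (trunc (mem E) a) (lo N).
  rewrite psumB -psumD; apply: eq_psum => j _; rewrite /trunc /g /out /trunc /=.
  rewrite !inE; case: (j \in F); case: (j \in A) => /=;
    by rewrite ?subr0 ?subrr ?addr0 ?add0r.
have [G0|/(fset_argmin (fun j => rnorm (a j)))[k kG kmin]] := eqVneq G fset0.
  have E0 : E = fset0 by apply: cardfs0_eq; move: EG; rewrite G0 cardfs0; lia.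
  rewrite ext /psum [X in _ - X]big1 ?[X in _ + X]big1 ?subr0 ?addr0.
  - rewrite -/(psum _ _ _) ler_peMl// -addrA lerDl addr_ge0 ?mulr_ge0 ?ltW//.
  - by move=> j _; rewrite /trunc /= E0 in_fset0 scale0r.
  - by move=> j _; rewrite /trunc /= G0 in_fset0 scale0r.
have /andP[kA kF] : (k \notin A) && (k \in F) by move: kG; rewrite inE.
have [t0|t0] := eqVneq (rnorm (a k)) 0.
  rewrite [X in rnorm X]big1 ?rnorm0; first by rewrite mulr_ge0// !addr_ge0 ?mulr_ge0 ?ltW.
  move=> j _; rewrite /trunc /out; case: ifP => [jF|]; last by rewrite scale0r.
  have := greedy _ _ jF kF; rewrite t0 => h.
  have /eqP : rnorm (a j) = 0 by apply/eqP; rewrite eq_le h rnorm_ge0.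
  by rewrite rnorm_eq0 => /eqP ->; rewrite scale0r.
set t := rnorm (a k) in t0 kmin; have t_gt0 : 0 < t by rewrite lt_neqAle eq_sym t0 rnorm_ge0.
have [||gG tG] := z_threshold N t_gt0 (g := g) (G := mem G).
- by move=> j jG; rewrite /g /trunc /out; move: (jG); rewrite /= inE => /andP[-> _]; exact: kmin.
- move=> j jG; rewrite /g /trunc /out; case: ifP => [jA|]; last by rewrite rnorm0 ltW.
  by apply: greedy => //; move: jG; rewrite /= inE jA.
have m0 : (0 < #|` G|)%N by rewrite cardfs_gt0; apply/fset0Pn; exists k.
apply: (total _ _ _ (rnorm (psum z (trunc (mem E) a) (lo N))) _ gG).
  rewrite ext; apply: le_trans (rnormD _ _) _; rewrite lerD2r; exact: rnormB.
apply: le_trans (z_upper (E := mem E) (t := t) (m := #|` G|) _ m0 _ _) _; first exact: ltW.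
- move=> j; rewrite /trunc; case: ifP => [jE|_]; last by rewrite rnorm0 mulr0.
  rewrite mulr1; apply: greedy => //; by move: jE; rewrite /= inE => /andP[].
- rewrite sum_mem_fset; first by rewrite ler_nat.
  by move=> j; rewrite inE => /andP[_ /AN].
rewrite ler_wpM2l ?(ltW c0)//; apply: le_trans tG; rewrite sum_mem_fset//.
by move=> j; rewrite inE => /andP[_ /FN].
Qed.

Lemma mem_fset_set (F : {fset nat}) j : (j \in [set` F]%classic) = (j \in F).
Proof. by apply/idP/idP; rewrite inE. Qed.

Lemma basis_proj_fset f (F : {fset nat}) M : (forall j, j \in F -> (j < M)%N) ->
  basis_proj z [set` F]%classic f = psum z (trunc (mem F) (basis_coord z f)) M.
Proof.
move=> FM; rewrite (basis_projE (N := M)).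
  by apply: eq_psum => j _; rewrite /trunc mem_fset_set.
by move=> j; rewrite mem_fset_set => /FM; rewrite ltnNge => /negbTE ->.
Qed.

(** Long partial sums of f approximate both sides. *)
Theorem almost_greedy_of_estimates : almost_greedy z.
Proof.
have [d d0 hd] := almost_greedy_finite; exists d => f A F AF greedy.
pose a := basis_coord z f; have fa : expansion z f a := basis_coordP terms_schauder (f:=f).
have [N1 hA] := fset_bounded A; have [N2 hF] := fset_bounded F.
have total (e u v w l r : R) : e * (1 + d) = l -> u <= e -> v <= e + w -> r <= d * v ->
  u + r <= d * w + l by nra.
apply/ler_addgt0Pr => e e0; have d1 : 0 < 1 + d by rewrite addr_gt0.
have /expansionP/(_ _ (divr_gt0 e0 d1))[N3 hN] := fa.
pose N := maxn (maxn N1 N2) N3.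
have hA' j : j \in A -> (j < lo N)%N by apply: hA; rewrite !leq_max leqnn.
have hF' j : j \in F -> (j < lo N)%N by apply: hF; rewrite !leq_max leqnn orbT.
have {}hN : rnorm (psum z a (lo N) - f) < e / (1 + d).
  by apply: hN; rewrite (leq_trans _ (leq_lo N))// leq_maxr.
have outE (B : {fset nat}) : psum z (trunc (out B) a) (lo N) =
    psum z a (lo N) - psum z (trunc (mem B) a) (lo N).
  rewrite psumB; apply: eq_psum => j _; rewrite /trunc /out /=.
  by case: (j \in B); rewrite ?subrr ?subr0.
have := hd N a A F AF hA' hF' greedy.
rewrite !outE -!basis_proj_fset// => h.
apply: le_trans (rnorm_dist (psum z a (lo N)) _ _) _.
apply: total (divfK (lt0r_neq0 d1) e) _ _ h; first by rewrite rnorm_distC ltW.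
apply: le_trans (rnorm_dist f _ _) _.
by rewrite lerD2r ltW.
Qed.

Lemma sum_fset_psum (A : {fset nat}) N : (forall j, j \in A -> (j < N)%N) ->
  \sum_(j <- A) z j = psum z (fun j => (j \in A)%:R) N.
Proof.
move=> AN; rewrite /psum [RHS](eq_bigr (fun j => if j \in A then z j else 0)); last first.
  by move=> j _; case: (j \in A) => /=; rewrite ?scale1r ?scale0r.
rewrite -big_mkcond /= -[RHS]big_filter; apply: perm_big; apply: uniq_perm.
- exact: fset_uniq.
- by rewrite filter_uniq ?iota_uniq.
- move=> j; rewrite mem_filter mem_index_iota /=.
  by case jA: (j \in A) => //=; rewrite AN.
Qed.

(** For a sum of basis vectors the two bounds are z_upper and the second half of
    z_threshold at t = 1. *)
Theorem fundamental_function_of_estimates : equivalent_on [set m | (1 <= m)%N]%classic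
  (fundamental_function z) (fun m => (m%:R `^ q^-1)%:E).
Proof.
have indn (A : {fset nat}) j : rnorm ((j \in A)%:R : K) = (j \in A)%:R.
  by case: (j \in A); rewrite ?rnorm1 ?rnorm0.
split; exists c => m /= m1.
  apply: ge_ereal_sup => _ [A Am ->]; rewrite -EFinM lee_fin.
  have [N0 hA] := fset_bounded A; have AN := hA N0 (leqnn _).
  rewrite (sum_fset_psum AN) -[m%:R `^ _]mul1r.
  apply: (z_upper (E := mem A)) => // [j|]; first by rewrite indn mul1r.
  by rewrite sum_mem_fset// ler_nat.
pose A : {fset nat} := [fset j in iota 0 m]%fset.
have Am : #|` A| = m by rewrite card_fseq undup_id ?iota_uniq// size_iota.
have [N0 hA] := fset_bounded A; have AN := hA N0 (leqnn _).
have [|j|j|_] := z_threshold (g := fun j => (j \in A)%:R) (G := mem A) N0 (t := 1).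
- exact: ltr01.
- by move=> /= jA; rewrite indn jA.
- by move=> /= /negbTE jA; rewrite indn jA.
rewrite mul1r sum_mem_fset// Am -sum_fset_psum// => h.
apply: (@le_trans _ _ (c%:E * (rnorm (\sum_(j <- A) z j))%:E)%E).
  by rewrite -EFinM lee_fin.
apply: lee_wpmul2l; first by rewrite lee_fin ltW.
by apply: ereal_sup_ubound; exists A => //; rewrite Am.
Qed.

Hypothesis z_cond_upper : forall a (P : pred nat) m,
  rnorm (psum z (trunc P a) m) <= c * (lev m).+1%:R * rnorm (psum z a m).
Hypothesis z_cond_lower : forall n, (0 < n)%N -> exists a (P : pred nat),
  0 < rnorm (psum z a (lo n)) /\
  n%:R * rnorm (psum z a (lo n)) <= c * rnorm (psum z (trunc P a) (lo n)).

Lemma coord_supported f m : basis_supp z f `<=` `I_m ->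
  f = psum z (basis_coord z f) m.
Proof.
move=> fm; apply: rcvg_unique (basis_coordP terms_schauder (f:=f)) _.
apply/rcvgP => e e0; exists m => n mn.
rewrite -[series _ n]/(psum z (basis_coord z f) n).
suff -> : psum z (basis_coord z f) n = psum z (basis_coord z f) m by rewrite subrr rnorm0.
rewrite /psum (@big_cat_nat _ _ _ m)//= [X in _ + X]big1_seq ?addr0// => j /=.
rewrite mem_index_iota => /andP[mj _].
have [->|aj] := eqVneq (basis_coord z f j) 0; first by rewrite scale0r.
by have := fm j aj; rewrite /= ltnNge mj.
Qed.

(** The level of m is log m up to constant factors: the first m indices meet
    lev m + 1 blocks at most and contain the first lev m of them. *)
Theorem Lconst_of_estimates : equivalent_on [set m | (2 <= m)%N]%classic
  (Lconst z) (fun m => (ln m%:R)%:E).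
Proof.
have ln2 : 0 < ln 2 :> R by rewrite ln_gt0// ltr1n.
have lnX (n : nat) : ln (2 ^ n)%:R = n%:R * ln 2 :> R.
  by rewrite natrX lnXn// mulr_natl.
split; [exists (3 * c / ln 2)|exists (2 * c * ln 2)] => m /= m2.
  have m0 : (0 : R) < m%:R by rewrite ltr0n (leq_trans _ m2).
  have lev_le : (lev m).+1%:R <= 3 * ln m%:R / ln 2 :> R.
    rewrite ler_pdivlMr//.
    have h1 : (lev m)%:R * ln 2 <= ln (2 * m%:R) :> R.
      rewrite -lnX ler_ln ?posrE ?ltr0n ?expn_gt0// ?mulr_gt0// -natrM ler_nat.
      have /andP[+ _] := @trunc_log_bounds 2 m.+1 isT isT; rewrite -/(lev m) => h.
      by apply: leq_trans h _; lia.
    have h2 : ln 2 <= ln m%:R :> R by rewrite ler_ln ?posrE// ler_nat.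
    move: h1; rewrite lnM ?posrE// -natr1 mulrDl mul1r; lra.
  apply: ge_ereal_sup => _ [f [A [f0 fm ->]]]; rewrite -EFinM lee_fin.
  rewrite ler_pdivrMr ?rnorm_gt0//.
  have aj j : (m <= j)%N -> basis_coord z f j = 0.
    move=> mj; apply/eqP; apply: contrapT => /negP aj.
    by have := fm j aj; rewrite /= ltnNge mj.
  rewrite (basis_projE (N := m)); last by move=> j _; exact: aj.
  apply: le_trans (z_cond_upper _ _ _) _; rewrite -(coord_supported fm).
  rewrite ler_wpM2r ?rnorm_ge0//; apply: le_trans (ler_wpM2l (ltW c0) lev_le) _.
  by rewrite (_ : c * _ = 3 * c / ln 2 * ln m%:R)//; ring.
pose n := lev m; have /andP[nm mn] := lev_bounds m.
have n0 : (0 < n)%N by apply: lev_ge; rewrite /lo/=; lia.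
have [a [P [pos h]]] := z_cond_lower n0.
pose b := trunc (fun j => (j < lo n)%N) a; pose f := psum z a (lo n).
have fb : basis_coord z f = b := basis_coordE terms_schauder (expansion_psum (x:=z) (a:=a)
  (N:=lo n)).
have Lge : ((rnorm (psum z (trunc P a) (lo n)) / rnorm f)%:E <= Lconst z m)%E.
  apply: ereal_sup_ubound; exists f, [set j | P j]%classic; split.
  - by rewrite -rnorm_gt0.
  - move=> j; rewrite /basis_supp /= fb /b /trunc; case: ifP => [jn _|_]; last by rewrite eqxx.
    exact: leq_trans jn nm.
  - congr ((rnorm _ / _)%:E).
    rewrite (basis_projE (N := lo n)) => [|j _ jn]; last first.
      by rewrite fb /b /trunc ltnNge jn.
    apply: eq_psum => j jn; rewrite fb /trunc /b /trunc jn.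
    by rewrite (_ : (j \in [set j | P j]) = P j)//; apply/idP/idP; rewrite inE.
apply: (@le_trans _ _ ((2 * c * ln 2)%:E *
  (rnorm (psum z (trunc P a) (lo n)) / rnorm f)%:E)%E); last first.
  apply: lee_wpmul2l => //; rewrite lee_fin mulr_ge0 ?(ltW ln2)//.
  by rewrite mulr_ge0 ?(ltW c0).
rewrite -EFinM lee_fin mulrA ler_pdivlMr//.
have h1 : ln m%:R <= 2 * n%:R * ln 2 :> R.
  apply: (@le_trans _ _ (ln (2 ^ n.+1)%:R)).
    rewrite ler_ln ?posrE ?ltr0n ?expn_gt0 ?(leq_trans _ m2)// ler_nat.
    by apply: ltnW; apply: (leq_trans mn); rewrite /lo leq_pred.
  rewrite lnX ler_wpM2r ?(ltW ln2)// -natrM ler_nat; lia.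
apply: le_trans (ler_wpM2r (ltW pos) h1) _.
have := ler_wpM2l (_ : 0 <= 2 * ln 2) h.
rewrite (_ : 2 * n%:R * ln 2 * _ = 2 * ln 2 * (n%:R * rnorm f)); last by rewrite /f; ring.
rewrite (_ : 2 * c * ln 2 * _ = 2 * ln 2 * (c * rnorm (psum z (trunc P a) (lo n)))); last by ring.
by apply; rewrite mulr_ge0 ?ltW.
Qed.

End Conclusions.

(** * Closed spans and interleaved sequences *)

Section ClosedSpan.
Context {R : realType} {s : scalar_kind}.
Local Notation K := (scalar_field R s).
Variable X : normedModType K.
Implicit Types x y : nat -> X.

Definition closed_span x : set X :=
  [set f | forall e : R, 0 < e -> exists a N, rnorm (f - psum x a N) < e].

Lemma closed_span_closed x f :
  (forall e : R, 0 < e -> exists2 g, closed_span x g & rnorm (f - g) < e) ->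
  closed_span x f.
Proof.
move=> h e e0; have e2 : 0 < e / 2 by rewrite divr_gt0.
have [g xg fg] := h _ e2; have [a [N hN]] := xg _ e2.
by exists a, N; rewrite (le_lt_trans (rnorm_dist g _ _))// (splitr e) ltrD.
Qed.

Lemma closed_span_psum x a N : closed_span x (psum x a N).
Proof. by move=> e e0; exists a, N; rewrite subrr rnorm0. Qed.

Lemma closed_span_gen x n : closed_span x (x n).
Proof.
rewrite -[x n](_ : psum x (fun j => (j == n)%:R) n.+1 = _).
  exact: closed_span_psum.
rewrite /psum big_nat_recr//= eqxx scale1r big_nat_cond big1 ?add0r// => j.
by move=> /andP[/andP[_ /ltn_eqF ->] _]; rewrite scale0r.
Qed.

Lemma closed_span_lin x c f g : closed_span x f -> closed_span x g ->
  closed_span x (c *: f + g).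
Proof.
move=> xf xg e e0; have c1 : 0 < rnorm c + 1 by rewrite ltr_wpDl ?rnorm_ge0.
have [|a [N hN]] := xf (e / (rnorm c + 1) / 2); first by rewrite !divr_gt0.
have [|b [M hM]] := xg (e / (rnorm c + 1) / 2); first by rewrite !divr_gt0.
pose tr N a := trunc (fun j => (j < N)%N) a : nat -> K.
have trE N' a' k : (N' <= k)%N -> psum x (tr N' a') k = psum x a' N'.
  by move=> h; rewrite psum_trunc (minn_idPr h).
exists (fun j => c * tr N a j + tr M b j), (maxn N M).
rewrite psumD psumZ !trE ?leq_maxl ?leq_maxr// opprD addrACA -scalerBr.
rewrite (le_lt_trans (rnormD _ _))// rnormZ.
have h1 := ler_wpM2l (rnorm_ge0 c) (ltW hN).
have h2 : rnorm c * (e / (rnorm c + 1) / 2) + e / (rnorm c + 1) / 2 = e / 2.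
  by field; rewrite gt_eqF.
by move: (ler_ltD h1 hM); rewrite h2 => /lt_trans; apply; lra.
Qed.

Lemma closed_span0 x : closed_span x 0.
Proof. by rewrite -[0](_ : psum x (fun=> 0) 0 = _);
  [exact: closed_span_psum|rewrite /psum big_geq]. Qed.

Lemma closed_spanD x f g : closed_span x f -> closed_span x g -> closed_span x (f + g).
Proof. by rewrite -[f in f + g]scale1r; exact: closed_span_lin. Qed.

Lemma closed_spanZ x c f : closed_span x f -> closed_span x (c *: f).
Proof. by move=> h; rewrite -[_ *: _]addr0; apply: closed_span_lin h (closed_span0 x). Qed.

Lemma closed_spanB x f g : closed_span x f -> closed_span x g -> closed_span x (f - g).
Proof. by move=> h h'; rewrite -scaleN1r addrC; exact: closed_span_lin. Qed.

Lemma closed_span_sum x I (r : seq I) (P : pred I) (F : I -> X) :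
  (forall i, P i -> closed_span x (F i)) -> closed_span x (\sum_(i <- r | P i) F i).
Proof.
move=> h; elim/big_rec: _ => [|i f Pi]; first exact: closed_span0.
by apply: closed_spanD; exact: h.
Qed.

Lemma closed_span_sub x y f : (forall n, closed_span x (y n)) ->
  closed_span y f -> closed_span x f.
Proof.
move=> xy yf; apply: closed_span_closed => e /yf[a [N hN]].
exists (psum y a N) => //; apply: closed_span_sum => j _; exact: closed_spanZ.
Qed.

Definition interleave x y n : X := if odd n then y n./2 else x n./2.

Lemma interleave_even x y n : interleave x y n.*2 = x n.
Proof. by rewrite /interleave odd_double doubleK. Qed.

Lemma interleave_odd x y n : interleave x y n.*2.+1 = y n.
Proof. by rewrite /interleave /= odd_double uphalf_double. Qed.

Lemma psum_interleave x y b k : psum (interleave x y) b k =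
  psum x (fun i => b i.*2) (uphalf k) + psum y (fun i => b i.*2.+1) k./2.
Proof.
have even i : psum (interleave x y) b i.*2 =
    psum x (fun i => b i.*2) i + psum y (fun i => b i.*2.+1) i.
  elim: i => [|i IH]; first by rewrite /psum !big_geq ?addr0.
  rewrite doubleS !psumS IH interleave_even interleave_odd -!addrA; congr (_ + _).
  by rewrite addrCA.
rewrite -(odd_double_half k); case: (odd k); move: (k./2) => i /=.
  by rewrite add1n doubleK uphalf_double !psumS even interleave_even addrAC.
by rewrite add0n uphalf_double doubleK even.
Qed.

(** The separation hypothesis bounds each of the two parts of a combination by
    the whole, after which the basis constants of the parts apply. *)
Lemma interleave_basic x y C : 0 < C -> basic_seq x C -> basic_seq y C ->
  (forall a b M N, rnorm (psum x a M) <= C * rnorm (psum x a M + psum y b N)) ->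
  basic_seq (interleave x y) (2 * C * C + C).
Proof.
move=> C0 xb yb xy b k N kN; rewrite !psum_interleave.
set a' := (fun i => b i.*2); set b' := (fun i => b i.*2.+1).
have h1 := xb a' (uphalf k) (uphalf N) _; have {}h1 := h1 (uphalf_leq kN).
have h2 := yb b' k./2 N./2 (half_leq kN).
have h3 := xy a' b' (uphalf N) N./2.
have h4 := rnormB (psum x a' (uphalf N) + psum y b' N./2) (psum x a' (uphalf N)).
rewrite addrAC subrr add0r in h4.
apply: le_trans (rnormD _ _) _.
move: h1 h2 h3 h4; move: (rnorm _) (rnorm _) (rnorm _) (rnorm _) (rnorm _).
move=> n1 n2 n3 n4 n5 h1 h2 h3 h4.
have h5 := ler_wpM2l (ltW C0) h3; have h6 := ler_wpM2l (ltW C0) h4.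
by nra.
Qed.

(** Projecting vectors on the first N terms can multiply norms by N / c. *)
Definition linearly_conditional x (c : R) := forall N, (0 < N)%N ->
  exists a (P : pred nat), 0 < rnorm (psum x a N) /\
    N%:R * rnorm (psum x a N) <= c * rnorm (psum x (trunc P a) N).

(** At least half of the first N terms belong to x. *)
Lemma interleave_conditional x y c : 0 <= c -> linearly_conditional x c ->
  linearly_conditional (interleave x y) (2 * c).
Proof.
move=> c0 h N N0; have M0 : (0 < uphalf N)%N by case: N N0 => [|[|N]].
have [a [P [pos le]]] := h _ M0.
have NM : N%:R <= 2 * (uphalf N)%:R :> R.
  by rewrite -natrM ler_nat mul2n -{1}[N]odd_double_half uphalf_half doubleD; case: (odd N).
have E (a' : nat -> K) : psum (interleave x y) (fun n => if odd n then 0 else a' n./2) N =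
    psum x a' (uphalf N).
  rewrite psum_interleave [X in _ + X]big1 ?addr0 => [|j _].
    by apply: eq_psum => j _; rewrite odd_double doubleK.
  by rewrite /= odd_double scale0r.
exists (fun n => if odd n then 0 else a n./2), (fun n => P n./2).
have -> : trunc (fun n => P n./2) (fun n => if odd n then 0 else a n./2) =
    (fun n => if odd n then 0 else trunc P a n./2).
  by apply/funext => n; rewrite /trunc; case: (odd n); case: ifP.
rewrite !E; split => //; apply: le_trans (ler_wpM2r (ltW pos) NM) _.
by rewrite -!mulrA ler_wpM2l.
Qed.

End ClosedSpan.

(** * Conditional bases of sums of l_1 and l_oo blocks *)

Section BlockBases.
Context {R : realType} {s : scalar_kind}.
Local Notation K := (scalar_field R s).
Variables (X : completeNormedModType K) (e : nat -> X) (C : R).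
Hypothesis C1 : 1 <= C.
Let C0 : 0 < C. Proof. exact: lt_le_trans ltr01 C1. Qed.

(** Unconditionality, as an inequality on finite sums. *)
Definition lattice_seq (x : nat -> X) (c : R) := forall u v N,
  (forall j, rnorm (u j : K) <= rnorm (v j : K)) ->
  rnorm (psum x u N) <= c * rnorm (psum x v N).

Hypothesis e_lattice : lattice_seq e C.

Definition block_sum (x : nat -> X) (u : nat -> K) n :=
  \sum_(lo n <= j < lo n.+1) u j *: x j.

Lemma psum_block_sum (x : nat -> X) (u : nat -> K) N :
  psum x u (lo N) = \sum_(0 <= n < N) block_sum x u n.
Proof. exact: psum_blocks0. Qed.

Lemma block_sum_psum (x : nat -> X) (u : nat -> K) n N : (n < N)%N ->
  block_sum x u n = psum x (trunc (fun j => lo n <= j < lo n.+1)%N u) (lo N).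
Proof.
move=> nN; rewrite psum_block_sum (bigD1_seq n) ?iota_uniq ?mem_index_iota//=.
rewrite [X in _ = _ + X]big1 ?addr0 => [|m mn].
  by apply: eq_big_nat => j h; rewrite /trunc h.
rewrite /block_sum big_nat_cond big1// => j /andP[/andP[h1 h2] _].
rewrite /trunc; case: ifP => [/andP[h3 h4]|_]; last by rewrite scale0r.
by move: mn; rewrite -(lev_eq h1 h2) (lev_eq h3 h4) eqxx.
Qed.

Lemma block_sum_le u N n : (n < N)%N ->
  rnorm (block_sum e u n) <= C * rnorm (psum e u (lo N)).
Proof.
move=> nN; rewrite (block_sum_psum _ _ nN); apply: e_lattice => j.
by rewrite /trunc; case: ifP; rewrite ?rnorm0 ?rnorm_ge0.
Qed.

(** Within blocks the partial sums are bounded by assumption; across blocks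
    they are lattice projections. *)
Lemma block_basic (d : nat -> X) (D : R) (delta : (nat -> K) -> nat -> K) : 0 <= D ->
  (forall b n, block_sum d b n = block_sum e (delta b) n) ->
  (forall b n k, (lo n <= k <= lo n.+1)%N ->
    rnorm (\sum_(lo n <= j < k) b j *: d j) <= D * rnorm (block_sum d b n)) ->
  basic_seq d (C + D * C).
Proof.
move=> D0 dE dpart a k M kM.
pose N := M.+1; have MN : (M <= lo N)%N by rewrite (leq_trans (leq_lo M))// lo_homo.
pose b := trunc (fun j => (j < M)%N) a.
have -> : psum d a M = psum d b (lo N) by rewrite psum_trunc_lo.
have -> : psum d a k = psum d b k by rewrite psum_trunc (minn_idPl kM).
have /andP[h1 /ltnW h2] := lev_bounds k; set n := lev k in h1 h2.
have nN : (n < N)%N by rewrite ltnS (leq_trans (leq_lev k)).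
have dlo m : psum d b (lo m) = psum e (delta b) (lo m).
  by rewrite !psum_block_sum; apply: eq_bigr => i _; rewrite dE.
rewrite [psum d b k]/psum (@big_cat_nat _ _ _ (lo n))//=.
apply: le_trans (rnormD _ _) _; rewrite mulrDl lerD//.
  rewrite -/(psum d b (lo n)) !dlo.
  rewrite -(@psum_trunc_lo _ _ _ e (delta b) (lo n) N) ?lo_homo ?(ltnW nN)//.
  apply: e_lattice => j; rewrite /trunc.
  by case: ifP; rewrite ?rnorm0 ?rnorm_ge0.
apply: le_trans (dpart _ _ _ _) _; first by rewrite h1.
rewrite -mulrA ler_wpM2l// dE dlo.
exact: block_sum_le.
Qed.

Lemma lev_pred j : (lo (lev j) < j)%N -> lev j.-1 = lev j.
Proof. by case: j => // j h; apply: lev_eq => //=; have /andP[_ /ltnW] := lev_bounds j.+1. Qed.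

Definition conditional_block_basis (d : nat -> X) (D : R) :=
  [/\ basic_seq d D, forall j, D^-1 <= rnorm (d j) <= D,
      linearly_conditional d D, forall l, closed_span d (e l)
    & forall j, exists u, d j = block_sum e u (lev j)].

Lemma block_sum_unit (x : nat -> X) j : x j = block_sum x (fun i => (i == j)%:R) (lev j).
Proof.
rewrite /block_sum (bigD1_seq j) ?iota_uniq ?mem_index_iota ?lev_bounds//= eqxx scale1r.
by rewrite big1 ?addr0// => i /negbTE ->; rewrite scale0r.
Qed.

Lemma psum_one_block (x : nat -> X) (u : nat -> K) n N : (lo n.+1 <= N)%N ->
  psum x (trunc (fun j => lo n <= j < lo n.+1)%N u) N = block_sum x u n.
Proof.
move=> nN; rewrite (block_sum_psum _ _ (ltnSn n)).
transitivity (psum x (trunc (fun j => lo n <= j < lo n.+1)%N u) (minn N (lo n.+1))).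
  rewrite -psum_trunc; apply: eq_psum => j _.
  by rewrite /trunc; case: ifP => [/andP[_ ->]//|_]; case: ifP.
by rewrite (minn_idPr nN).
Qed.

(** It suffices to find conditional vectors in each block: the last complete
    block below N has more than N / 4 members. *)
Lemma block_conditional (x : nat -> X) (c : R) (b : nat -> K) (P : pred nat) :
  (forall n, 0 < rnorm (block_sum x b n)) ->
  (forall n, 4 * 2 ^+ n * rnorm (block_sum x b n) <= c * rnorm (block_sum x (trunc P b) n)) ->
  linearly_conditional x c.
Proof.
move=> pos le N N0; have levN : (0 < lev N)%N by apply: lev_ge; rewrite /lo.
have /andP[] := lev_bounds N; set n := (lev N).-1; rewrite -(prednK levN) -/n => nN Nn.
exists (trunc (fun j => lo n <= j < lo n.+1)%N b), P.
have -> : trunc P (trunc (fun j => lo n <= j < lo n.+1)%N b) =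
    trunc (fun j => lo n <= j < lo n.+1)%N (trunc P b).
  by apply/funext => j; rewrite /trunc; case: ifP; case: ifP.
rewrite !psum_one_block//; split; first exact: pos.
apply: le_trans (le n); rewrite ler_wpM2r ?rnorm_ge0//.
rewrite -natrX -natrM ler_nat (leq_trans (ltnW Nn))// /lo !expnS.
by apply: leq_trans (leq_pred _) _; rewrite mulnA.
Qed.

(** Every block thus ends at an even index, and the terms of even index are the
    ones to project on. *)
Lemma lo_odd n : odd (lo n.+1).
Proof. by rewrite /lo; have := expn_gt0 2 n; rewrite expnS; lia. Qed.

Let lo_gt0 n : (0 < lo n.+1)%N. Proof. by move: (lo_odd n); case: lo. Qed.

Let lastb n : (lo n <= (lo n.+1).-1 < lo n.+1)%N.
Proof. by rewrite prednK// leqnn andbT -ltnS prednK// lo_lt_S. Qed.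

Section L1.
Hypothesis e_upper : forall j, rnorm (e j) <= C.
Hypothesis e_l1 : forall u n, \sum_(lo n <= j < lo n.+1) rnorm (u j) <=
  C * rnorm (block_sum e u n).

Definition diff_basis j : X := e j - (if (lo (lev j) < j)%N then e j.-1 else 0).
Local Notation d := diff_basis.

Lemma sum_diff_basis (b : nat -> K) n k : (lo n <= k <= lo n.+1)%N ->
  \sum_(lo n <= j < k) b j *: d j =
  \sum_(lo n <= j < k) (b j - (if (j.+1 < k)%N then b j.+1 else 0)) *: e j.
Proof.
move=> /andP[nk]; rewrite -(subnKC nk); elim: (k - lo n)%N => [|i IH] h.
  by rewrite addn0 !big_geq.
rewrite addnS in h *; rewrite !big_nat_recr ?leq_addr//= IH ?(ltnW h)// {IH}.
rewrite ltnn subr0 /diff_basis (lev_eq (leq_addr _ _) h).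
case: i h => [|i] h; first by rewrite addn0 ltnn subr0 !big_geq.
rewrite addnS !big_nat_recr ?leq_addr//= ltnn ltnSn !subr0 scalerBr scalerBl.
rewrite -!addrA; congr (_ + (_ + _)); last by rewrite addrC.
by apply: eq_big_nat => j /andP[_ jk]; rewrite !ltnS jk (ltnW jk).
Qed.

(** Telescoping: a coefficient is the sum of the differences from it on, so that
    cutting the sequence there costs no more than those differences. *)
Lemma tail_diff (b : nat -> K) k M : (k < M)%N ->
  b k = \sum_(k <= j < M) (b j - (if (j.+1 < M)%N then b j.+1 else 0)).
Proof.
move=> kM; pose f j := if (j < M)%N then b j else 0.
rewrite (eq_big_nat _ _ (F2 := fun j => - (f j.+1 - f j))) => [|j /andP[_ jM]].
  by rewrite sumrN telescope_sumr ?(ltnW kM)// /f ltnn kM sub0r opprK.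
by rewrite opprB /f jM.
Qed.

Lemma sum_diff_basis_le (b : nat -> K) n k : (lo n <= k <= lo n.+1)%N ->
  \sum_(lo n <= j < k) rnorm (b j - (if (j.+1 < k)%N then b j.+1 else 0)) <=
  \sum_(lo n <= j < lo n.+1) rnorm (b j - (if (j.+1 < lo n.+1)%N then b j.+1 else 0)).
Proof.
move=> /andP[]; case: k => [|k] nk kM.
  by rewrite big_geq// sumr_ge0// => j _; exact: rnorm_ge0.
move: nk; rewrite leq_eqVlt => /predU1P[<-|nk].
  by rewrite big_geq// sumr_ge0// => j _; exact: rnorm_ge0.
rewrite big_nat_recr//= ltnn subr0 (@big_cat_nat _ _ _ k (lo n) (lo n.+1))//= ?(ltnW kM)//.
apply: lerD.
  apply: ler_sum_nat => j /andP[_ jk].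
  by rewrite ltnS jk (leq_trans _ kM).
by rewrite [in leLHS](tail_diff b kM); exact: rnorm_sum.
Qed.

Definition diff_coef (b : nat -> K) j : K :=
  b j - (if (j.+1 < lo (lev j).+1)%N then b j.+1 else 0).

Lemma block_sum_diff b n : block_sum d b n = block_sum e (diff_coef b) n.
Proof.
rewrite /block_sum sum_diff_basis ?leqnn ?lo_homo//.
by apply: eq_big_nat => j /andP[h1 h2]; rewrite /diff_coef (lev_eq h1 h2).
Qed.

Lemma sum_l1_le (u : nat -> K) m k :
  rnorm (\sum_(m <= j < k) u j *: e j) <= C * \sum_(m <= j < k) rnorm (u j).
Proof.
apply: le_trans (rnorm_sum _ _ _) _; rewrite mulr_sumr; apply: ler_sum => j _.
by rewrite rnormZ mulrC ler_wpM2r ?rnorm_ge0.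
Qed.

Lemma diff_coef_le b n : \sum_(lo n <= j < lo n.+1)
    rnorm (b j - (if (j.+1 < lo n.+1)%N then b j.+1 else 0)) <=
  C * rnorm (block_sum d b n).
Proof.
rewrite block_sum_diff; apply: le_trans (e_l1 _ _); apply: ler_sum_nat => j /andP[h1 h2].
by rewrite /diff_coef (lev_eq h1 h2).
Qed.

Lemma sum_diff_one n l : (lo n <= l < lo n.+1)%N ->
  \sum_(lo n <= j < l.+1) 1 *: d j = e l.
Proof.
move=> /andP[h1 h2]; rewrite (sum_diff_basis (fun=> 1)) ?h2 ?(leqW h1)//.
rewrite big_nat_recr//= ltnn subr0 scale1r.
rewrite big_nat_cond big1 ?add0r// => j /andP[/andP[_ jl] _].
by rewrite ltnS jl subrr scale0r.
Qed.

Lemma diff_coef_term_le b n i : (lo n <= i < lo n.+1)%N ->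
  rnorm (b i - (if (i.+1 < lo n.+1)%N then b i.+1 else 0)) <= C * rnorm (block_sum d b n).
Proof.
move=> ib; apply: le_trans (diff_coef_le _ _).
rewrite (bigD1_seq i) ?iota_uniq ?mem_index_iota//= lerDl sumr_ge0// => j _.
exact: rnorm_ge0.
Qed.

(** The difference basis: all of its terms in a block add up to a single vector
    e l, while the terms of even index alone have coefficients of modulus one on
    the whole block, and thus a norm comparable with its size. *)
Theorem l1_block_basis : conditional_block_basis d (8 * C ^+ 3).
Proof.
have C3 : C <= C ^+ 3 by rewrite -{1}[C]expr1 ler_weXn2l.
have C2 : C * C <= C ^+ 3 by rewrite -expr2 ler_weXn2l.
have C3_gt0 : 0 < C ^+ 3 by rewrite exprn_gt0.
split.
- have h : basic_seq d (C + (C * C) * C).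
    apply: (block_basic (delta := diff_coef));
      [exact: mulr_ge0 (ltW C0) (ltW C0)|exact: block_sum_diff|].
    move=> b n k nk; rewrite sum_diff_basis//; apply: le_trans (sum_l1_le _ _ _) _.
    rewrite -mulrA ler_wpM2l ?(ltW C0)//; apply: le_trans (sum_diff_basis_le _ nk) _.
    exact: diff_coef_le.
  move=> a k N kN; apply: le_trans (h a k N kN) _; rewrite ler_wpM2r ?rnorm_ge0//.
  by move: C3 C3_gt0; rewrite !exprS expr0; lra.
- move=> j; apply/andP; split.
    apply: (@le_trans _ _ C^-1); first by rewrite lef_pV2 ?posrE ?mulr_gt0//; lra.
    rewrite -[C^-1]mulr1 ler_pdivrMl// [d j]block_sum_unit.
    apply: le_trans (diff_coef_term_le _ (lev_bounds j)).
    by rewrite eqxx gtn_eqF// if_same subr0 rnorm1.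
  apply: (@le_trans _ _ (C + C)); last by lra.
  apply: le_trans (rnormB _ _) _; apply: lerD => //.
  by case: ifP => // _; rewrite rnorm0 ltW.
- apply: (block_conditional (b := fun=> 1) (P := fun j => ~~ odd j)) => n.
    rewrite rnorm_gt0; apply/eqP => h; have := diff_coef_term_le (fun=> 1) (lastb n).
    by rewrite h prednK// ltnn subr0 rnorm1 rnorm0 mulr0 ler10.
  have h1 : rnorm (block_sum d (fun=> 1) n) <= C.
    by have := sum_diff_one (lastb n); rewrite prednK// /block_sum => ->.
  have h2 : 2 ^+ n <= C * rnorm (block_sum d (trunc (fun j => ~~ odd j) (fun=> 1)) n).
    apply: le_trans (diff_coef_le _ _).
    rewrite -natrX -size_block -[leLHS]mulr1n -sumr_const_nat.
    apply: ler_sum_nat => j /andP[_ jM]; rewrite /trunc /=.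
    case oj: (odd j) => /=; last by rewrite if_same subr0 rnorm1.
    rewrite (_ : (j.+1 < lo n.+1)%N); first by rewrite sub0r rnormN rnorm1.
    rewrite ltn_neqAle jM andbT; apply/eqP => jE.
    by have := lo_odd n; rewrite -jE /= oj.
  have := ler_wpM2l (exprn_ge0 n (ler0n R 2)) h1.
  have := ler_wpM2r (ltW C0) h2; move: C2.
  move: (rnorm _) (rnorm (block_sum d (trunc _ _) n)) (rnorm_ge0 (block_sum d (trunc (fun j =>
    ~~ odd j) (fun=> 1)) n)).
  move=> a b b0 c2; have := ler_wpM2r b0 c2; have := mulr_ge0 (ltW C3_gt0) b0.
  by move: (C ^+ 3) (2 ^+ n) => c3 p h3 h4 h5 h6; nra.
- move=> l; rewrite -(sum_diff_one (lev_bounds l)).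
  by apply: closed_span_sum => j _; apply: closed_spanZ; exact: closed_span_gen.
- move=> j; exists (diff_coef (fun i => (i == j)%:R)).
  by rewrite -block_sum_diff -block_sum_unit.
Qed.

End L1.

Section Linf.
Hypothesis e_upper : forall u n (t : R), 0 <= t -> (forall j, rnorm (u j) <= t) ->
  rnorm (block_sum e u n) <= C * t.
Hypothesis e_lower : forall u n j, (lo n <= j < lo n.+1)%N ->
  rnorm (u j) <= C * rnorm (block_sum e u n).

Definition summing_basis j : X := \sum_(lo (lev j) <= l < j.+1) e l.
Local Notation d := summing_basis.

Lemma sum_summing_basis (b : nat -> K) n k : (lo n <= k <= lo n.+1)%N ->
  \sum_(lo n <= j < k) b j *: d j =
  \sum_(lo n <= l < k) (\sum_(l <= j < k) b j) *: e l.
Proof.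
move=> /andP[nk]; rewrite -(subnKC nk); elim: (k - lo n)%N => [|i IH] h.
  by rewrite addn0 !big_geq.
rewrite addnS in h *; rewrite [LHS]big_nat_recr ?leq_addr//= IH ?(ltnW h)// {IH}.
rewrite {1}/summing_basis (lev_eq (leq_addr _ _) h).
rewrite [RHS](eq_big_nat _ _ (F2 := fun l => (\sum_(l <= j < lo n + i) b j) *: e l +
    b (lo n + i)%N *: e l)); last first.
  by move=> l /andP[_ li]; rewrite big_nat_recr//= scalerDl.
rewrite big_split /= -scaler_sumr; congr (_ + _).
by rewrite [RHS]big_nat_recr ?leq_addr//= [X in _ = _ + X *: _]big_geq// scale0r addr0.
Qed.

Definition sum_coef (b : nat -> K) l : K := \sum_(l <= j < lo (lev l).+1) b j.

Lemma block_sum_summing b n : block_sum d b n = block_sum e (sum_coef b) n.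
Proof.
rewrite /block_sum sum_summing_basis ?leqnn ?lo_homo//.
by apply: eq_big_nat => j /andP[h1 h2]; rewrite /sum_coef (lev_eq h1 h2).
Qed.

Lemma sum_coef_le b n l : (lo n <= l <= lo n.+1)%N ->
  rnorm (\sum_(l <= j < lo n.+1) b j) <= C * rnorm (block_sum d b n).
Proof.
move=> /andP[nl]; rewrite leq_eqVlt => /predU1P[->|ln].
  by rewrite big_geq// rnorm0 mulr_ge0 ?rnorm_ge0 ?(ltW C0).
rewrite block_sum_summing; have := @e_lower (sum_coef b) n l.
by rewrite /sum_coef nl ln (lev_eq nl ln); exact.
Qed.

Lemma summing_partial b n k : (lo n <= k <= lo n.+1)%N ->
  rnorm (\sum_(lo n <= j < k) b j *: d j) <= 2 * (C * C) * rnorm (block_sum d b n).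
Proof.
move=> nk; rewrite sum_summing_basis//; have /andP[h1 h2] := nk.
set B := rnorm (block_sum d b n).
pose v l : K := if (lo n <= l < k)%N then \sum_(l <= j < k) b j else 0.
have -> : \sum_(lo n <= l < k) (\sum_(l <= j < k) b j) *: e l = block_sum e v n.
  rewrite /block_sum (@big_cat_nat _ _ _ k (lo n) (lo n.+1))//=.
  rewrite [X in _ = _ + X]big_nat_cond [X in _ = _ + X]big1 ?addr0; last first.
    by move=> l /andP[/andP[kl _] _]; rewrite /v [(l < k)%N]ltnNge kl andbF scale0r.
  by apply: eq_big_nat => l lk; rewrite /v lk.
have B0 : 0 <= B by exact: rnorm_ge0.
have -> : 2 * (C * C) * B = C * (2 * (C * B)) by ring.
apply: e_upper; first by rewrite !mulr_ge0 ?(ltW C0).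
move=> l; rewrite /v; case: ifP => [/andP[nl lk]|_]; last first.
  by rewrite rnorm0 !mulr_ge0 ?(ltW C0).
have -> : \sum_(l <= j < k) b j = \sum_(l <= j < lo n.+1) b j - \sum_(k <= j < lo n.+1) b j.
  by rewrite (@big_cat_nat _ _ _ k l (lo n.+1))//= ?(ltnW lk)// addrK.
apply: le_trans (rnormB _ _) _; rewrite mulr_natl mulr2n lerD ?sum_coef_le//.
by rewrite nl (leq_trans (ltnW lk)).
Qed.

Lemma alternating_tail n l : (lo n <= l <= lo n.+1)%N ->
  \sum_(l <= j < lo n.+1) (-1) ^+ j = (if odd l then 0 else 1 : K).
Proof.
move=> /andP[nl lM]; have [i iM lE] : exists2 i, (i <= lo n.+1)%N & l = (lo n.+1 - i)%N.
  by exists (lo n.+1 - l)%N; rewrite ?leq_subr ?subKn.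
move: nl; rewrite {}lE {lM l}; elim: i iM => [|i IH] iM nl.
  by rewrite subn0 big_geq// lo_odd.
have iM' : (lo n.+1 - i.+1 < lo n.+1)%N by rewrite ltn_subrL lo_gt0.
have E : (lo n.+1 - i.+1).+1 = (lo n.+1 - i)%N by rewrite subnSK.
rewrite big_ltn// E IH ?(ltnW iM)//; last by rewrite -E (leq_trans nl).
rewrite -E /=; case o: (odd _) => /=.
  by rewrite -signr_odd o expr1 addNr.
by rewrite -signr_odd o expr0 addr0.
Qed.

(** The summing basis: the alternating sum over a block has coefficients 0 and 1
    with respect to e, while the first coefficient of its terms of even index
    counts them. *)
Theorem linf_block_basis : conditional_block_basis d (8 * C ^+ 3).
Proof.
have C3 : C <= C ^+ 3 by rewrite -{1}[C]expr1 ler_weXn2l.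
have C2 : C * C <= C ^+ 3 by rewrite -expr2 ler_weXn2l.
have C3_gt0 : 0 < C ^+ 3 by rewrite exprn_gt0.
have C2_gt0 : 0 < C * C by exact: mulr_gt0.
split.
- have h : basic_seq d (C + (2 * (C * C)) * C).
    apply: (block_basic (delta := sum_coef));
      [by rewrite mulr_ge0 ?(ltW C2_gt0)|exact: block_sum_summing|].
    exact: summing_partial.
  move=> a k N kN; apply: le_trans (h a k N kN) _; rewrite ler_wpM2r ?rnorm_ge0//.
  by move: C3 C3_gt0; rewrite !exprS expr0; lra.
- move=> j; have /andP[j1 j2] := lev_bounds j; apply/andP; split.
    apply: (@le_trans _ _ C^-1); first by rewrite lef_pV2 ?posrE ?mulr_gt0//; lra.
    rewrite -[C^-1]mulr1 ler_pdivrMl// [d j]block_sum_unit.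
    have jb : (lo (lev j) <= j <= lo (lev j).+1)%N by rewrite j1 ltnW.
    apply: le_trans (sum_coef_le _ jb).
    rewrite (bigD1_seq j) ?iota_uniq ?mem_index_iota ?leqnn ?j2//= eqxx big1 ?addr0 ?rnorm1//.
    by move=> i /negbTE ->.
  rewrite [d j](_ : _ = block_sum e (fun l => (l <= j)%N%:R) (lev j)).
    apply: le_trans (e_upper (t := 1) _ _ _) _ => //.
      by move=> i; case: (i <= j)%N; rewrite ?rnorm1 ?rnorm0.
    by rewrite mulr1; lra.
  rewrite /block_sum (@big_cat_nat _ _ _ j.+1)//= ?(leqW j1)//.
  rewrite [X in _ = _ + X]big_nat_cond [X in _ = _ + X]big1 ?addr0.
    by apply: eq_big_nat => i /andP[_]; rewrite ltnS => ->; rewrite scale1r.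
  by move=> i /andP[/andP[ji _] _]; rewrite leqNgt ji scale0r.
- apply: (block_conditional (b := fun j => (-1) ^+ j) (P := fun j => ~~ odd j)) => n.
    rewrite rnorm_gt0; apply/eqP => h.
    have := @sum_coef_le (fun j => (-1) ^+ j) n (lo n.+1).-1.
    have /andP[n1 n2] := lastb n.
    rewrite h rnorm0 mulr0 alternating_tail ?n1 ?(ltnW n2)// => /(_ isT).
    rewrite (_ : odd _ = false); first by rewrite rnorm1 ler10.
    by have := lo_odd n; case: (lo n.+1) (lo_gt0 n) => //= m _ /negbTE.
  have h1 : rnorm (block_sum d (fun j => (-1) ^+ j) n) <= C.
    rewrite block_sum_summing [block_sum _ _ _](_ : _ =
        block_sum e (fun l => if odd l then 0 else 1) n).
      rewrite -[leRHS]mulr1; apply: e_upper => // j.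
      by case: (odd j); rewrite ?rnorm1 ?rnorm0.
    apply: eq_big_nat => l /andP[l1 l2]; rewrite /sum_coef (lev_eq l1 l2).
    by rewrite alternating_tail// l1 ltnW.
  have h2 : 2 ^+ n <= 2 * (C * rnorm (block_sum d (trunc (fun j => ~~ odd j) (fun j => (-1) ^+
    j)) n)).
    have nn : (lo n <= lo n <= lo n.+1)%N by rewrite leqnn lo_homo.
    have := sum_coef_le (trunc (fun j => ~~ odd j) (fun j => (-1) ^+ j)) nn.
    move=> /(ler_wpM2l (ler0n R 2)); apply: le_trans.
    have T : 2 * \sum_(lo n <= j < lo n.+1) trunc (fun j => ~~ odd j) (fun j => (-1) ^+ j) j =
        real_scalar (2 ^+ n + (if odd (lo n) then 0 else 1)) :> K.
      rewrite real_scalarD.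
      have -> : real_scalar (2 ^+ n) = \sum_(lo n <= j < lo n.+1) 1 :> K.
        by rewrite sumr_const_nat size_block -natrX real_scalar_natr.
      have -> : real_scalar (if odd (lo n) then 0 else 1) =
          \sum_(lo n <= j < lo n.+1) (-1) ^+ j :> K.
        rewrite alternating_tail ?leqnn ?lo_homo//.
        by case: (odd _); rewrite ?real_scalar0 ?real_scalar1.
      rewrite -big_split mulr_sumr; apply: eq_bigr => j _ /=.
      rewrite /trunc -signr_odd; case: (odd j) => /=; first by rewrite expr1 subrr mulr0.
      by rewrite expr0 mulr1.
    have /= := congr1 (fun k : K => rnorm k) T.
    rewrite rnormM -(real_scalar_natr 2) !rnorm_real => {}T.
    move: T; rewrite ger0_norm// => ->; rewrite ger0_norm.
      by rewrite lerDl; case: (odd _).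
    by rewrite addr_ge0 ?exprn_ge0//; case: (odd _).
  have := ler_wpM2l (exprn_ge0 n (ler0n R 2)) h1.
  have := ler_wpM2r (ltW C0) h2; move: C2.
  move: (rnorm _) (rnorm (block_sum d (trunc _ _) n)) (rnorm_ge0 (block_sum d (trunc (fun j =>
    ~~ odd j) (fun j => (-1) ^+ j)) n)).
  move=> a b b0 c2; have := ler_wpM2r b0 c2; have := mulr_ge0 (ltW C3_gt0) b0.
  by move: (C ^+ 3) (2 ^+ n) => c3 p h3 h4 h5 h6; nra.
- move=> l; have /andP[l1 l2] := lev_bounds l.
  suff -> : e l = d l - (if (lo (lev l) < l)%N then d l.-1 else 0).
    apply: closed_spanB; first exact: closed_span_gen.
    by case: ifP => _; [exact: closed_span_gen|exact: closed_span0].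
  rewrite {1}/summing_basis big_nat_recr//=; case: ifP => [h|/negbT].
    by rewrite /summing_basis lev_pred// prednK ?(leq_ltn_trans _ h)// addrC addrK.
  by rewrite -leqNgt => h; rewrite big_geq// subr0 add0r.
- move=> j; exists (sum_coef (fun i => (i == j)%:R)).
  by rewrite -block_sum_summing -block_sum_unit.
Qed.

End Linf.
End BlockBases.

(** * Mixed-norm sequence spaces *)

Section BpqFacts.
Context {R : realType} {s : scalar_kind}.
Local Notation K := (scalar_field R s).
Variables (p : \bar R) (q : R).
Hypothesis hp : p = +oo%E \/ p = 1%:E.
Hypothesis q1 : 1 < q.
Let q0 : 0 < q. Proof. exact: lt_trans ltr01 q1. Qed.

Lemma lp_norm1E n (v : 'I_n -> K) : lp_norm 1%:E v = \sum_(i < n) rnorm (v i).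
Proof.
rewrite /= invr1 powRr1 => [|]; last by apply: sumr_ge0 => i _; exact: powR_ge0.
by apply: eq_bigr => i _; rewrite powRr1 ?rnorm_ge0.
Qed.

Lemma lp_norm_coord n (v : 'I_n -> K) i : rnorm (v i) <= lp_norm p v.
Proof.
case: hp => ->; first by rewrite /=; exact: le_bigmax.
rewrite lp_norm1E (bigD1 i)//= lerDl sumr_ge0// => j _; exact: rnorm_ge0.
Qed.

Lemma lp_norm_ge0 n (v : 'I_n -> K) : 0 <= lp_norm p v.
Proof.
case: hp => ->; last by rewrite lp_norm1E sumr_ge0// => j _; exact: rnorm_ge0.
by rewrite /=; exact: bigmax_ge_id.
Qed.

Lemma lp_norm_le n (v w : 'I_n -> K) : (forall i, rnorm (v i) <= rnorm (w i)) ->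
  lp_norm p v <= lp_norm p w.
Proof.
move=> h; case: hp => ->; last by rewrite !lp_norm1E; apply: ler_sum.
by rewrite /=; apply: le_bigmax2.
Qed.

Lemma lp_normD n (v w : 'I_n -> K) :
  lp_norm p (fun i => v i + w i) <= lp_norm p v + lp_norm p w.
Proof.
have := @lp_norm_coord n v; have := @lp_norm_coord n w.
have := @lp_norm_ge0 n v; have := @lp_norm_ge0 n w.
case: hp => -> v0 w0 hw hv.
  apply: bigmax_le; first exact: addr_ge0.
  by move=> i _; apply: le_trans (rnormD _ _) _; exact: lerD.
by rewrite !lp_norm1E -big_split; apply: ler_sum => i _; exact: rnormD.
Qed.

Lemma lp_normZ n a (v : 'I_n -> K) :
  lp_norm p (fun i => a * v i) <= rnorm a * lp_norm p v.
Proof.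
have := @lp_norm_coord n v; have := @lp_norm_ge0 n v; case: hp => -> v0 hv.
  apply: bigmax_le; first by rewrite mulr_ge0 ?rnorm_ge0.
  by move=> i _; rewrite rnormM ler_wpM2l ?rnorm_ge0 ?hv.
by rewrite !lp_norm1E mulr_sumr; apply: ler_sum => i _; rewrite rnormM.
Qed.

Lemma lp_norm0 n (v : 'I_n -> K) : (forall i, v i = 0) -> lp_norm p v = 0.
Proof.
move=> h; apply/eqP; rewrite eq_le lp_norm_ge0 andbT; case: hp => ->.
  by apply: bigmax_le => // i _; rewrite h rnorm0.
by rewrite lp_norm1E big1// => i _; rewrite h rnorm0.
Qed.

Implicit Types f g : bidx -> K.

Definition power_sum f N : R := \sum_(0 <= n < N) lp_norm p (@block R s f n) `^ q.

Lemma power_sum_ge0 f N : 0 <= power_sum f N.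
Proof. by apply: sumr_ge0 => n _; exact: powR_ge0. Qed.

Lemma power_sum_homo f : {homo power_sum f : m n / (m <= n)%N >-> m <= n}.
Proof.
move=> m n mn; rewrite /power_sum (@big_cat_nat _ _ _ m 0 n)//= lerDl.
by apply: sumr_ge0 => i _; exact: powR_ge0.
Qed.

Lemma qsum_partial f N : ((power_sum f N)%:E <= Bpq_qsum p q f)%E.
Proof.
rewrite /power_sum -sumEFin; apply: nneseries_lim_ge => n _ _.
by rewrite lee_fin powR_ge0.
Qed.

Lemma qsum_bounded f (M : R) : (forall N, power_sum f N <= M) ->
  (Bpq_qsum p q f <= M%:E)%E.
Proof.
move=> h; apply: lime_le.
  by apply: is_cvg_nneseries => n _ _; rewrite lee_fin powR_ge0.
by apply: nearW => N; rewrite sumEFin lee_fin; exact: h.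
Qed.

Lemma Bpq_fin f : Bpq p q f -> exists2 M : R, 0 <= M & Bpq_qsum p q f = M%:E.
Proof.
rewrite /Bpq /= => h; have h0 := qsum_partial f 0.
move: h h0; case: (Bpq_qsum p q f) => [M||]//= _ h0.
by exists M => //; apply: le_trans (power_sum_ge0 f 0) _.
Qed.

Lemma power_sum_norm f N : Bpq p q f -> power_sum f N <= Bpq_norm p q f `^ q.
Proof.
move=> /Bpq_fin[M M0 E]; have := qsum_partial f N.
by rewrite /Bpq_norm E /= lee_fin (root_powRK q1).
Qed.

Lemma Bpq_norm_ge0 f : 0 <= Bpq_norm p q f. Proof. exact: powR_ge0. Qed.

Lemma Bpq_bounded f (t : R) : 0 <= t -> (forall N, power_sum f N <= t `^ q) ->
  Bpq p q f /\ Bpq_norm p q f <= t.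
Proof.
move=> t0 /qsum_bounded h; have fB : Bpq p q f by rewrite /Bpq /= (le_lt_trans h)// ltry.
split=> //; have [M M0 E] := Bpq_fin fB.
by move: h; rewrite /Bpq_norm E /= lee_fin => h; exact: root_le.
Qed.

Lemma Bpq_le f g : (forall b, rnorm (f b) <= rnorm (g b)) -> Bpq p q g ->
  Bpq p q f /\ Bpq_norm p q f <= Bpq_norm p q g.
Proof.
move=> fg gB; apply: Bpq_bounded; first exact: Bpq_norm_ge0.
move=> N; apply: le_trans (power_sum_norm N gB); apply: ler_sum => n _.
apply: ler_pow => //; first exact: lp_norm_ge0.
by apply: lp_norm_le => i; exact: fg.
Qed.

Lemma Bpq_lin a f g : Bpq p q f -> Bpq p q g -> Bpq p q (fun b => a * f b + g b).
Proof.
move=> fB gB; have hf N := power_sum_norm N fB; have hg N := power_sum_norm N gB.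
have nf := Bpq_norm_ge0 f; have ng := Bpq_norm_ge0 g.
move: hf hg nf ng; move: (Bpq_norm p q f) (Bpq_norm p q g) => F B hf hg F0 B0.
have na := rnorm_ge0 a; pose A := rnorm a * F; have A0 : 0 <= A by exact: mulr_ge0.
have AB0 : 0 <= A + B by exact: addr_ge0.
have t0 : 0 <= 2 * (2 * (A + B)) by apply: mulr_ge0 => //; exact: mulr_ge0.
suff /(Bpq_bounded t0)[] : forall N, power_sum (fun b => a * f b + g b) N <=
    (2 * (2 * (A + B))) `^ q by [].
move=> N; apply: (@le_trans _ _ (2 `^ q * (A `^ q + B `^ q))).
  have : rnorm a `^ q * power_sum f N + power_sum g N <= A `^ q + B `^ q.
    by apply: lerD => //; rewrite /A powRM// ler_wpM2l ?powR_ge0.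
  move=> /(ler_wpM2l (powR_ge0 2 q)); apply: le_trans.
  rewrite /power_sum mulr_sumr -big_split mulr_sumr; apply: ler_sum => n _ /=.
  have lf := lp_norm_ge0 (@block R s f n); have lg := lp_norm_ge0 (@block R s g n).
  rewrite -(powRM _ na lf).
  apply: le_trans (powR_add_le q1 (mulr_ge0 na lf) lg).
  apply: ler_pow => //; first exact: lp_norm_ge0.
  apply: le_trans (lp_normD _ _) _; rewrite lerD2r; exact: lp_normZ.
rewrite (powRM _ (ler0n _ 2) (mulr_ge0 (ler0n _ 2) AB0)) ler_wpM2l ?powR_ge0//.
rewrite (powRM _ (ler0n _ 2) AB0).
have h2 : 2 <= 2 `^ q :> R by rewrite le1r_powR ?(ltW q1)// ler1n.
apply: le_trans (ler_wpM2r (powR_ge0 _ _) h2); rewrite mulr_natl mulr2n.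
by apply: lerD; apply: ler_pow => //; rewrite ?lerDl ?lerDr.
Qed.

Lemma Bpq_coord f b : Bpq p q f -> rnorm (f b) <= Bpq_norm p q f.
Proof.
case: b => n i fB.
apply: le_trans (@lp_norm_coord n.+1 (@block R s f n) i) _.
have := power_sum_norm n.+1 fB; rewrite /power_sum big_nat_recr//= => h.
have h' : lp_norm p (@block R s f n) `^ q <= Bpq_norm p q f `^ q.
  by apply: le_trans h; rewrite lerDr; exact: power_sum_ge0.
have -> : Bpq_norm p q f = (Bpq_norm p q f `^ q) `^ q^-1.
  by rewrite (powR_rootK q1 (Bpq_norm_ge0 f)).
by apply: (le_root q1) => //; exact: lp_norm_ge0.
Qed.

Lemma Bpq_one_block f n : (forall b, projT1 b != n -> f b = 0) ->
  Bpq p q f /\ Bpq_norm p q f = lp_norm p (@block R s f n).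
Proof.
move=> f0.
have blk0 m : m != n -> lp_norm p (@block R s f m) = 0.
  by move=> mn; apply: lp_norm0 => i; rewrite /block f0.
have [|N|fB le] := @Bpq_bounded f (lp_norm p (@block R s f n)).
- exact: lp_norm_ge0.
- rewrite /power_sum; have [nN|Nn] := ltnP n N.
    rewrite (bigD1_seq n) ?iota_uniq ?mem_index_iota//= big1 ?addr0// => m /blk0 ->.
    by rewrite powR0// gt_eqF.
  rewrite big_nat_cond big1 ?powR_ge0// => m /andP[/andP[_ mN] _].
  have mn : m != n by rewrite ltn_eqF// (leq_trans mN).
  by rewrite (blk0 _ mn) powR0// gt_eqF.
split=> //; apply/eqP; rewrite eq_le le /=.
have := power_sum_norm n.+1 fB; rewrite /power_sum big_nat_recr//= => h.
have -> : Bpq_norm p q f = (Bpq_norm p q f `^ q) `^ q^-1.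
  by rewrite (powR_rootK q1 (Bpq_norm_ge0 f)).
apply: (le_root q1); first exact: lp_norm_ge0.
by apply: le_trans h; rewrite lerDr; exact: power_sum_ge0.
Qed.

Lemma Bpq0 : Bpq p q (fun=> 0 : K).
Proof. by have [] := @Bpq_one_block (fun=> 0) 0 (fun _ _ => erefl). Qed.

Lemma Bpq_tail f (e : R) : Bpq p q f -> 0 < e -> exists N,
  Bpq_norm p q (fun b => if (N <= projT1 b)%N then f b else 0) <= e.
Proof.
move=> fB e0; have eq0 : 0 < e `^ q by rewrite powR_gt0.
have [M M0 E] := Bpq_fin fB.
have [N hN] : exists N, M - e `^ q < power_sum f N.
  apply: contrapT => h; have : (Bpq_qsum p q f <= (M - e `^ q)%:E)%E.
    by apply: qsum_bounded => N; rewrite leNgt; apply/negP => ?; apply: h; exists N.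
  by rewrite E lee_fin lerBrDr gerDl leNgt eq0.
exists N; set g := fun b => _.
have [|L|_ //] := @Bpq_bounded g e; first exact: ltW.
apply: le_trans (power_sum_homo g (leq_addr N L)) _.
rewrite addnC /power_sum (@big_cat_nat _ _ _ N)//= ?leq_addr//.
rewrite [X in X + _]big_nat_cond [X in X + _]big1 ?add0r => [|n /andP[/andP[_ nN] _]].
  have := qsum_partial f (N + L); rewrite E lee_fin.
  rewrite /power_sum (@big_cat_nat _ _ _ N)//= ?leq_addr// => h.
  have : \sum_(N <= n < N + L) lp_norm p (@block R s g n) `^ q =
      \sum_(N <= n < N + L) lp_norm p (@block R s f n) `^ q.
    apply: eq_big_nat => n /andP[Nn _]; congr (_ `^ _); congr lp_norm.
    by apply/funext => i; rewrite /block /g /= Nn.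
  by move=> ->; move: h hN; rewrite /power_sum; lra.
rewrite lp_norm0 ?powR0 ?gt_eqF// => i.
by rewrite /block /g /= leqNgt nN.
Qed.

End BpqFacts.

(** * Families supported on parts of the index set *)

Section IndexSets.
Context {R : realType} {s : scalar_kind}.
Local Notation K := (scalar_field R s).

Definition pos (b : bidx) : nat * nat := (projT1 b, nat_of_ord (projT2 b)).

Definition at_pos (c : nat * nat) : bidx := existT (fun n : nat => 'I_n.+1) c.1 (inord c.2).

Lemma posK b : at_pos (pos b) = b.
Proof. by case: b => n i; rewrite /at_pos /= inord_val. Qed.

Lemma at_posK c : (c.2 <= c.1)%N -> pos (at_pos c) = c.
Proof. by case: c => n i /= h; rewrite /pos /= inordK. Qed.

Lemma pos_valid b : ((pos b).2 <= (pos b).1)%N.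
Proof. by case: b => n i /=; rewrite -ltnS ltn_ord. Qed.

Definition unit_vector (c : nat * nat) (b : bidx) : K := (pos b == c)%:R.

Definition spread (iota : nat -> nat * nat) (u : nat -> K) N (b : bidx) : K :=
  \sum_(0 <= j < N) u j * unit_vector (iota j) b.

Definition restrict_to (A : pred (nat * nat)) (f : bidx -> K) (b : bidx) : K :=
  if A (pos b) then f b else 0.

Lemma spread_at iota (u : nat -> K) N j b : injective iota -> (j < N)%N -> pos b = iota j ->
  spread iota u N b = u j.
Proof.
move=> inj jN bj; rewrite /spread (bigD1_seq j) ?iota_uniq ?mem_index_iota//=.
rewrite /unit_vector bj eqxx mulr1 big1 ?addr0// => i ij.
by rewrite (inj_eq inj) eq_sym (negbTE ij) mulr0.
Qed.

Lemma spread_out iota (u : nat -> K) N b : (forall j, (j < N)%N -> pos b != iota j) ->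
  spread iota u N b = 0.
Proof.
move=> h; rewrite /spread big_nat_cond big1// => j /andP[/andP[_ jN] _].
by rewrite /unit_vector (negbTE (h _ jN)) mulr0.
Qed.

Lemma spread_case iota N b : injective iota ->
  (exists2 j, (j < N)%N & pos b = iota j) \/ forall u : nat -> K, spread iota u N b = 0.
Proof.
move=> inj; have [h|h] := pselect (exists2 j, (j < N)%N & pos b = iota j); first by left.
by right=> v; apply: spread_out => j jN; apply/eqP => bj; apply: h; exists j.
Qed.

Lemma spread_le iota (u v : nat -> K) N b : injective iota ->
  (forall j, rnorm (u j) <= rnorm (v j)) ->
  rnorm (spread iota u N b) <= rnorm (spread iota v N b).
Proof.
move=> inj uv; have [[j jN bj]|h] := @spread_case iota N b inj.
  by rewrite !(spread_at _ inj jN bj).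
by rewrite !h.
Qed.

(** Three families of positions: a row 2m+1 begins with a copy of row m, the
    rows of even index begin with a single position, and the rows 2^(k+1)
    continue with 2^k positions. *)
Definition copy_pos : pred (nat * nat) := fun c => odd c.1 && (c.2 <= c.1./2)%N.
Definition lq_pos (m : nat) : nat * nat := (m.*2, 0).
Definition dyadic_pos (l : nat) : nat * nat := ((2 ^ lev l).*2, (l - lo (lev l)).+1).

Lemma lq_pos_inj : injective lq_pos.
Proof. by move=> m n [/double_inj]. Qed.

Lemma dyadic_pos_inj : injective dyadic_pos.
Proof.
move=> l m [/double_inj/eqP]; rewrite eqn_exp2l// => /eqP lm.
have /andP[+ _] := lev_bounds l; have /andP[+ _] := lev_bounds m; rewrite lm; lia.
Qed.

Lemma dyadic_pos_bound l : ((dyadic_pos l).2 <= 2 ^ lev l)%N.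
Proof. by have := lev_bounds l; rewrite /= loS; lia. Qed.

Lemma dyadic_pos_valid l : ((dyadic_pos l).2 <= (dyadic_pos l).1)%N.
Proof. by have := dyadic_pos_bound l; rewrite /= -addnn; lia. Qed.

Definition lq_part : pred (nat * nat) := fun c => ~~ odd c.1 && (c.2 == 0)%N.
Definition dyadic_part : pred (nat * nat) := fun c => `[< exists l, dyadic_pos l = c >].
Definition rest_part : pred (nat * nat) := fun c =>
  [&& (c.2 <= c.1)%N, ~~ copy_pos c, ~~ lq_part c & ~~ dyadic_part c].

Lemma lq_part_pos m : lq_part (lq_pos m).
Proof. by rewrite /lq_part /= odd_double. Qed.

Lemma dyadic_part_pos l : dyadic_part (dyadic_pos l).
Proof. by apply/asboolP; exists l. Qed.

Lemma lq_copy c : lq_part c -> ~~ copy_pos c.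
Proof. by rewrite /copy_pos => /andP[/negbTE ->]. Qed.

Lemma dyadic_copy c : dyadic_part c -> ~~ copy_pos c.
Proof. by move=> /asboolP[l <-]; rewrite /copy_pos /= odd_double. Qed.

Lemma dyadic_lq c : dyadic_part c -> ~~ lq_part c.
Proof. by move=> /asboolP[l <-]; rewrite /lq_part /= andbF. Qed.

(** Infinitely many positions are left, among them the last ones of odd rows. *)
Lemma rest_enum : exists2 iota : nat -> nat * nat, injective iota &
  (forall j, rest_part (iota j)) /\ forall c, rest_part c -> exists j, iota j = c.
Proof.
have : ([set: nat] #= [set c | rest_part c])%card.
  rewrite card_eq_sym; apply: eq_card_nat => //.
  apply/infiniteP/pcard_leP/injfunPex.
  exists (fun m => (m.*2.+1, m.*2.+1)) => [m _ /=|m n _ _ [/double_inj]//].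
  rewrite /rest_part /copy_pos /lq_part /= odd_double leqnn /= uphalf_double.
  rewrite -ltnNge ltnS -addnn leq_addr /=.
  apply/negP => /asboolP[l [/(congr1 odd)]]; by rewrite /= addnn !odd_double.
move=> /card_set_bijP[f [fA finj fsurj]]; exists f.
  by move=> m n; apply: finj; rewrite inE.
split=> [j|c /fsurj[j _ <-]]; first exact: fA.
by exists j.
Qed.

Section Norms.
Variables (p : \bar R) (q : R).
Hypothesis hp : p = +oo%E \/ p = 1%:E.
Hypothesis q1 : 1 < q.
Let q0 : 0 < q. Proof. exact: lt_trans ltr01 q1. Qed.

Lemma lp_norm_widen (V : nat -> K) n k : (n <= k)%N -> (forall i, (n <= i)%N -> V i = 0) ->
  lp_norm p (fun i : 'I_k => V i) = lp_norm p (fun i : 'I_n => V i).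
Proof.
move=> nk V0; case: hp => ->.
  apply/eqP; rewrite eq_le /=; apply/andP; split; apply: bigmax_le.
  - exact: bigmax_ge_id.
  - move=> i _; have [iN|/V0 ->] := ltnP i n; last by rewrite rnorm0 bigmax_ge_id.
    exact: (le_bigmax _ (fun i : 'I_n => rnorm (V i)) (Ordinal iN)).
  - exact: bigmax_ge_id.
  - move=> i _; exact: (le_bigmax _ (fun i : 'I_k => rnorm (V i)) (widen_ord nk i)).
rewrite !lp_norm1E (big_ord_widen k (fun i => rnorm (V i)) nk) [RHS]big_mkcond /=.
by apply: eq_bigr => i _; case: ltnP => // /V0 ->; rewrite rnorm0.
Qed.

Lemma block_at_pos (f : bidx -> K) n (i : 'I_n.+1) : block f i = f (at_pos (n, nat_of_ord i)).
Proof. by rewrite /block /at_pos /= inord_val. Qed.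

(** Row m is moved to the beginning of row 2m+1; of_copy reads it off there. *)
Definition to_copy (f : bidx -> K) (b : bidx) : K :=
  if copy_pos (pos b) then f (at_pos ((pos b).1./2, (pos b).2)) else 0.

Definition of_copy (f : bidx -> K) (b : bidx) : K :=
  f (at_pos ((pos b).1.*2.+1, (pos b).2)).

Lemma of_copyK f : of_copy (to_copy f) = f.
Proof.
apply/funext => b; have h := pos_valid b.
have h2 : ((pos b).2 <= (pos b).1.*2.+1)%N.
  by rewrite (leq_trans h)// leqW// -addnn leq_addr.
rewrite /of_copy /to_copy (at_posK (c := (_, _)) h2) /copy_pos.
rewrite [_.1]/= [_.2]/= [odd _]/= odd_double [_./2]/= uphalf_double h.
exact: (congr1 f (posK b)).
Qed.

Lemma to_copyK f : to_copy (of_copy f) = restrict_to copy_pos f.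
Proof.
apply/funext => b; rewrite /to_copy /of_copy /restrict_to; case: ifP => // /andP[c_odd h].
have e : (pos b).1./2.*2.+1 = (pos b).1 by rewrite -[RHS]odd_double_half c_odd.
rewrite (at_posK (c := (_, _)) h) (_ : at_pos _ = b)//.
have h3 := posK b; rewrite {1}(surjective_pairing (pos b)) -e in h3; exact: h3.
Qed.

Lemma block_to_copy f m : lp_norm p (@block R s (to_copy f) m.*2.+1) =
  lp_norm p (@block R s f m).
Proof.
pose V i := if (i <= m)%N then f (at_pos (m, i)) else 0.
have -> : @block R s (to_copy f) m.*2.+1 = fun i => V i.
  apply/funext => i; rewrite /block /to_copy /copy_pos /pos /= odd_double /= uphalf_double.
  by [].
have -> : @block R s f m = fun i => V i.
  apply/funext => i; rewrite block_at_pos /V -ltnS ltn_ord//.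
apply: lp_norm_widen; first by rewrite ltnS leqW// -addnn leq_addr.
by move=> i mi; rewrite /V leqNgt mi.
Qed.

Lemma power_sum_double f N : power_sum p q f N.*2 =
  \sum_(0 <= m < N) (lp_norm p (@block R s f m.*2) `^ q + lp_norm p (@block R s f m.*2.+1) `^ q).
Proof.
elim: N => [|N IH]; first by rewrite /power_sum !big_geq.
by rewrite doubleS /power_sum !big_nat_recr//= -addrA -IH.
Qed.

Lemma Bpq_to_copy f : Bpq p q f ->
  Bpq p q (to_copy f) /\ Bpq_norm p q (to_copy f) <= Bpq_norm p q f.
Proof.
move=> fB; apply: (Bpq_bounded q1); first exact: Bpq_norm_ge0.
move=> N; have NN : (N <= N.*2)%N by rewrite -addnn leq_addr.
apply: le_trans (power_sum_homo _ _ _ NN) _; rewrite power_sum_double.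
apply: le_trans (power_sum_norm q1 N fB); apply: ler_sum => m _.
rewrite block_to_copy [X in X `^ _ + _](lp_norm0 hp) ?powR0 ?gt_eqF ?add0r// => i.
by rewrite /block /to_copy /copy_pos /= odd_double.
Qed.

Lemma Bpq_restrict A f : Bpq p q f ->
  Bpq p q (restrict_to A f) /\ Bpq_norm p q (restrict_to A f) <= Bpq_norm p q f.
Proof.
apply: Bpq_le => // b; rewrite /restrict_to; case: ifP => // _.
by rewrite rnorm0 rnorm_ge0.
Qed.

Lemma Bpq_of_copy f : Bpq p q f ->
  Bpq p q (of_copy f) /\ Bpq_norm p q (of_copy f) <= Bpq_norm p q f.
Proof.
move=> fB; have [fB' le] := Bpq_restrict copy_pos fB.
suff [h1 h2] : Bpq p q (of_copy f) /\ Bpq_norm p q (of_copy f) <= Bpq_norm p q (restrict_to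
  copy_pos f).
  by split; [exact: h1|exact: le_trans h2 le].
apply: (Bpq_bounded q1); first exact: Bpq_norm_ge0.
move=> N; apply: le_trans (power_sum_norm q1 N.*2 fB').
rewrite power_sum_double -to_copyK; apply: ler_sum => m _.
by rewrite block_to_copy lerDr powR_ge0.
Qed.

Lemma Bpq_unit c : (c.2 <= c.1)%N ->
  Bpq p q (unit_vector c) /\ Bpq_norm p q (unit_vector c) = 1.
Proof.
case: c => n i /= ni; have [|fB ->] := @Bpq_one_block R s p q hp q1 (unit_vector (n, i)) n.
  move=> [m j] /= mn; rewrite /unit_vector /pos /=.
  by rewrite xpair_eqE (negbTE mn).
split=> //; apply/eqP; rewrite eq_le; apply/andP; split; last first.
  have := @lp_norm_coord R s p hp n.+1 (@block R s (unit_vector (n, i)) n) (inord i).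
  by rewrite /block /unit_vector /pos /= inordK// eqxx rnorm1.
case: hp => ->.
  apply: bigmax_le => // j _; rewrite /block /unit_vector.
  by case: (_ == _); rewrite ?rnorm1 ?rnorm0.
rewrite lp_norm1E (bigD1 (inord i))//= big1 ?addr0 => [|j ji].
  by rewrite /block /unit_vector /pos /= inordK// eqxx rnorm1.
rewrite /block /unit_vector /pos /= xpair_eqE eqxx /=.
rewrite (_ : (nat_of_ord j == i)%N = false) ?rnorm0//; apply/negbTE/eqP => e.
by case/eqP: ji; apply/val_inj; rewrite /= inordK.
Qed.

Lemma Bpq_spread iota u N : (forall j, ((iota j).2 <= (iota j).1)%N) ->
  Bpq p q (spread iota u N).
Proof.
move=> v; elim: N => [|N IH].
  suff -> : spread iota u 0 = fun=> 0 by exact: Bpq0.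
  by apply/funext => b; rewrite /spread big_geq.
suff -> : spread iota u N.+1 = fun b => u N * unit_vector (iota N) b + spread iota u N b.
  have [uB _] := Bpq_unit (v N); exact: (Bpq_lin hp q1 (u N) uB IH).
by apply/funext => b; rewrite /spread big_nat_recr//= addrC.
Qed.

(** Even rows contain one position of lq_pos each. *)
Lemma lq_spread_norm u N : Bpq_norm p q (spread lq_pos u N) = qsum q u 0 N `^ q^-1.
Proof.
have v j : ((lq_pos j).2 <= (lq_pos j).1)%N by [].
have fB := Bpq_spread u N v.
have blk m : lp_norm p (@block R s (spread lq_pos u N) m.*2) =
    rnorm (if (m < N)%N then u m else 0).
  apply/eqP; rewrite eq_le; apply/andP; split.
    pose V i := if (i == 0)%N then (if (m < N)%N then u m else 0) else 0.
    have -> : @block R s (spread lq_pos u N) m.*2 = fun i => V i.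
      apply/funext => i; rewrite /block /V; case: eqP => i0.
        case: ifP => mN.
          by apply: (spread_at _ lq_pos_inj mN); rewrite /pos /= i0.
        apply: spread_out => j jN; rewrite /pos /= i0; apply/eqP => -[/double_inj mj].
        by move: mN; rewrite mj jN.
      by apply: spread_out => j jN; rewrite /pos /lq_pos xpair_eqE; apply/nandP; right; apply/eqP.
    rewrite (@lp_norm_widen V 1) => //; last by case.
    case: hp => ->; last by rewrite lp_norm1E big_ord1.
    by rewrite /= big_ord_recl big_ord0 max_l ?rnorm_ge0.
  have := @lp_norm_coord R s p hp _ (@block R s (spread lq_pos u N) m.*2) ord0.
  case: ifP => [mN|_]; last by rewrite rnorm0 => _; exact: lp_norm_ge0.
  by rewrite /block (spread_at _ lq_pos_inj mN).
apply/eqP; rewrite eq_le; apply/andP; split.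
  have [|M|_ //] := @Bpq_bounded R s p q q1 (spread lq_pos u N) (qsum q u 0 N `^ q^-1).
    exact: powR_ge0.
  rewrite (root_powRK q1) ?qsum_ge0//.
  have MM : (M <= (M + N).*2)%N by rewrite -addnn -addnA leq_addr.
  apply: le_trans (power_sum_homo _ _ _ MM) _; rewrite power_sum_double.
  rewrite (@big_cat_nat _ _ _ N 0 (M + N))//= ?leq_addl//.
  rewrite -[leRHS]addr0 /qsum; apply: lerD.
    apply: ler_sum_nat => m /andP[_ mN]; rewrite blk mN (lp_norm0 hp) ?powR0 ?gt_eqF ?addr0// => i.
    by apply: spread_out => j _; rewrite /pos /lq_pos xpair_eqE; apply/nandP; left;
      apply/eqP => /(congr1 odd); rewrite /= !odd_double.
  rewrite big_nat_cond big1// => m /andP[/andP[Nm _] _].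
  rewrite blk ltnNge Nm /= rnorm0 (lp_norm0 hp) ?powR0 ?gt_eqF ?addr0// => i.
  by apply: spread_out => j _; rewrite /pos /lq_pos xpair_eqE; apply/nandP; left;
      apply/eqP => /(congr1 odd); rewrite /= !odd_double.
apply: (root_le q1); rewrite ?Bpq_norm_ge0 ?qsum_ge0//.
apply: le_trans (power_sum_norm q1 N.*2 fB); rewrite power_sum_double.
apply: ler_sum_nat => m /andP[_ mN]; rewrite blk mN lerDl powR_ge0//.
Qed.

End Norms.
End IndexSets.

(** * Splitting a space with a complemented mixed-norm subspace *)

Section Splitting.
Context {R : realType} {s : scalar_kind}.
Local Notation K := (scalar_field R s).
Variables (X : completeNormedModType K) (p : \bar R) (q : R).
Hypothesis hp : p = +oo%E \/ p = 1%:E.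
Hypothesis q1 : 1 < q.
Variables (T : (bidx -> K) -> X) (P : {linear X -> X}) (C : R).
Hypothesis C1 : 1 <= C.
Hypothesis T_lin : forall (a : K) f g, Bpq p q f -> Bpq p q g ->
  T (fun b => a * f b + g b) = a *: T f + T g.
Hypothesis T_upper : forall f, Bpq p q f -> rnorm (T f) <= C * Bpq_norm p q f.
Hypothesis T_lower : forall f, Bpq p q f -> Bpq_norm p q f <= C * rnorm (T f).
Hypothesis P_bounded : forall v, rnorm (P v) <= C * rnorm v.
Hypothesis P_idem : forall v, P (P v) = P v.
Hypothesis P_range : range P = T @` Bpq p q.

Let C0 : 0 < C. Proof. exact: lt_le_trans ltr01 C1. Qed.

Let unitB c (cv : (c.2 <= c.1)%N) : Bpq p q (unit_vector c : bidx -> K) /\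
  Bpq_norm p q (unit_vector c : bidx -> K) = 1 := Bpq_unit hp q1 cv.

Lemma T_sub f g : Bpq p q f -> Bpq p q g -> T (fun b => f b - g b) = T f - T g.
Proof.
move=> fB gB; rewrite -scaleN1r addrC -T_lin//; congr T; apply/funext => b.
by rewrite mulN1r addrC.
Qed.

Lemma Bpq_sub f g : Bpq p q f -> Bpq p q g -> Bpq p q (fun b => f b - g b : K).
Proof.
move=> fB gB; suff -> : (fun b => f b - g b) = fun b => (-1) * g b + f b.
  exact: (Bpq_lin hp q1 (-1) gB fB).
by apply/funext => b; rewrite mulN1r addrC.
Qed.

Lemma T_inj f g : Bpq p q f -> Bpq p q g -> T f = T g -> f = g.
Proof.
move=> fB gB e; apply/funext => b; apply/eqP; rewrite -subr_eq0 -rnorm_eq0.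
have dB := Bpq_sub fB gB; rewrite eq_le rnorm_ge0 andbT.
apply: le_trans (Bpq_coord hp q1 b dB) _; apply: le_trans (T_lower dB) _.
by rewrite T_sub// e subrr rnorm0 mulr0.
Qed.

Lemma T0 : T (fun=> 0) = 0.
Proof.
have := T_sub (Bpq0 hp q1) (Bpq0 hp q1); rewrite [X in _ = X]subrr => e.
by rewrite -[RHS]e; congr T; apply/funext => b; rewrite subrr.
Qed.

Lemma coordinates_exist f : exists u, Bpq p q u /\ T u = P f.
Proof.
have : range P (P f) by exists f.
by rewrite P_range => -[u uB e]; exists u.
Qed.

Definition coordinates (f : X) : bidx -> K := projT1 (cid (coordinates_exist f)).
Local Notation U := coordinates.

Lemma coordinates_Bpq f : Bpq p q (U f).
Proof. by rewrite /U; case: cid => u []. Qed.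

Lemma T_coordinates f : T (U f) = P f.
Proof. by rewrite /U; case: cid => u []. Qed.
Local Notation UB := coordinates_Bpq.

Lemma coordinates_unique f u : Bpq p q u -> T u = P f -> U f = u.
Proof. by move=> uB e; apply: (T_inj (UB f) uB); rewrite T_coordinates. Qed.

Lemma P_T u : Bpq p q u -> P (T u) = T u.
Proof.
move=> uB; have : (T @` Bpq p q) (T u) by exists u.
by rewrite -P_range => -[v _ <-].
Qed.

Lemma coordinates_T u : Bpq p q u -> U (T u) = u.
Proof. by move=> uB; apply: coordinates_unique => //; rewrite P_T. Qed.

Lemma coordinates_lin a f g : U (a *: f + g) = fun b => a * U f b + U g b.
Proof.
apply: coordinates_unique; first exact: (Bpq_lin hp q1 a (UB f) (UB g)).
by rewrite T_lin ?T_coordinates ?linearP//; exact: UB.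
Qed.

Lemma coordinates_le f : Bpq_norm p q (U f) <= C * (C * rnorm f).
Proof.
apply: le_trans (T_lower (UB f)) _; rewrite T_coordinates.
by rewrite ler_wpM2l ?(ltW C0).
Qed.

(** Contractions of the sequence space, to be transported to X by T. *)
Definition bounded_on_Bpq (L : (bidx -> K) -> bidx -> K) :=
  (forall f, Bpq p q f -> Bpq p q (L f) /\ Bpq_norm p q (L f) <= Bpq_norm p q f) /\
  forall a f g, L (fun b => a * f b + g b) = fun b => a * L f b + L g b.

Lemma restrict_bounded A : bounded_on_Bpq (restrict_to A).
Proof.
split=> [f fB|a f g]; first exact: (Bpq_restrict hp q1 A fB).
by apply/funext => b; rewrite /restrict_to; case: ifP; rewrite ?mulr0 ?addr0.
Qed.

Lemma to_copy_bounded : bounded_on_Bpq to_copy.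
Proof.
split=> [f fB|a f g]; first exact: (Bpq_to_copy hp q1 fB).
by apply/funext => b; rewrite /to_copy; case: ifP; rewrite ?mulr0 ?addr0.
Qed.

Lemma of_copy_bounded : bounded_on_Bpq of_copy.
Proof. by split=> [f fB|a f g //]; exact: (Bpq_of_copy hp q1 fB). Qed.

Definition induced (L : (bidx -> K) -> bidx -> K) (f : X) : X := T (L (U f)).

Lemma induced_lin L a f g : bounded_on_Bpq L ->
  induced L (a *: f + g) = a *: induced L f + induced L g.
Proof.
move=> [LB Ll]; rewrite /induced coordinates_lin Ll T_lin//.
- by have [] := LB _ (UB f).
- by have [] := LB _ (UB g).
Qed.

Lemma induced_le L f : bounded_on_Bpq L -> rnorm (induced L f) <= C ^+ 3 * rnorm f.
Proof.
move=> [LB _]; have [B le] := LB _ (UB f); rewrite /induced.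
apply: le_trans (T_upper B) _; rewrite exprS -mulrA ler_wpM2l ?(ltW C0)//.
by apply: le_trans le _; rewrite expr2 -mulrA; exact: coordinates_le.
Qed.

Definition off_rest (f : X) : X := f - P f.

Lemma off_rest_lin a f g : off_rest (a *: f + g) = a *: off_rest f + off_rest g.
Proof. by rewrite /off_rest linearP scalerBr opprD addrACA. Qed.

Lemma off_rest_le f : rnorm (off_rest f) <= (1 + C) * rnorm f.
Proof. by apply: le_trans (rnormB _ _) _; rewrite mulrDl mul1r lerD2l. Qed.

Lemma coordinates_off f : U (off_rest f) = fun=> 0.
Proof.
apply: coordinates_unique; first exact: (Bpq0 hp q1).
by rewrite /off_rest linearB /= P_idem subrr T0.
Qed.

(** Moving the part of f in the subspace into the copy of that subspace, and
    keeping the rest, is an isomorphic embedding of X into itself. Its image is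
    complemented by the sequences supported outside the copy. *)
Definition copy_shift (f : X) : X := induced to_copy f + off_rest f.
Definition copy_unshift (f : X) : X := induced of_copy f + off_rest f.

Lemma shift_lin a f g : copy_shift (a *: f + g) = a *: copy_shift f + copy_shift g.
Proof.
rewrite /copy_shift induced_lin ?off_rest_lin; last exact: to_copy_bounded.
by rewrite [in RHS]scalerDr [LHS]addrACA.
Qed.

Let shift_bound (L : (bidx -> K) -> bidx -> K) f : bounded_on_Bpq L ->
  rnorm (induced L f + off_rest f) <= 3 * C ^+ 3 * rnorm f.
Proof.
move=> LB; apply: le_trans (rnormD _ _) _.
have h1 := induced_le f LB; have h2 := off_rest_le f.
have h3 : 1 + C <= 2 * C ^+ 3.
  have : C <= C ^+ 3 by rewrite -{1}[C]expr1 ler_weXn2l.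
  by move: C1; lra.
have := ler_wpM2r (rnorm_ge0 f) h3; move: h1 h2; rewrite mulrDl mul1r; lra.
Qed.

Lemma shift_le f : rnorm (copy_shift f) <= 3 * C ^+ 3 * rnorm f.
Proof. exact: shift_bound to_copy_bounded. Qed.

Lemma unshift_le f : rnorm (copy_unshift f) <= 3 * C ^+ 3 * rnorm f.
Proof. exact: shift_bound of_copy_bounded. Qed.

Lemma coordinates_induced L f : bounded_on_Bpq L -> U (induced L f) = L (U f).
Proof. by move=> [LB _]; apply: coordinates_T; have [] := LB _ (UB f). Qed.

Lemma coordinatesD f g : U (f + g) = fun b => U f b + U g b.
Proof.
rewrite -[f]scale1r coordinates_lin scale1r; apply/funext => b.
by rewrite mul1r.
Qed.

Lemma coordinates_shift f : U (copy_shift f) = to_copy (U f).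
Proof.
rewrite coordinatesD coordinates_off coordinates_induced; last exact: to_copy_bounded.
by apply/funext => b; rewrite addr0.
Qed.

Lemma coordinates_unshift f : U (copy_unshift f) = of_copy (U f).
Proof.
rewrite coordinatesD coordinates_off coordinates_induced; last exact: of_copy_bounded.
by apply/funext => b; rewrite addr0.
Qed.

Lemma off_rest_induced L f g : bounded_on_Bpq L ->
  off_rest (induced L f + off_rest g) = off_rest g.
Proof.
move=> [LB _]; have [B _] := LB _ (UB f).
have P0 : P (off_rest g) = 0 by rewrite /off_rest linearB /= P_idem subrr.
by rewrite {1}/off_rest linearD P0 addr0 (P_T B) addrAC subrr add0r.
Qed.

Lemma shiftK f : copy_unshift (copy_shift f) = f.
Proof.
rewrite /copy_unshift /induced coordinates_shift of_copyK T_coordinates.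
rewrite /copy_shift off_rest_induced; last exact: to_copy_bounded.
by rewrite /off_rest addrC subrK.
Qed.

Lemma unshiftK f : copy_shift (copy_unshift f) = induced (restrict_to copy_pos) f + off_rest f.
Proof.
rewrite /copy_shift {1}/induced coordinates_unshift to_copyK; congr (_ + _).
by rewrite /copy_unshift off_rest_induced; last exact: of_copy_bounded.
Qed.

Lemma shift_decomposition f :
  f = copy_shift (copy_unshift f) + induced (restrict_to (predC copy_pos)) f.
Proof.
rewrite unshiftK addrAC -[LHS](subrK (P f)) addrC; congr (_ + _).
rewrite -T_coordinates /induced -[T (restrict_to copy_pos _)]scale1r -T_lin; last 2 first.
- by have [] := Bpq_restrict hp q1 copy_pos (UB f).
- by have [] := Bpq_restrict hp q1 (predC copy_pos) (UB f).
congr T; apply/funext => b; rewrite /restrict_to /= mul1r.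
by case: (copy_pos _) => /=; rewrite ?addr0 ?add0r.
Qed.

Definition part_proj (A : pred (nat * nat)) : X -> X := induced (restrict_to A).

Lemma proj_lin A a f g : part_proj A (a *: f + g) = a *: part_proj A f + part_proj A g.
Proof. by apply: induced_lin; exact: restrict_bounded. Qed.

Lemma proj_le A f : rnorm (part_proj A f) <= C ^+ 3 * rnorm f.
Proof. by apply: induced_le; exact: restrict_bounded. Qed.

Lemma proj_shift (A : pred (nat * nat)) f : (forall c, A c -> ~~ copy_pos c) ->
  part_proj A (copy_shift f) = 0.
Proof.
move=> Ac; rewrite /part_proj /induced coordinates_shift -T0; congr T; apply/funext => b.
by rewrite /restrict_to /to_copy; case: ifP => // /Ac /negbTE ->.
Qed.

Lemma lattice_basic (x : nat -> X) (c : R) : lattice_seq x c -> basic_seq x c.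
Proof.
move=> h a k N kN; rewrite -(minn_idPr kN) -psum_trunc; apply: h => j.
by rewrite /trunc; case: ifP => // _; rewrite rnorm0 rnorm_ge0.
Qed.

Definition ev (c : nat * nat) : X := T (unit_vector c).

Section Families.
Variables (iota : nat -> nat * nat).
Hypothesis iota_valid : forall j, ((iota j).2 <= (iota j).1)%N.

Lemma psum_ev u N : psum (fun j => ev (iota j)) u N = T (spread iota u N).
Proof.
elim: N => [|N IH].
  rewrite /psum big_geq// -T0; congr T; apply/funext => b.
  by rewrite /spread big_geq.
rewrite psumS IH addrC -T_lin; last 2 first.
- by have [] := unitB (iota_valid N).
- exact: (Bpq_spread hp q1 u N iota_valid).
by congr T; apply/funext => b; rewrite /spread big_nat_recr//= addrC.
Qed.

Lemma ev_norm j : C^-1 <= rnorm (ev (iota j)) <= C.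
Proof.
have [uB u1] := unitB (iota_valid j); apply/andP; split.
  by rewrite -[C^-1]mulr1 ler_pdivrMl// -u1; exact: T_lower.
by rewrite -[leRHS]mulr1 -u1; exact: T_upper.
Qed.

Hypothesis iota_inj : injective iota.

Lemma ev_lattice : lattice_seq (fun j => ev (iota j)) (C * C).
Proof.
move=> u v N uv; rewrite !psum_ev -mulrA.
have uB := Bpq_spread hp q1 u N iota_valid; have vB := Bpq_spread hp q1 v N iota_valid.
apply: le_trans (T_upper uB) _; rewrite ler_wpM2l ?(ltW C0)//.
apply: le_trans (T_lower vB).
by have [] := @Bpq_le R s p q hp q1 _ _ (fun b => spread_le N b iota_inj uv) vB.
Qed.

End Families.

Lemma proj_ev (A : pred (nat * nat)) c : (c.2 <= c.1)%N -> part_proj A (ev c) =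
  if A c then ev c else 0.
Proof.
move=> cv; have [uB _] := unitB cv.
rewrite /part_proj /induced /ev coordinates_T//; case: ifP => Ac.
  congr T; apply/funext => b; rewrite /restrict_to /unit_vector.
  by have [->|_] := eqVneq (pos b) c; [rewrite Ac|rewrite if_same].
rewrite -T0; congr T; apply/funext => b; rewrite /restrict_to /unit_vector.
by have [->|_] := eqVneq (pos b) c; [rewrite Ac|rewrite if_same].
Qed.

(** Truncations to finitely many blocks reduce to the images of unit vectors. *)
Lemma proj_closed_span (x : nat -> X) (A : pred (nat * nat)) f :
  (forall c, (c.2 <= c.1)%N -> A c -> closed_span x (ev c)) -> closed_span x (part_proj A f).
Proof.
move=> h; have [gB _] := Bpq_restrict hp q1 A (UB f); set g := restrict_to A (U f) in gB.
rewrite /part_proj /induced -/g; apply: closed_span_closed => e e0.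
have eC : 0 < e / (2 * C) by rewrite divr_gt0// mulr_gt0.
have [N hN] := Bpq_tail hp q1 gB eC.
pose l := [seq (n, i) | n <- iota 0 N, i <- iota 0 n.+1] : seq (nat * nat).
have l_uniq : uniq l.
  apply: allpairs_uniq_dep; rewrite ?iota_uniq//.
  - by move=> n _; exact: iota_uniq.
  - by move=> [n i] [m j] _ _ /= [-> ->].
have mem_lc c : (c \in l) = (c.1 < N)%N && (c.2 <= c.1)%N.
  case: c => n i; apply/allpairsPdep/andP => [[n' [i' [+ + [-> ->]]]]|[nN iN]].
    by rewrite !mem_iota /= !add0n ltnS.
  by exists n, i; rewrite !mem_iota /= !add0n ltnS.
have mem_l b : (pos b \in l) = (projT1 b < N)%N.
  by rewrite mem_lc pos_valid andbT.
have l_valid c : c \in l -> (c.2 <= c.1)%N by rewrite mem_lc => /andP[].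
have sumB (r : seq (nat * nat)) : {subset r <= l} ->
    Bpq p q (fun b => \sum_(c <- r) g (at_pos c) * unit_vector c b : K) /\
    T (fun b => \sum_(c <- r) g (at_pos c) * unit_vector c b) =
    \sum_(c <- r) g (at_pos c) *: ev c.
  elim: r => [|c r IH] rl.
    rewrite big_nil (_ : (fun b => _) = fun=> 0); first by split; [exact: (Bpq0 hp q1)|exact: T0].
    by apply/funext => b; rewrite big_nil.
  have [|rB rT] := IH; first by move=> c' c'r; apply: rl; rewrite inE c'r orbT.
  have [uB _] := unitB (l_valid c (rl c (mem_head _ _))).
  rewrite big_cons (_ : (fun b => _) = fun b => g (at_pos c) * unit_vector c b +
    \sum_(c <- r) g (at_pos c) * unit_vector c b); last first.
    by apply/funext => b; rewrite big_cons.
  by split; [exact: (Bpq_lin hp q1 _ uB rB)|rewrite (T_lin _ uB rB) rT].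
have [hB hT] := sumB l (fun c cl => cl).
exists (\sum_(c <- l) g (at_pos c) *: ev c).
  rewrite big_seq_cond; apply: closed_span_sum => c /andP[cl _].
  rewrite /g /restrict_to at_posK ?l_valid//; case: ifP => Ac.
    by apply: closed_spanZ; apply: h => //; exact: l_valid.
  by rewrite scale0r; exact: closed_span0.
rewrite -hT -(T_sub gB hB); have dB := Bpq_sub gB hB.
apply: le_lt_trans (T_upper dB) _.
rewrite [X in Bpq_norm p q X](_ : _ = fun b => if (N <= projT1 b)%N then g b else 0).
  apply: le_lt_trans (ler_wpM2l (ltW C0) hN) _.
  have -> : C * (e / (2 * C)) = e / 2 by field; rewrite gt_eqF.
  by move: e0; lra.
apply/funext => b; case: leqP => bN.
  rewrite big_seq_cond big1 ?subr0// => c /andP[cl _]; rewrite /unit_vector.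
  case: eqP => [e'|_]; last by rewrite mulr0.
  by move: cl; rewrite -e' mem_l ltnNge bN.
rewrite (bigD1_seq (pos b)) ?mem_l//= posK /unit_vector eqxx mulr1.
rewrite big1 ?addr0 ?subrr// => c cb.
by rewrite eq_sym (negbTE cb) mulr0.
Qed.

Lemma linear_weighted_sum (L : X -> X) (y : nat -> X) (a : nat -> K) m k :
  (forall c f g, L (c *: f + g) = c *: L f + L g) ->
  L (\sum_(m <= j < k) a j *: y j) = \sum_(m <= j < k) a j *: L (y j).
Proof.
move=> Llin; have L0 : L 0 = 0.
  by have := Llin 1 0 0; rewrite !scale1r addr0 => /esym/eqP; rewrite -subr_eq0 addrK => /eqP.
elim/big_rec2: _ => [|j f g _ <-]; first exact: L0.
by rewrite Llin.
Qed.

(** Projections onto disjoint sets of positions are used in this form to verify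
    the hypothesis of interleave_basic. *)
Lemma separated (L : X -> X) (x y : nat -> X) (c : R) :
  (forall a f g, L (a *: f + g) = a *: L f + L g) ->
  (forall f, rnorm (L f) <= c * rnorm f) ->
  (forall j, L (x j) = x j) -> (forall j, L (y j) = 0) ->
  forall a b M N, rnorm (psum x a M) <= c * rnorm (psum x a M + psum y b N).
Proof.
move=> Llin Lc Lx Ly a b M N; apply: le_trans (Lc _).
have Ladd f g : L (f + g) = L f + L g by rewrite -{1}[f]scale1r Llin scale1r.
rewrite Ladd /psum (linear_weighted_sum x a 0 M Llin) (linear_weighted_sum y b 0 N Llin).
rewrite [X in _ + X]big1 => [|j _]; last by rewrite Ly scaler0.
by rewrite addr0; under [X in _ <= rnorm X]eq_bigr => j _ do rewrite Lx.
Qed.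

Local Notation es := (fun j => ev (lq_pos j)).
Local Notation eD := (fun j => ev (dyadic_pos j)).
Local Notation rho := (root2 q).

Let es_valid j : ((lq_pos j).2 <= (lq_pos j).1)%N. Proof. by []. Qed.

Lemma lq_upper u N : rnorm (psum es u N) <= C * qsum q u 0 N `^ q^-1.
Proof.
rewrite (psum_ev es_valid) -(lq_spread_norm hp q1).
exact: T_upper (Bpq_spread hp q1 u N es_valid).
Qed.

Lemma lq_lower u N : qsum q u 0 N `^ q^-1 <= C * rnorm (psum es u N).
Proof.
rewrite (psum_ev es_valid) -(lq_spread_norm hp q1).
exact: T_lower (Bpq_spread hp q1 u N es_valid).
Qed.

Definition dyadic_block (u : nat -> K) n : bidx -> K :=
  spread dyadic_pos (trunc (fun j => lo n <= j < lo n.+1)%N u) (lo n.+1).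

Lemma block_sum_dyadic u n : block_sum eD u n = T (dyadic_block u n).
Proof. by rewrite (block_sum_psum _ _ (ltnSn n)) (psum_ev dyadic_pos_valid). Qed.

Lemma dyadic_block_Bpq u n : Bpq p q (dyadic_block u n) /\
  Bpq_norm p q (dyadic_block u n) = lp_norm p (@block R s (dyadic_block u n) (2 ^ n).*2).
Proof.
apply: (Bpq_one_block hp q1) => b bn; rewrite /dyadic_block.
have [[j jn bj]|->//] := @spread_case R s dyadic_pos (lo n.+1) b dyadic_pos_inj.
rewrite (spread_at _ dyadic_pos_inj jn bj) /trunc; case: ifP => // /andP[h1 h2].
by move: bn; rewrite (congr1 fst bj : projT1 b = _) /= (lev_eq h1 h2) eqxx.
Qed.

Lemma dyadic_block_at u n j b : (lo n <= j < lo n.+1)%N -> pos b = dyadic_pos j ->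
  dyadic_block u n b = u j.
Proof.
move=> jn bj; have /andP[_ j2] := jn.
by rewrite /dyadic_block (spread_at _ dyadic_pos_inj j2 bj) /trunc jn.
Qed.

(** On the positions dyadic_pos the norm of a single block is the maximum norm or
    the sum norm of 2^n coordinates up to the factor C, where the summing basis or the difference
    basis is conditional. *)
Lemma exists_conditional_block_basis : exists d D, 0 < D /\
  conditional_block_basis eD d D.
Proof.
have CC : C <= C * C by rewrite ler_peMl ?(ltW C0).
have CC1 : 1 <= C * C by exact: le_trans C1 CC.
have CC0 : 0 < C * C by exact: mulr_gt0.
have lat := ev_lattice dyadic_pos_valid dyadic_pos_inj.
case: hp => pE.
- exists (summing_basis eD), (8 * (C * C) ^+ 3); split.
    by rewrite mulr_gt0 ?exprn_gt0.
  apply: linf_block_basis => //.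
  + move=> u n t t0 ut; rewrite block_sum_dyadic.
    have [B E] := dyadic_block_Bpq u n; apply: le_trans (T_upper B) _.
    rewrite E -mulrA ler_wpM2l ?(ltW C0)//; apply: le_trans (_ : t <= _); last first.
      by rewrite ler_peMl.
    rewrite pE; apply: bigmax_le => // i _; rewrite /block /dyadic_block.
    set b := existT _ _ _.
    have [[j jn bj]|->] := @spread_case R s dyadic_pos (lo n.+1) b dyadic_pos_inj.
      rewrite (spread_at _ dyadic_pos_inj jn bj) /trunc.
      by case: ifP => // _; rewrite rnorm0.
    by rewrite rnorm0.
  + move=> u n j jn; rewrite block_sum_dyadic; have [B _] := dyadic_block_Bpq u n.
    have := Bpq_coord hp q1 (at_pos (dyadic_pos j)) B.
    rewrite (dyadic_block_at u jn (at_posK (dyadic_pos_valid j))) => /le_trans; apply.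
    by apply: le_trans (T_lower B) _; rewrite ler_wpM2r ?rnorm_ge0.
- exists (diff_basis eD), (8 * (C * C) ^+ 3); split.
    by rewrite mulr_gt0 ?exprn_gt0.
  apply: l1_block_basis => //.
  + by move=> j; have /andP[_ h] := ev_norm dyadic_pos_valid j; exact: le_trans h CC.
  + move=> u n; rewrite block_sum_dyadic; have [B E] := dyadic_block_Bpq u n.
    apply: le_trans (_ : C * rnorm (T (dyadic_block u n)) <= _); last first.
      by rewrite ler_wpM2r ?rnorm_ge0.
    apply: le_trans (T_lower B); rewrite E pE lp_norm1E.
    pose G i := rnorm (dyadic_block u n (at_pos ((2 ^ n).*2, i))).
    rewrite (eq_bigr (fun i : 'I_(2 ^ n).*2.+1 => G i)); last first.
      by move=> i _; rewrite (block_at_pos (dyadic_block u n)).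
    rewrite -(big_mkord xpredT G) loS addnC -{1}[lo n]add0n big_addn addnK.
    have n2 : (2 ^ n < (2 ^ n).*2.+1)%N by rewrite ltnS -addnn leq_addr.
    rewrite (@big_cat_nat _ _ _ (2 ^ n).+1 0 (2 ^ n).*2.+1)//=.
    rewrite [X in _ <= X + _]big_ltn// [X in _ <= _ + X + _]big_add1 /=.
    rewrite -addrA addrCA -[leLHS]addr0; apply: lerD; last first.
      by rewrite addr_ge0 ?rnorm_ge0// sumr_ge0// => i _; exact: rnorm_ge0.
    apply: ler_sum_nat => i /andP[_ i2]; rewrite /G.
    have ib : (lo n <= i + lo n < lo n.+1)%N by rewrite leq_addl loS addnC ltn_add2l.
    rewrite (dyadic_block_at (j := (i + lo n)%N) u ib)//.
    have /andP[h1 h2] := ib.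
    rewrite at_posK /=; last by rewrite (leq_trans i2)// -addnn leq_addr.
    by rewrite /dyadic_pos (lev_eq h1 h2) addnK.
Qed.

Lemma basic_seq_le (x : nat -> X) (c c' : R) : basic_seq x c -> c <= c' -> basic_seq x c'.
Proof.
by move=> h cc a k N kN; apply: le_trans (h a k N kN) _; rewrite ler_wpM2r ?rnorm_ge0.
Qed.

Lemma linearly_conditional_le (x : nat -> X) (c c' : R) :
  linearly_conditional x c -> c <= c' -> linearly_conditional x c'.
Proof.
move=> h cc N N0; have [a [Q [pos le]]] := h N N0; exists a, Q; split=> //.
by apply: le_trans le _; rewrite ler_wpM2r ?rnorm_ge0.
Qed.

(** The directions that the new basis loses in each block, normalized. They enter
    y, so that the closed span of the new basis still contains all vectors es. *)
Definition lq_average m : X :=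
  real_scalar (rho ^+ m)^-1 *: \sum_(lo m <= j < lo m.+1) es j.

Lemma psum_lq_average a M : psum lq_average a M =
  psum es (fun j => real_scalar (rho ^+ lev j)^-1 * a (lev j)) (lo M).
Proof.
rewrite psum_block_sum /psum; apply: eq_bigr => m _.
rewrite /lq_average scalerA scaler_sumr; apply: eq_big_nat => j /andP[h1 h2].
by rewrite (lev_eq h1 h2) mulrC.
Qed.

Lemma lq_average_basic : basic_seq lq_average (C * C).
Proof.
move=> a k M kM; rewrite !psum_lq_average.
have := lattice_basic (ev_lattice es_valid lq_pos_inj); apply; exact: lo_homo.
Qed.

Lemma lq_average_norm m : C^-1 <= rnorm (lq_average m) <= C.
Proof.
pose u := trunc (fun j => lo m <= j < lo m.+1)%N (fun=> real_scalar (rho ^+ m)^-1 : K).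
have E : lq_average m = psum es u (lo m.+1).
  rewrite -(block_sum_psum _ _ (ltnSn m)) /lq_average scaler_sumr.
  by apply: eq_bigr => j _.
have Q : qsum q u 0 (lo m.+1) = 1.
  rewrite /qsum (@big_cat_nat _ _ _ (lo m))//= ?lo_homo//.
  rewrite big_nat_cond big1 ?add0r => [|j /andP[/andP[_ jm] _]]; last first.
    by rewrite /u /trunc leqNgt jm rnorm0 powR0// gt_eqF// (lt_trans ltr01).
  rewrite (eq_big_nat _ _ (F2 := fun=> (2 ^+ m)^-1)) => [|j jm].
    by rewrite sumr_const_nat size_block -[LHS]mulr_natl natrX divff// expf_neq0.
  rewrite /u /trunc jm rnorm_real gtr0_norm ?invr_gt0 ?root2X_gt0//.
  by rewrite -powR_inv1 ?(ltW (root2X_gt0 q1 _))// powRAC root2Xq// powR_inv1.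
apply/andP; split.
  rewrite -[C^-1]mulr1 ler_pdivrMl// E; apply: le_trans (lq_lower u _).
  by rewrite Q powR1.
by rewrite E; apply: le_trans (lq_upper u _) _; rewrite Q powR1 mulr1.
Qed.

Lemma lev_ltE j n : (lev j < n)%N = (j < lo n)%N.
Proof.
have /andP[_ h] := lev_bounds j; apply/idP/idP => [jn|]; last exact: lev_lt.
by apply: leq_trans h (lo_homo jn).
Qed.

(** Sequences constant on blocks disappear when averages are subtracted. *)
Lemma centered_addl (u g : nat -> K) j : mean u (lev j) = 0 ->
  centered (fun i => u i + g (lev i)) j = u j.
Proof.
move=> u0; rewrite /centered; set n := lev j.
rewrite /mean (eq_big_nat _ _ (F2 := fun i => u i + g n)); last first.
  by move=> i /andP[h1 h2]; rewrite (lev_eq h1 h2).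
rewrite big_split mulrDr -/(mean u n) u0 add0r (sum_block_const (_ : K^o)).
by rewrite mulrA -real_scalarM mulVf ?expf_neq0// real_scalar1 mul1r addrK.
Qed.

Lemma leq_quarter N : ((uphalf N)./2 <= N)%N.
Proof. lia. Qed.

Section WithBasis.
Variables (x : nat -> X) (B : R).
Hypothesis B1 : 1 <= B.
Hypothesis x_basic : basic_seq x B.
Hypothesis x_norm : forall j, B^-1 <= rnorm (x j) <= B.
Hypothesis x_dense : dense_span x.

Let B0 : 0 < B. Proof. exact: lt_le_trans ltr01 B1. Qed.

Definition copied_basis n : X := copy_shift (x n).

Lemma psum_copied a N : psum copied_basis a N = copy_shift (psum x a N).
Proof. by rewrite /psum (linear_weighted_sum x a 0 N shift_lin). Qed.

Let S := 3 * C ^+ 3.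
Let S0 : 0 < S. Proof. by rewrite mulr_gt0 ?exprn_gt0. Qed.

Lemma copied_basis_basic : basic_seq copied_basis (S * (B * S)).
Proof.
move=> a k N kN; rewrite !psum_copied; apply: le_trans (shift_le _) _.
rewrite -[leRHS]mulrA -[B * S * _]mulrA ler_wpM2l ?(ltW S0)//.
apply: le_trans (x_basic a kN) _.
rewrite ler_wpM2l ?(ltW B0)// -{1}[psum x a N]shiftK; exact: unshift_le.
Qed.

Lemma copied_basis_norm j : (S * B)^-1 <= rnorm (copied_basis j) <= S * B.
Proof.
have /andP[h1 h2] := x_norm j; apply/andP; split.
  rewrite invfM ler_pdivrMl//; apply: le_trans h1 _.
  by rewrite -{1}[x j]shiftK; exact: unshift_le.
by apply: le_trans (shift_le _) _; rewrite ler_wpM2l ?(ltW S0).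
Qed.

(** The sequence y interleaves the conditional basis on the dyadic positions, the
    averages of the l_q basis, the unit vectors at the remaining positions and the
    copy of the given basis of X inside X. The projections onto sets of positions
    separate these parts. With the l_q basis they span X, and the conditionality
    of the first part is preserved. *)
Theorem exists_dkk_data : exists y D, [/\ 1 <= D, C <= D, basic_seq y D,
    forall n, D^-1 <= rnorm (y n) <= D & linearly_conditional y D] /\
  [/\ forall u b N, (forall n, mean u n = 0) ->
        rnorm (psum es u (lo N)) <= D * rnorm (psum es u (lo N) + psum y b N),
      forall m, exists i, y i = lq_average m
    & forall z, (forall n, closed_span z (y n)) -> (forall j, closed_span z (es j)) ->
        dense_span z].
Proof.
have [d [E [E0 [d_basic d_norm d_cond d_span d_block]]]] := exists_conditional_block_basis.
have [iota iota_inj [iota_rest rest_iota]] := rest_enum.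
have iota_valid j : ((iota j).2 <= (iota j).1)%N by have /and4P[] := iota_rest j.
pose r j := ev (iota j).
pose y1 := interleave d lq_average; pose y2 := interleave r copied_basis.
pose y := interleave y1 y2.
have proj_d (A : pred (nat * nat)) : (forall c, dyadic_part c -> A c) ->
  forall j, part_proj A (d j) = d j.
  move=> dA j; have [u ->] := d_block j.
  rewrite /block_sum (linear_weighted_sum _ u _ _ (proj_lin A)).
  apply: eq_bigr => i _; rewrite (proj_ev A (dyadic_pos_valid i)) dA//.
  exact: dyadic_part_pos.
have proj_d0 (A : pred (nat * nat)) : (forall c, dyadic_part c -> ~~ A c) ->
  forall j, part_proj A (d j) = 0.
  move=> dA j; have [u ->] := d_block j.
  rewrite /block_sum (linear_weighted_sum _ u _ _ (proj_lin A)).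
  apply: big1 => i _; rewrite (proj_ev A (dyadic_pos_valid i)).
  by rewrite (negbTE (dA _ (dyadic_part_pos i))) scaler0.
have proj_Z (A : pred (nat * nat)) c f : part_proj A (c *: f) = c *: part_proj A f.
  have P0 : part_proj A 0 = 0.
    have := proj_lin A 1 0 0; rewrite !scale1r addr0 => /esym/eqP.
    by rewrite -subr_eq0 addrK => /eqP.
  by rewrite -[c *: f]addr0 proj_lin P0 addr0.
have proj_sum (A : pred (nat * nat)) m k : part_proj A (\sum_(m <= j < k) es j) =
  \sum_(m <= j < k) part_proj A (es j).
  have := linear_weighted_sum es (fun=> 1) m k (proj_lin A).
  under eq_bigr do rewrite scale1r; move=> ->; by under eq_bigr do rewrite scale1r.
have proj_a (A : pred (nat * nat)) : (forall c, lq_part c -> A c) ->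
  forall j, part_proj A (lq_average j) = lq_average j.
  move=> lA j; rewrite /lq_average proj_Z proj_sum; congr (_ *: _).
  by apply: eq_bigr => i _; rewrite (proj_ev A (es_valid i)) lA// lq_part_pos.
have proj_a0 (A : pred (nat * nat)) : (forall c, lq_part c -> ~~ A c) ->
  forall j, part_proj A (lq_average j) = 0.
  move=> lA j; rewrite /lq_average proj_Z proj_sum big1 ?scaler0// => i _.
  by rewrite (proj_ev A (es_valid i)) (negbTE (lA _ (lq_part_pos i))).
pose A12 c := dyadic_part c || lq_part c.
have lq_dyadic c : lq_part c -> ~~ dyadic_part c.
  by move=> h; apply/negP => /dyadic_lq; rewrite h.
have sep1 := separated (proj_lin dyadic_part) (proj_le dyadic_part)
   (proj_d dyadic_part (fun c h => h)) (proj_a0 dyadic_part lq_dyadic).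
have y1_fix j : part_proj A12 (y1 j) = y1 j.
  rewrite /y1 /interleave; case: ifP => _.
    by apply: proj_a => c h; rewrite /A12 h orbT.
  by apply: proj_d => c h; rewrite /A12 h.
have y2_kill (A : pred (nat * nat)) j : (forall c, A c -> A12 c) -> part_proj A (y2 j) = 0.
  move=> AA; rewrite /y2 /interleave; case: ifP => _.
    by apply: proj_shift => c /AA /orP[]; [exact: dyadic_copy|exact: lq_copy].
  rewrite (proj_ev A (iota_valid _)); case: ifP => // /AA.
  by have /and4P[_ _ /negbTE h1 /negbTE h2] := iota_rest j./2; rewrite /A12 h1 h2.
have sep2 := separated (proj_lin A12) (proj_le A12) y1_fix (fun j => y2_kill A12 j (fun c h => h)).
have r_fix j : part_proj rest_part (r j) = r j.
  by rewrite (proj_ev rest_part (iota_valid j)) iota_rest.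
have copied_kill j : part_proj rest_part (copied_basis j) = 0.
  by apply: proj_shift => c /and4P[].
have sep3 := separated (proj_lin rest_part) (proj_le rest_part) r_fix copied_kill.
have C3 : 0 < C ^+ 3 by rewrite exprn_gt0.
have CC : 0 < C * C by exact: mulr_gt0.
have SBS : 0 < S * (B * S) by rewrite !mulr_gt0.
have SB : 0 < S * B by rewrite mulr_gt0.
pose B2 := E + C * C + S * (B * S) + C ^+ 3.
have [le1 le2 le3 le4] : [/\ E <= B2, C * C <= B2, S * (B * S) <= B2 & C ^+ 3 <= B2].
  by rewrite /B2; move: (C ^+ 3) (C * C) (S * (B * S)) C3 CC SBS => a1 a2 a3 h1 h2 h3; split; lra.
have B20 : 0 < B2 by exact: lt_le_trans le1.
have y1_basic : basic_seq y1 (2 * B2 * B2 + B2).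
  apply: interleave_basic => //.
  - exact: (basic_seq_le d_basic le1).
  - exact: (basic_seq_le lq_average_basic le2).
  - by move=> a b M N; apply: le_trans (sep1 a b M N) _; rewrite ler_wpM2r ?rnorm_ge0.
have y2_basic : basic_seq y2 (2 * B2 * B2 + B2).
  apply: interleave_basic => //.
  - exact: (basic_seq_le (lattice_basic (ev_lattice iota_valid iota_inj)) le2).
  - exact: (basic_seq_le copied_basis_basic le3).
  - by move=> a b M N; apply: le_trans (sep3 a b M N) _; rewrite ler_wpM2r ?rnorm_ge0.
pose B3 := 2 * B2 * B2 + B2.
have B2B3 : B2 <= B3 by rewrite /B3 lerDr !mulr_ge0 ?(ltW B20).
have B30 : 0 < B3 by exact: lt_le_trans B2B3.
have y_basic : basic_seq y (2 * B3 * B3 + B3).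
  apply: interleave_basic => //.
  move=> a b M N; apply: le_trans (sep2 a b M N) _.
  by rewrite ler_wpM2r ?rnorm_ge0// (le_trans le4).
pose B4 := 2 * B3 * B3 + B3.
have B40 : 0 < B4 by rewrite /B4 addr_gt0// !mulr_gt0.
pose G := 8 * C * (C * C ^+ 3); have G0 : 0 < G by rewrite !mulr_gt0.
pose D := B4 + 4 * E + C + S * B + G.
have [D1 D2 D3 D4 D5] : [/\ B4 <= D, 4 * E <= D, C <= D, S * B <= D & G <= D].
  rewrite /D {D}; clearbody B4 G; move: (S * B) SB B40 G0 E0 C0 => a1 h1 h2 h3 h4 h5.
  by split; lra.
have ED : E <= D by move: E0 D2; lra.
have norm_D c f : 0 < c -> c <= D -> c^-1 <= rnorm f <= c -> D^-1 <= rnorm (f : X) <= D.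
  move=> c0 cD /andP[h1 h2]; rewrite (le_trans h2 cD) andbT; apply: le_trans h1.
  by rewrite lef_pV2 ?posrE// (lt_le_trans c0).
exists y, D; split; split=> //.
- exact: le_trans C1 D3.
- exact: (basic_seq_le y_basic D1).
- move=> n; rewrite /y /y1 /y2 /interleave; case: ifP => _; case: ifP => _.
  + exact: norm_D SB D4 (copied_basis_norm _).
  + exact: norm_D C0 D3 (ev_norm iota_valid _).
  + exact: norm_D C0 D3 (lq_average_norm _).
  + exact: norm_D E0 ED (d_norm _).
- apply: linearly_conditional_le D2; rewrite (_ : 4 * E = 2 * (2 * E)); last by ring.
  apply: interleave_conditional; first by rewrite mulr_ge0 ?(ltW E0).
  by apply: interleave_conditional => //; exact: ltW.
(* The projection onto the l_q positions keeps only the averages of y. These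
   are constant on blocks, and centering removes them. *)
- move=> u b N u0; set f := _ + _.
  have projD (A : pred (nat * nat)) g h : part_proj A (g + h) = part_proj A g + part_proj A h.
    by rewrite -{1}[g]scale1r proj_lin scale1r.
  have proj_psum (A : pred (nat * nat)) w a M : part_proj A (psum w a M) =
      psum (fun j => part_proj A (w j)) a M := linear_weighted_sum w a 0 M (proj_lin A).
  have psum0 (w : nat -> X) a M : (forall j, w j = 0) -> psum w a M = 0.
    by move=> w0; rewrite /psum big1// => j _; rewrite w0 scaler0.
  have [b3 [M [MN fE]]] : exists b3 M, (M <= N)%N /\
      part_proj lq_part f = psum es u (lo N) + psum lq_average b3 M.
    exists (fun i => b i.*2.+1.*2), (uphalf N)./2; split.
      exact: leq_quarter.
    rewrite /f projD /y psum_interleave projD /y1 psum_interleave projD !proj_psum.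
    rewrite [psum (fun j => part_proj _ (d j)) _ _]psum0;
      last exact: (proj_d0 lq_part (fun c h => dyadic_lq h)).
    rewrite [psum (fun j => part_proj _ (y2 j)) _ _]psum0; last first.
      by move=> j; apply: y2_kill => c h; rewrite /A12 h orbT.
    rewrite add0r addr0; congr (_ + _); apply: eq_bigr => j _; congr (_ *: _).
      by rewrite (proj_ev lq_part (es_valid j)) lq_part_pos.
    exact: proj_a.
  pose g n : K := if (n < M)%N then real_scalar (rho ^+ n)^-1 * b3 n else 0.
  pose v j := u j + g (lev j).
  have {}fE : part_proj lq_part f = psum es v (lo N).
    rewrite fE psum_lq_average -{1}(minn_idPr (lo_homo MN)) -psum_trunc -psumD.
    by apply: eq_psum => j _; rewrite /v /g /trunc lev_ltE.
  have cv j : centered v j = u j by exact: centered_addl (u0 _).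
  apply: le_trans (lq_upper u _) _.
  have -> : qsum q u 0 (lo N) = qsum q (centered v) 0 (lo N).
    by apply: eq_bigr => j _; rewrite cv.
  apply: (@le_trans _ _ (C * (8 * qsum q v 0 (lo N) `^ q^-1))).
    rewrite ler_wpM2l ?(ltW C0)// -root_qsumM ?qsum_ge0//.
    by apply: ler_root => //; [exact: qsum_ge0|exact: qsum_center].
  apply: (@le_trans _ _ (C * (8 * (C * (C ^+ 3 * rnorm f))))).
    rewrite !ler_wpM2l ?(ltW C0)//; apply: le_trans (lq_lower v _) _.
    by rewrite ler_wpM2l ?(ltW C0)// -fE; exact: proj_le.
  rewrite (_ : C * _ = G * rnorm f); last by rewrite /G; ring.
  by rewrite ler_wpM2r ?rnorm_ge0.
- move=> m; exists m.*2.+1.*2.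
  by rewrite /y interleave_even /y1 interleave_odd.
- move=> z zy zs.
  have zd j : closed_span z (d j).
    by have := zy j.*2.*2; rewrite /y interleave_even /y1 interleave_even.
  have zr j : closed_span z (r j).
    by have := zy j.*2.*2.+1; rewrite /y interleave_odd /y2 interleave_even.
  have zx j : closed_span z (copied_basis j).
    by have := zy j.*2.+1.*2.+1; rewrite /y interleave_odd /y2 interleave_odd.
  have zshift g : closed_span z (copy_shift g).
    apply: closed_span_closed => e e0.
    have [a [N hN]] := x_dense g (divr_gt0 e0 S0).
    exists (psum copied_basis a N).
      by apply: closed_span_sum => j _; exact: closed_spanZ.
    rewrite psum_copied; have -> : copy_shift g - copy_shift (psum x a N) =
        copy_shift (g - psum x a N).
      by rewrite -[in RHS]scaleN1r [in RHS]addrC shift_lin scaleN1r addrC.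
    by apply: le_lt_trans (shift_le _) _; rewrite mulrC -ltr_pdivlMr.
  move=> f; change (closed_span z f); rewrite [f]shift_decomposition; apply: closed_spanD => //.
  apply: (proj_closed_span (A := predC copy_pos)) => c cv /= cc.
  have [lc|lc] := boolP (lq_part c).
    have /andP[c1 /eqP c2] := lc; have -> : c = lq_pos c.1./2 by
      rewrite [LHS]surjective_pairing /lq_pos c2 even_halfK.
    exact: zs.
  have [/asboolP[l <-]|dc] := boolP (dyadic_part c); first exact: closed_span_sub zd (d_span l).
  have [|j <-] := rest_iota c; last exact: zr.
  by rewrite /rest_part cv cc lc dc.
Qed.

End WithBasis.
End Splitting.

(** * The almost greedy basis *)

Section Assembly.
Context {R : realType} {s : scalar_kind}.
Local Notation K := (scalar_field R s).
Variables (X : completeNormedModType K) (q : R).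
Hypothesis q1 : 1 < q.
Local Notation rho := (root2 q).

(** The sum of the block of level n is a multiple of y n. *)
Lemma closed_span_dkk_y (es y : nat -> X) n : closed_span (dkk q es y) (y n).
Proof.
have m1 m : mean (fun=> 1 : K) m = 1.
  rewrite /mean (sum_block_const (1 : K^o)) -[_ *: _]/(_ * _) mulr1 -real_scalarM.
  by rewrite mulVf ?expf_neq0// real_scalar1.
have E : block_part q es y (fun=> 1) n = real_scalar (rho ^+ n) *: y n.
  rewrite block_partE big1 => [|j _]; last by rewrite /centered m1 subrr scale0r.
  by rewrite add0r /wmean m1 mulr1.
have <- : real_scalar (rho ^+ n)^-1 *: block_part q es y (fun=> 1) n = y n.
  rewrite E scalerA -real_scalarM mulVf ?real_scalar1 ?scale1r//.
  by rewrite gt_eqF// root2X_gt0.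
apply: closed_spanZ; apply: closed_span_sum => j _.
by apply: closed_spanZ; exact: closed_span_gen.
Qed.

(** Once the block averages are among the terms of y, they can be added back. *)
Lemma closed_span_dkk_es (es y : nat -> X) j :
  (forall m, exists i, y i = real_scalar (rho ^+ m)^-1 *: \sum_(lo m <= j < lo m.+1) es j) ->
  closed_span (dkk q es y) (es j).
Proof.
move=> avg; set n := lev j; set S := \sum_(lo n <= i < lo n.+1) es i.
have zS : closed_span (dkk q es y) S.
  have [i yi] := avg n; have := closed_spanZ (real_scalar (rho ^+ n)) (closed_span_dkk_y es y i).
  by rewrite yi scalerA -real_scalarM mulfV ?gt_eqF ?root2X_gt0// real_scalar1 scale1r.
have -> : es j = dkk q es y j + real_scalar (2 ^+ n)^-1 *: S -
    real_scalar (rho ^+ n * (2 ^+ n)^-1) *: y n.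
  by rewrite /dkk addrAC addrK subrK.
apply: closed_spanB; last by apply: closed_spanZ; exact: closed_span_dkk_y.
by apply: closed_spanD; [exact: closed_span_gen|exact: closed_spanZ].
Qed.

Lemma banach_basis_constants (x : nat -> X) : banach_basis x -> exists B,
  [/\ 1 <= B, basic_seq x B, forall j, B^-1 <= rnorm (x j) <= B & dense_span x].
Proof.
move=> [x_basis [k [M [k0 kM]]]].
have x_neq0 j : x j != 0.
  by have /andP[h _] := kM j; rewrite -rnorm_gt0 (lt_le_trans k0).
have [C C0 hC] := basis_constant x_basis x_neq0.
have M0 : 0 <= M by have /andP[_] := kM 0%N; apply: le_trans; exact: rnorm_ge0.
have k10 : 0 < k^-1 by rewrite invr_gt0.
pose B := 1 + C + M + k^-1.
have [B1 BC BM Bk] : [/\ 1 <= B, C <= B, M <= B & k^-1 <= B].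
  by rewrite /B; move: (k^-1) k10 => k' k'0; split; lra.
exists B; split=> //.
- move=> a i N iN; have := hC _ _ (expansion_psum (x:=x) (a:=a) (N:=N)) i.
  by rewrite psum_trunc (minn_idPl iN) => /le_trans; apply; rewrite ler_wpM2r ?rnorm_ge0.
- move=> j; have /andP[h1 h2] := kM j; rewrite (le_trans h2 BM) andbT.
  by apply: le_trans h1; rewrite -[k]invrK lef_pV2 ?posrE// (lt_le_trans k10 Bk).
- move=> f e e0; have [a [fa _]] := x_basis f.
  have /expansionP/(_ _ e0)[N hN] := fa.
  by exists a, N; rewrite rnorm_distC hN.
Qed.

Lemma Bpq_complemented_constants (p : \bar R) : Bpq_complemented_in X p q ->
  exists (T : (bidx -> K) -> X) (P : {linear X -> X}) C,
  1 <= C /\ [/\ forall (a : K) f g, Bpq p q f -> Bpq p q g ->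
       T (fun b => a * f b + g b) = a *: T f + T g,
     forall f, Bpq p q f -> rnorm (T f) <= C * Bpq_norm p q f,
     forall f, Bpq p q f -> Bpq_norm p q f <= C * rnorm (T f) &
     [/\ forall v, rnorm (P v) <= C * rnorm v, forall v, P (P v) = P v &
         range P = T @` Bpq p q]].
Proof.
move=> [T [[T_lin [C hC] [k k0 hk]] [P [P_cont P_idem P_range]]]].
have [D D0 hD] := linear_rbounded P_cont.
have k10 : 0 < k^-1 by rewrite invr_gt0.
have C0 : 0 <= `|C| by [].
exists T, P, (1 + `|C| + k^-1 + D); split.
  by rewrite -!addrA lerDl !addr_ge0// ltW.
have w (t u : R) : 0 <= u -> t <= 1 + `|C| + k^-1 + D ->
  t * u <= (1 + `|C| + k^-1 + D) * u by move=> u0 h; rewrite ler_wpM2r.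
split=> //.
- move=> f fB; apply: le_trans (hC f fB) _; apply: w (Bpq_norm_ge0 _ _ _) _.
  apply: le_trans (ler_norm C) _; rewrite -!addrA addrCA lerDl.
  by rewrite !addr_ge0// ltW.
- move=> f fB; apply: (@le_trans _ _ (k^-1 * rnorm (T f))).
    by rewrite mulrC ler_pdivlMr// mulrC hk.
  apply: w (rnorm_ge0 _) _; rewrite addrAC lerDr.
  by rewrite !addr_ge0// ltW.
- split=> // v; apply: le_trans (hD v) _; apply: w (rnorm_ge0 _) _.
  by rewrite lerDr !addr_ge0// ltW.
Qed.

Theorem exists_almost_greedy_basis (p : \bar R) : p = +oo%E \/ p = 1%:E ->
  (exists x : nat -> X, banach_basis x) -> Bpq_complemented_in X p q ->
  exists x : nat -> X,
    [/\ banach_basis x, almost_greedy x,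
        equivalent_on [set m | (1 <= m)%N]%classic
          (fundamental_function x) (fun m => (m%:R `^ q^-1)%:E)
      & equivalent_on [set m | (2 <= m)%N]%classic
          (Lconst x) (fun m => (ln m%:R)%:E)].
Proof.
move=> hp [x0 /banach_basis_constants[B [B1 x0_basic x0_norm x0_dense]]].
move=> /Bpq_complemented_constants[T [P [C [C1 [T_lin T_upper T_lower]]]]].
move=> [P_bounded P_idem P_range].
have es_upper := lq_upper hp q1 T_lin T_upper.
have es_lower := lq_lower hp q1 T_lin T_lower.
have [y [D [[D1 CD y_basic y_norm y_cond] [es_y_sum avg gen]]]] :=
  exists_dkk_data hp q1 C1 T_lin T_upper T_lower P_bounded P_idem P_range
    B1 x0_basic x0_norm x0_dense.
pose es j : X := ev T (lq_pos j); pose z := dkk q es y.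
have D0 : 0 < D by exact: lt_le_trans D1.
have es_upper' u N : rnorm (psum es u N) <= D * qsum q u 0 N `^ q^-1.
  by apply: le_trans (es_upper u N) _; rewrite ler_wpM2r ?powR_ge0.
have es_lower' u N : qsum q u 0 N `^ q^-1 <= D * rnorm (psum es u N).
  by apply: le_trans (es_lower u N) _; rewrite ler_wpM2r ?rnorm_ge0.
have y_lower n : D^-1 <= rnorm (y n) by have /andP[] := y_norm n.
have y_upper n : rnorm (y n) <= D by have /andP[] := y_norm n.
have [c1 c1_gt0 z_basic] := dkk_basic q1 D1 es_upper' es_lower' y_basic y_lower y_upper es_y_sum.
have [c2 c2_gt0 z_threshold] := dkk_threshold q1 D1 es_upper' es_lower' y_basic y_lower y_upper
  es_y_sum.
have [c3 c3_gt0 z_upper] := dkk_upper q1 D1 es_upper' y_upper.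
have [c4 c4_ge0 z_cond_upper] :=
  dkk_conditionality_upper q1 D1 es_upper' es_lower' y_basic y_lower y_upper es_y_sum.
have z_dense : dense_span z.
  by apply: gen => [n|j]; [exact: closed_span_dkk_y|exact: closed_span_dkk_es].
pose c := c1 + c2 + c3 + c4 + D.
have [le1 le2 le3 le4 le5] : [/\ c1 <= c, c2 <= c, c3 <= c, c4 <= c & D <= c].
  by rewrite /c {c}; clear -c1_gt0 c2_gt0 c3_gt0 c4_ge0 D0; split; lra.
have c0 : 0 < c by exact: lt_le_trans le1.
have z_basic' : basic_seq z c by exact: basic_seq_le z_basic le1.
have z_threshold' N (g : nat -> K) (G : pred nat) t :
    0 < t -> (forall j, G j -> t <= rnorm (g j)) ->
    (forall j, ~~ G j -> rnorm (g j) <= t) ->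
    rnorm (psum z (trunc G g) (lo N)) <= c * rnorm (psum z g (lo N)) /\
    t * (\sum_(0 <= j < lo N) (G j)%:R) `^ q^-1 <= c * rnorm (psum z g (lo N)).
  move=> t0 h1 h2; have [h3 h4] := z_threshold N g G t t0 h1 h2.
  by split; [apply: le_trans h3 _|apply: le_trans h4 _]; rewrite ler_wpM2r ?rnorm_ge0.
have z_upper' N (h : nat -> K) (E : pred nat) t m :
    0 <= t -> (0 < m)%N -> (forall j, rnorm (h j) <= t * (E j)%:R) ->
    \sum_(0 <= j < lo N) (E j)%:R <= m%:R :> R ->
    rnorm (psum z h (lo N)) <= c * (t * m%:R `^ q^-1).
  move=> t0 m0 h1 h2; apply: le_trans (z_upper N h E t m t0 m0 h1 h2) _.
  by rewrite ler_wpM2r ?mulr_ge0 ?powR_ge0.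
have z_cond_upper' a (Q : pred nat) m :
    rnorm (psum z (trunc Q a) m) <= c * (lev m).+1%:R * rnorm (psum z a m).
  apply: le_trans (z_cond_upper a Q m) _.
  by rewrite ler_wpM2r ?rnorm_ge0// ler_wpM2r ?ler0n.
have z_cond_lower n : (0 < n)%N -> exists a (Q : pred nat), 0 < rnorm (psum z a (lo n)) /\
    n%:R * rnorm (psum z a (lo n)) <= c * rnorm (psum z (trunc Q a) (lo n)).
  move=> n0; have [b [Q [b0 hb]]] := y_cond n n0.
  have [a [E1 E2]] := dkk_conditionality_lower q1 es y b Q n.
  exists a, (fun j => Q (lev j)); rewrite E1 E2; split=> //.
  by apply: le_trans hb _; rewrite ler_wpM2r ?rnorm_ge0.
exists z; split.
- exact: banach_basis_of_estimates c0 z_basic' z_dense z_threshold' z_upper'.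
- exact: almost_greedy_of_estimates q1 c0 z_basic' z_dense z_threshold' z_upper'.
- exact: fundamental_function_of_estimates c0 z_threshold' z_upper'.
- exact: Lconst_of_estimates q1 c0 z_basic' z_dense z_threshold' z_upper' z_cond_upper'
  z_cond_lower.
Qed.
End Assembly.

Theorem theorem4p17 (R : realType) (s : scalar_kind)
  (X : completeNormedModType (scalar_field R s)) (q : R)
  (hX : exists x : nat -> X, banach_basis x)
  (hq : 1 < q)
  (hB : Bpq_complemented_in X +oo%E q \/ Bpq_complemented_in X 1%:E q) :
  exists x : nat -> X,
    [/\ banach_basis x,
        almost_greedy x,
        equivalent_on [set m | (1 <= m)%N]
          (fundamental_function x) (fun m => (m%:R `^ q^-1)%:E)
      & equivalent_on [set m | (2 <= m)%N]
          (Lconst x) (fun m => (ln m%:R)%:E)].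
Proof.
case: hB => h.
  exact: (exists_almost_greedy_basis hq (or_introl erefl) hX h).
exact: (exists_almost_greedy_basis hq (or_intror erefl) hX h).
Qed.
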